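(* If $X_\bullet$ is one of the following semi-simplicial sets, then its reduced simplicial bounded cohomology vanishes, $\widetilde H^q_{\mathrm{b,s}}(X_\bullet;\mathbb R)=0$, in the range of degrees $q\le c(X_\bullet)$, where $c(X_\bullet)$ is as indicated. (1) ($\mathrm{GL}_n$-complexes) (a) the Tits building $T^{\mathbb K}_n$ of type $\mathtt A_{n-1}$ of any field $\mathbb K$, with $c(X_\bullet)=n-3$; (b) the complex $X^n_\bullet$ of $R$-split injections into $R^n$ for any unital ring $R$, with $c(X_\bullet)=n-\mathrm{sr}(R)-1$, where $\mathrm{sr}(R)\in[1,\infty]$ is the Bass stable rank of $R$. (2) ($\mathrm{Aut}^\epsilon_n$-complexes) (a) the Tits building $T^{\omega,\mathbb K}_n$ of type $\mathtt C_n$ of any field $\mathbb K$, with $c(X_\bullet)=n-2$; (b) the complex of hyperbolic $(\epsilon,\Lambda)$-split injections into the $(\epsilon,\Lambda)$-quadratic module $\mathcal H^{\oplus n}$, for $R=\mathbb Z$ or $R$ any field of characteristic zero and $(\epsilon,\Lambda)$ any form parameter for $R$, with $c(X_\bullet)=\lfloor\frac{n-4}{2}\rfloor$.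
   Context: **Simplicial bounded cohomology.** For a semi-simplicial set $X_\bullet$ let $C_q(X_\bullet)=\mathbb R[X_q]$ with $\partial_q=\sum_{i=0}^q(-1)^i d_i$ and the $\ell^1$-norm. The reduced complex $\widetilde C_*(X_\bullet)$ is obtained by adding $\mathbb R$ (with the absolute value as norm) in degree $-1$, with $\partial_0$ mapping each vertex to $1$. The reduced simplicial bounded cohomology $\widetilde H^q_{\mathrm{b,s}}(X_\bullet;\mathbb R)$ is the cohomology of the complex of bounded linear functionals on $\widetilde C_*(X_\bullet)$ (degrees $q\ge-1$). A poset is regarded as a semi-simplicial set via its order complex: $p$-simplices are chains $x_0\lneq\dots\lneq x_p$, the $k$-th face omits $x_k$. **Tits buildings.** $T_n^{\mathbb K}$ is the poset of subspaces $0\ne V\subsetneq\mathbb K^n$ ordered by inclusion. $T_n^{\omega,\mathbb K}$ is the poset of nontrivial isotropic subspaces $0\neq V\subseteq\mathbb K^{2n}$ with respect to the standard symplectic form $\omega$, ordered by inclusion. **Stable rank.** A sequence $(v_1,\dots,v_k)$ in an $R$-module $M$ is unimodular if it is an ordered basis of a free direct summand of $M$; a vector $v\in R^l$ is unimodular if $\{v\}$ is a basis of a free direct summand of rank one. $R$ satisfies $(SR_l)$ if for every $l'\ge l$ and every unimodular column vector $(r_1,\dots,r_{l'})^T\in R^{l'}$ there are $t_1,\dots,t_{l'-1}\in R$ such that $(r_1+t_1r_{l'},\dots,r_{l'-1}+t_{l'-1}r_{l'})^T\in R^{l'-1}$ is unimodular. $\mathrm{sr}(R)$ is the smallest $l\ge1$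 such that $R$ satisfies $(SR_{l+1})$, and $\infty$ if there is none. **Complex of $R$-split injections.** Its $p$-simplices are the split injective $R$-module homomorphisms $R^{p+1}\to R^n$, and the $i$-th face map is precomposition with $R^p=R^i\oplus0\oplus R^{p-i}\to R^{p+1}$. **Quadratic modules.** A form parameter for $R$ is a pair $(\epsilon,\Lambda)$ with $\epsilon\in\{+1,-1\}$ and $\Lambda\subseteq R$ an additive subgroup with $\{a-\epsilon a: a\in R\}\subseteq\Lambda\subseteq\{a\in R: a+\epsilon a=0\}$. An $(\epsilon,\Lambda)$-quadratic module is a triple $\mathbf M=(M,\lambda,\mu)$ with $M$ an $R$-module, $\lambda:M\otimes M\to R$ bilinear with $\lambda(x,y)=\epsilon\lambda(y,x)$, and $\mu:M\to R/\Lambda$ a function with $\mu(ax)=a^2\mu(x)$ for $a\in R$, $x\in M$, and $\mu(x+y)-\mu(x)-\mu(y)\equiv\lambda(x,y)\bmod\Lambda$. Morphisms are $R$-linear maps preserving $\lambda$ and $\mu$; $\oplus$ is orthogonal direct sum. The hyperbolic module $\mathcal H$ has underlying module $R\{e,f\}$ with $\lambda(e,f)=1$, $\lambda(f,e)=\epsilon$, $\lambda(e,e)=\lambda(f,f)=0$, $\mu(e)=\mu(f)=0$. **Complex of hyperbolic split injections.** For a quadratic module $\mathbf M$, its $p$-simplices are the morphisms $\mathcal H^{\oplus p+1}\to\mathbf M$, and the $i$-th face map is precomposition with $\mathcal H^{\oplus p}=\mathcal H^{\oplus i}\oplus0\oplus\mathcal H^{\oplus p-i}\to\mathcal H^{\oplus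 p+1}$. *)

(* Defs.v *)
From HB Require Import structures.
From mathcomp Require Export all_boot all_order all_algebra.
From mathcomp Require Export boolp classical_sets functions reals.
From mathcomp Require Export constructive_ereal.
(* the notations of finmap and monalg clash with those of classical_sets *)
From mathcomp Require Export -(notations) finmap.
From mathcomp.multinomials Require Export -(notations) monalg.

Set Implicit Arguments.
Unset Strict Implicit.
Unset Printing Implicit Defensive.

Import Order.TTheory GRing.Theory Num.Theory.
Local Open Scope ring_scope.

(* The last field is d_i d_{j+1} = d_j d_i for i <= j. *)
Record semisimplicial := SemiSimplicial {
  simplices :> nat -> Type;
  face : forall p, 'I_p.+2 -> simplices p.+1 -> simplices p;
  face_face : forall p (i j : 'I_p.+2) (x : simplices p.+2), (i <= j)%N ->
    face i (face (lift ord0 j) x) = face j (face (widen_ord (leqnSn _) i) x)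
}.

Lemma lift_lift p (i j : 'I_p.+2) (k : 'I_p.+1) : (i <= j)%N ->
  lift (lift ord0 j) (lift i k) = lift (widen_ord (leqnSn _) i) (lift j k).
Proof.
move=> le_ij; apply: val_inj; rewrite /= /bump leq0n add1n.
case: (leqP i k) => hi; case: (leqP j k) => hj; rewrite ?add0n ?add1n.
- by rewrite ltnS hj (leqW hi).
- by rewrite ltnS leqNgt hj hi.
- by move: (leq_trans hi (leq_trans le_ij hj)); rewrite ltnn.
- by rewrite [(j < k)%N]ltnNge (ltnW hj) (leqNgt i k) hi.
Qed.

Section BoundedCohomology.
Variables (RR : realType) (X : semisimplicial).

(* [malg K RR] is the free [RR]-module on [K]. *)
Definition chain q : lmodType RR := malg {classic X q} RR.

Definition basis_chain q (x : X q) : chain q :=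
  mkmalgU (x : {classic X q}) (1 : RR).

Definition l1_norm q (c : chain q) : RR :=
  \sum_(x <- msupp c) `|mcoeff x c|.

Definition boundary q (c : chain q.+1) : chain q :=
  \sum_(x <- msupp c) mcoeff x c *:
    \sum_(i < q.+2) (-1) ^+ i *: basis_chain (face i x).

Definition augmentation (c : chain 0) : RR^o :=
  \sum_(x <- msupp c) mcoeff x c.

(* The index is shifted by one: [rchain k] is the reduced chain group in
   degree k - 1, and [rboundary k] goes from degree k to degree k - 1. *)
Definition rchain k : lmodType RR :=
  if k is q.+1 then chain q else RR^o.

Definition rnorm k : rchain k -> RR :=
  if k is q.+1 return rchain k -> RR then @l1_norm q else fun c => `|c|.

Definition rboundary k : rchain k.+1 -> rchain k :=
  if k is q.+1 return rchain k.+1 -> rchain k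
  then @boundary q else augmentation.

Local Open Scope classical_set_scope.

Definition bounded_cochain k : set (rchain k -> RR^o) :=
  [set f : rchain k -> RR^o |
    linear f /\ exists M : RR, forall c, `|f c : RR| <= M * rnorm c].

Definition bounded_cocycle k : set (rchain k -> RR^o) :=
  [set f : rchain k -> RR^o | @bounded_cochain k f /\ f \o @rboundary k = 0].

Definition bounded_coboundary k : set (rchain k -> RR^o) :=
  if k is j.+1 return set (rchain k -> RR^o)
  then [set g \o @rboundary j | g in @bounded_cochain j]
  else [set 0].

Definition cohomology_class k (z : rchain k -> RR^o) :
  set (rchain k -> RR^o) := [set z + b | b in @bounded_coboundary k].

(* the quotient cocycles / coboundaries in degree k - 1, as a set of cosets *)
Definition reduced_bH k : set (set (rchain k -> RR^o)) :=
  [set cohomology_class z | z in @bounded_cocycle k].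

(* Degrees below -1 are omitted: the complex is zero there. *)
Definition reduced_bH_vanishes_up_to (c : \bar int) : Prop :=
  forall k : nat, ((k%:Z - 1)%:E <= c)%E ->
    @reduced_bH k = [set cohomology_class 0].

End BoundedCohomology.

Arguments bounded_cochain : clear implicits.
Arguments bounded_cocycle : clear implicits.
Arguments bounded_coboundary : clear implicits.
Arguments reduced_bH : clear implicits.

Section OrderComplex.
Variables (d : Order.disp_t) (T : porderType d).

Record poset_chain p := PosetChain {
  vertex :> 'I_p.+1 -> T;
  vertex_lt : forall i j : 'I_p.+1, (i < j)%N -> (vertex i < vertex j)%O
}.

Lemma poset_chain_inj p (x y : poset_chain p) :
  (vertex x : 'I_p.+1 -> T) = y -> x = y.
Proof.
by case: x y => [x hx] [y hy] /= e; case: _ / e hy => hy; congr PosetChain;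
  exact: Prop_irrelevance.
Qed.

Lemma omit_lt p (k : 'I_p.+2) (x : poset_chain p.+1) (i j : 'I_p.+1) :
  (i < j)%N -> (x (lift k i) < x (lift k j))%O.
Proof.
move=> lt_ij; apply: vertex_lt.
by rewrite /= ltnNge leq_bump2 -ltnNge.
Qed.

Definition omit p (k : 'I_p.+2) (x : poset_chain p.+1) : poset_chain p :=
  PosetChain (@omit_lt p k x).

Lemma omit_omit p (i j : 'I_p.+2) (x : poset_chain p.+2) : (i <= j)%N ->
  omit i (omit (lift ord0 j) x) = omit j (omit (widen_ord (leqnSn _) i) x).
Proof.
move=> le_ij; apply: poset_chain_inj; apply/funext => k /=.
by rewrite lift_lift.
Qed.

Definition order_complex : semisimplicial := SemiSimplicial omit_omit.

End OrderComplex.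

Fact subspace_display : Order.disp_t.
Proof. exact: Order.Disp tt tt. Qed.

Section SubspacePoset.
Variables (K : fieldType) (V : vectType K) (P : pred {vspace V}).

Record subspace_of := SubspaceOf {
  carrier :> {vspace V};
  carrierP : P carrier
}.

HB.instance Definition _ := [isSub for carrier].
HB.instance Definition _ := [Choice of subspace_of by <:].

Definition subspace_le (U W : subspace_of) : bool := (U <= W)%VS.

Lemma subspace_le_refl : reflexive subspace_le.
Proof. by move=> U; exact: subvv. Qed.

Lemma subspace_le_anti : antisymmetric subspace_le.
Proof. by move=> U W h; apply/val_inj/eqP; rewrite eqEsubv. Qed.

Lemma subspace_le_trans : transitive subspace_le.
Proof. by move=> U W X; exact: subv_trans. Qed.

HB.instance Definition _ := Order.Le_isPOrder.Build subspace_display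
  subspace_of subspace_le_refl subspace_le_anti subspace_le_trans.

End SubspacePoset.

Definition tits_building_A (K : fieldType) (n : nat) : semisimplicial :=
  order_complex (subspace_of
    (fun U : {vspace 'cV[K]_n} => (U != 0%VS) && (U != fullv))).

Definition std_symplectic (K : fieldType) (n : nat) (x y : 'cV[K]_(n + n)) : K :=
  \sum_(i < n) (x (lshift n i) 0 * y (rshift n i) 0 -
                x (rshift n i) 0 * y (lshift n i) 0).

Definition isotropic (K : fieldType) (n : nat)
    (U : {vspace 'cV[K]_(n + n)}) : Prop :=
  forall x y, x \in U -> y \in U -> std_symplectic x y = 0.

Definition tits_building_C (K : fieldType) (n : nat) : semisimplicial :=
  order_complex (subspace_of
    (fun U : {vspace 'cV[K]_(n + n)} => (U != 0%VS) && `[< isotropic U >])).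

Section Unimodular.
Variables (R : pzRingType) (M : lmodType R).

Definition is_submodule (N : M -> Prop) : Prop :=
  [/\ N 0, forall x y, N x -> N y -> N (x + y) &
      forall (a : R) x, N x -> N (a *: x)].

Definition is_direct_summand (N : M -> Prop) : Prop :=
  is_submodule N /\
  exists N' : M -> Prop,
    [/\ is_submodule N', forall x, N x -> N' x -> x = 0 &
        forall x, exists y z, [/\ N y, N' z & x = y + z]].

Definition is_basis k (v : 'I_k -> M) (N : M -> Prop) : Prop :=
  (forall a : 'I_k -> R, \sum_i a i *: v i = 0 -> forall i, a i = 0) /\
  (forall x, N x <-> exists a : 'I_k -> R, x = \sum_i a i *: v i).

Definition unimodular k (v : 'I_k -> M) : Prop :=
  exists N : M -> Prop, is_direct_summand N /\ is_basis v N.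

End Unimodular.

(* Columns over [R] form a right [R]-module, i.e. a left module over the
   opposite ring [R^c], so that matrices over [R], in particular the elementary
   operations r_i + t_i r_l of (SR_l), act on them from the left by module
   homomorphisms. *)
Section StableRank.
Variable R : pzRingType.

Definition unimodular_col l (r : 'cV[R^c]_l) : Prop :=
  unimodular (fun _ : 'I_1 => r).

(* The length l' of the column is m + 1. *)
Definition SR (l : nat) : Prop :=
  forall m : nat, (l <= m.+1)%N ->
  forall r : 'cV[R]_m.+1, unimodular_col r ->
  exists t : 'I_m -> R,
    unimodular_col
      (\col_(i < m) (r (widen_ord (leqnSn m) i) 0 + t i * r ord_max 0 : R)).

Definition stable_rank : \bar int :=
  match pselect (exists l, (0 < l)%N && `[< SR l.+1 >]) with
  | left ex => (ex_minn ex)%:Z%:E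
  | right _ => +oo%E
  end.

End StableRank.

Lemma unlift_unlift p (i j : 'I_p.+2) (l : 'I_p.+3) : (i <= j)%N ->
  obind (unlift i) (unlift (lift ord0 j) l) =
  obind (unlift j) (unlift (widen_ord (leqnSn _) i) l).
Proof.
move=> le_ij; case: (unliftP (lift ord0 j) l) => [m ->|->] /=.
  case: (unliftP i m) => [k ->|->]; first by rewrite lift_lift // liftK /= liftK.
  suff -> : lift (lift ord0 j) i = widen_ord (leqnSn _) i.
    by rewrite !unlift_none.
  by apply: val_inj; rewrite /= /bump leq0n add1n ltnNge le_ij.
suff -> : lift ord0 j = lift (widen_ord (leqnSn _) i) j.
  by rewrite liftK /= unlift_none.
by apply: val_inj; rewrite /= /bump leq0n le_ij.
Qed.

Section SplitInjections.
Variables (R : pzRingType) (n : nat).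

(* the inclusion of R^p = R^i (+) 0 (+) R^(p-i) into R^(p+1) *)
Definition insert_zero p (i : 'I_p.+1) (x : 'cV[R^c]_p) : 'cV[R^c]_p.+1 :=
  \col_j oapp (fun k => x k 0) 0 (unlift i j).

Definition drop_coord p (i : 'I_p.+1) (x : 'cV[R^c]_p.+1) : 'cV[R^c]_p :=
  \col_j x (lift i j) 0.

Lemma insert_zero_linear p (i : 'I_p.+1) : linear (@insert_zero p i).
Proof.
move=> a x y; apply/matrixP => j k; rewrite !mxE.
by case: (unlift i j) => [l|] /=; rewrite ?mxE ?mulr0 ?addr0.
Qed.

Lemma drop_coord_linear p (i : 'I_p.+1) : linear (@drop_coord p i).
Proof. by move=> a x y; apply/matrixP => j k; rewrite !mxE. Qed.

Lemma insert_zeroK p (i : 'I_p.+1) : cancel (insert_zero i) (drop_coord i).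
Proof. by move=> x; apply/matrixP => j k; rewrite !mxE liftK /= ord1. Qed.

Lemma insert_insert p (i j : 'I_p.+2) (x : 'cV[R^c]_p.+1) : (i <= j)%N ->
  insert_zero (lift ord0 j) (insert_zero i x) =
  insert_zero (widen_ord (leqnSn _) i) (insert_zero j x).
Proof.
move=> le_ij; apply/matrixP => l k; rewrite !mxE.
have e q (h : 'I_q.+2) (o : option 'I_q.+2) (z : 'cV[R^c]_q.+1) :
    oapp (fun m => insert_zero h z m 0) 0 o =
    oapp (fun m => z m 0) 0 (obind (unlift h) o).
  by case: o => //= m; rewrite mxE.
by rewrite !e unlift_unlift.
Qed.

Record split_injection p := SplitInjection {
  sinj_fun :> 'cV[R^c]_p -> 'cV[R^c]_n;
  sinj_linear : linear sinj_fun;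
  sinj_split : exists g : 'cV[R^c]_n -> 'cV[R^c]_p,
    linear g /\ cancel sinj_fun g
}.

Lemma split_injection_inj p (f g : split_injection p) :
  (f : _ -> _) = g -> f = g.
Proof.
case: f g => [f lf sf] [g lg sg] /= e; case: _ / e lg sg => lg sg.
by congr SplitInjection; exact: Prop_irrelevance.
Qed.

Section Face.
Variables (p : nat) (i : 'I_p.+1) (f : split_injection p.+1).

Lemma sinj_face_linear : linear (f \o insert_zero i).
Proof. by move=> a x y /=; rewrite insert_zero_linear sinj_linear. Qed.

Lemma sinj_face_split : exists g : 'cV[R^c]_n -> 'cV[R^c]_p,
  linear g /\ cancel (f \o insert_zero i) g.
Proof.
have [g [lg gK]] := sinj_split f.
exists (drop_coord i \o g); split; last exact: can_comp gK (@insert_zeroK p i).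
by move=> a x y /=; rewrite lg drop_coord_linear.
Qed.

Definition sinj_face : split_injection p :=
  SplitInjection sinj_face_linear sinj_face_split.

End Face.

Lemma sinj_face_face p (i j : 'I_p.+2) (f : split_injection p.+3) :
  (i <= j)%N ->
  sinj_face i (sinj_face (lift ord0 j) f) =
  sinj_face j (sinj_face (widen_ord (leqnSn _) i) f).
Proof.
move=> le_ij; apply: split_injection_inj; apply/funext => x /=.
by rewrite insert_insert.
Qed.

Definition split_injections : semisimplicial :=
  @SemiSimplicial (fun p => split_injection p.+1)
    (fun p i => @sinj_face p.+1 i) sinj_face_face.

End SplitInjections.

Record form_parameter (R : comPzRingType) := FormParameter {
  fp_eps : R;
  fp_Lambda : zmodClosed R;
  fp_epsP : fp_eps = 1 \/ fp_eps = -1;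
  fp_min : forall a, a - fp_eps * a \in fp_Lambda;
  fp_max : forall a, a \in fp_Lambda -> a + fp_eps * a = 0
}.

Section QuadraticModules.
Variables (R : comPzRingType) (P : form_parameter R).

Local Notation eps := (fp_eps P).
Local Notation Lambda := (fp_Lambda P).

Definition mod_Lambda : zmodType := Quotient.quot Lambda.

Definition to_mod_Lambda : R -> mod_Lambda := \pi_(Quotient.quot Lambda)%qT.

Lemma to_mod_LambdaD a b :
  to_mod_Lambda (a + b) = to_mod_Lambda a + to_mod_Lambda b.
Proof. exact: raddfD. Qed.

(* The axiom [qm_muZ] is mu(ax) = a^2 mu(x), where a^2 acts on R/Lambda through
   a representative b of mu(x). If a^2 Lambda is contained in Lambda, which is
   automatic when R is the ring of integers or a field of characteristic zero,
   the choice of b is irrelevant. *)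
Record quadratic_module := QuadraticModule {
  qm_carrier :> lmodType R;
  qm_lambda : qm_carrier -> qm_carrier -> R;
  qm_mu : qm_carrier -> mod_Lambda;
  qm_lambda_linearl : forall (a : R) x x' y,
    qm_lambda (a *: x + x') y = a * qm_lambda x y + qm_lambda x' y;
  qm_lambda_linearr : forall (a : R) x y y',
    qm_lambda x (a *: y + y') = a * qm_lambda x y + qm_lambda x y';
  qm_lambdaC : forall x y, qm_lambda x y = eps * qm_lambda y x;
  qm_muZ : forall (a : R) x, exists2 b : R,
    qm_mu x = to_mod_Lambda b & qm_mu (a *: x) = to_mod_Lambda (a ^+ 2 * b);
  qm_muD : forall x y,
    qm_mu (x + y) - qm_mu x - qm_mu y = to_mod_Lambda (qm_lambda x y)
}.

Record qm_morphism (M N : quadratic_module) := QmMorphism {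
  qmm_fun :> M -> N;
  qmm_linear : linear qmm_fun;
  qmm_lambda : forall x y, qm_lambda (qmm_fun x) (qmm_fun y) = qm_lambda x y;
  qmm_mu : forall x, qm_mu (qmm_fun x) = qm_mu x
}.

Lemma qm_morphism_inj (M N : quadratic_module) (f g : qm_morphism M N) :
  (f : M -> N) = g -> f = g.
Proof.
case: f g => [f f1 f2 f3] [g g1 g2 g3] /= e; case: _ / e g1 g2 g3 => g1 g2 g3.
by congr QmMorphism; exact: Prop_irrelevance.
Qed.

Lemma qmm_comp_linear (M N L : quadratic_module) (g : qm_morphism N L)
  (f : qm_morphism M N) : linear (g \o f).
Proof. by move=> a x y /=; rewrite !qmm_linear. Qed.

Lemma qmm_comp_lambda (M N L : quadratic_module) (g : qm_morphism N L)
  (f : qm_morphism M N) x y :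
  qm_lambda ((g \o f) x) ((g \o f) y) = qm_lambda x y.
Proof. by rewrite /= !qmm_lambda. Qed.

Lemma qmm_comp_mu (M N L : quadratic_module) (g : qm_morphism N L)
  (f : qm_morphism M N) x : qm_mu ((g \o f) x) = qm_mu x.
Proof. by rewrite /= !qmm_mu. Qed.

Definition qmm_comp (M N L : quadratic_module) (g : qm_morphism N L)
    (f : qm_morphism M N) : qm_morphism M L :=
  QmMorphism (qmm_comp_linear g f) (qmm_comp_lambda g f) (qmm_comp_mu g f).

(* In the hyperbolic module, the pair (a, b) stands for a e + b f. *)
Definition hyp_lambda (x y : (R^o * R^o)%type) : R :=
  x.1 * y.2 + eps * (x.2 * y.1).

(* forced by mu(e) = mu(f) = 0 and lambda(e, f) = 1 *)
Definition hyp_mu (x : (R^o * R^o)%type) : mod_Lambda :=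
  to_mod_Lambda (x.1 * x.2 : R).

Lemma eps_sqr : eps * eps = 1.
Proof. by case: (fp_epsP P) => ->; rewrite ?mulrNN mulr1. Qed.

Lemma hyp_lambda_linearl (a : R) (x x' y : (R^o * R^o)%type) :
  hyp_lambda (a *: x + x') y = a * hyp_lambda x y + hyp_lambda x' y.
Proof.
rewrite /hyp_lambda /=; rewrite /GRing.scale /=.
rewrite !mulrDl !mulrDr -!mulrA [eps * (a * _)]mulrCA.
by rewrite -!addrA; congr (_ + _); rewrite addrCA.
Qed.

Lemma hyp_lambdaC (x y : (R^o * R^o)%type) :
  hyp_lambda x y = eps * hyp_lambda y x.
Proof.
rewrite /hyp_lambda mulrDr [eps * (eps * _)]mulrA eps_sqr mul1r addrC.
by rewrite [y.2 * _]mulrC [y.1 * _]mulrC.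
Qed.

Lemma hyp_lambda_linearr (a : R) (x y y' : (R^o * R^o)%type) :
  hyp_lambda x (a *: y + y') = a * hyp_lambda x y + hyp_lambda x y'.
Proof.
by rewrite 3![hyp_lambda x _]hyp_lambdaC hyp_lambda_linearl mulrDr mulrCA.
Qed.

Lemma hyp_muZ (a : R) (x : (R^o * R^o)%type) : exists2 b : R,
  hyp_mu x = to_mod_Lambda b & hyp_mu (a *: x) = to_mod_Lambda (a ^+ 2 * b).
Proof.
by exists (x.1 * x.2) => //; rewrite /hyp_mu /= /GRing.scale /= mulrACA expr2.
Qed.

Lemma hyp_muD (x y : (R^o * R^o)%type) :
  hyp_mu (x + y) - hyp_mu x - hyp_mu y = to_mod_Lambda (hyp_lambda x y).
Proof.
apply/eqP; rewrite !subr_eq -!to_mod_LambdaD /hyp_mu /to_mod_Lambda.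
rewrite -Quotient.idealrBE /hyp_lambda /=.
rewrite (_ : _ - _ = x.2 * y.1 - eps * (x.2 * y.1)); first exact: fp_min.
rewrite mulrDl !mulrDr [y.1 * x.2]mulrC; apply: (canLR (addrK _)).
set E := eps * _; rewrite [X in _ = _ + (X + _ + _)]addrC -!addrA addKr.
by rewrite addrC -!addrA addrCA.
Qed.

Definition hyperbolic : quadratic_module :=
  QuadraticModule hyp_lambda_linearl hyp_lambda_linearr hyp_lambdaC
    hyp_muZ hyp_muD.

Section Power.
Variables (M : quadratic_module) (k : nat).

Definition pow_lambda (x y : {ffun 'I_k -> M}) : R :=
  \sum_i qm_lambda (x i) (y i).

Definition pow_mu (x : {ffun 'I_k -> M}) : mod_Lambda := \sum_i qm_mu (x i).

Lemma pow_lambda_linearl (a : R) (x x' y : {ffun 'I_k -> M}) :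
  pow_lambda (a *: x + x') y = a * pow_lambda x y + pow_lambda x' y.
Proof.
rewrite /pow_lambda mulr_sumr -big_split; apply: eq_bigr => i _ /=.
by rewrite !ffunE qm_lambda_linearl.
Qed.

Lemma pow_lambda_linearr (a : R) (x y y' : {ffun 'I_k -> M}) :
  pow_lambda x (a *: y + y') = a * pow_lambda x y + pow_lambda x y'.
Proof.
rewrite /pow_lambda mulr_sumr -big_split; apply: eq_bigr => i _ /=.
by rewrite !ffunE qm_lambda_linearr.
Qed.

Lemma pow_lambdaC (x y : {ffun 'I_k -> M}) :
  pow_lambda x y = eps * pow_lambda y x.
Proof.
by rewrite /pow_lambda mulr_sumr; apply: eq_bigr => i _; exact: qm_lambdaC.
Qed.

Lemma pow_muZ (a : R) (x : {ffun 'I_k -> M}) : exists2 b : R,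
  pow_mu x = to_mod_Lambda b & pow_mu (a *: x) = to_mod_Lambda (a ^+ 2 * b).
Proof.
pose K u v := exists2 b : R, u = to_mod_Lambda b & v = to_mod_Lambda (a ^+ 2 * b).
apply: (big_ind2 K) => [|u u' v v' [b -> ->] [c -> ->]|i _].
- by exists 0; rewrite ?mulr0 /to_mod_Lambda raddf0.
- by exists (b + c); rewrite ?mulrDr to_mod_LambdaD.
by rewrite ffunE; exact: qm_muZ.
Qed.

Lemma pow_muD (x y : {ffun 'I_k -> M}) :
  pow_mu (x + y) - pow_mu x - pow_mu y = to_mod_Lambda (pow_lambda x y).
Proof.
rewrite /pow_mu -!sumrB /pow_lambda.
rewrite (big_morph to_mod_Lambda to_mod_LambdaD (raddf0 _)).
by apply: eq_bigr => i _; rewrite ffunE qm_muD.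
Qed.

Definition qm_power : quadratic_module :=
  QuadraticModule pow_lambda_linearl pow_lambda_linearr pow_lambdaC
    pow_muZ pow_muD.

End Power.

Section Insert.
Variables (M : quadratic_module) (p : nat) (i : 'I_p.+1).

(* the inclusion of M^p = M^i (+) 0 (+) M^(p-i) into M^(p+1) *)
Definition qm_insert_fun (x : qm_power M p) : qm_power M p.+1 :=
  [ffun j => oapp x 0 (unlift i j)].

Lemma qm_insert_linear : linear qm_insert_fun.
Proof.
move=> a x y; apply/ffunP => j; rewrite !ffunE.
by case: (unlift i j) => [l|] /=; rewrite ?ffunE ?scaler0 ?addr0.
Qed.

Lemma qm_lambda0l (y : M) : qm_lambda 0 y = 0.
Proof.
by have := qm_lambda_linearl (-1) 0 0 y; rewrite scaler0 addr0 mulN1r addNr.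
Qed.

Lemma qm_mu0 : qm_mu (0 : M) = 0.
Proof.
have [b _] := qm_muZ 0 (0 : M).
by rewrite scaler0 expr0n mul0r => ->; rewrite /to_mod_Lambda raddf0.
Qed.

Lemma qm_insert_lambda (x y : qm_power M p) :
  qm_lambda (qm_insert_fun x) (qm_insert_fun y) = qm_lambda x y.
Proof.
rewrite /= /pow_lambda (bigD1_ord i) //= !ffunE unlift_none /= qm_lambda0l add0r.
by apply: eq_bigr => j _; rewrite !ffunE liftK.
Qed.

Lemma qm_insert_mu (x : qm_power M p) : qm_mu (qm_insert_fun x) = qm_mu x.
Proof.
rewrite /= /pow_mu (bigD1_ord i) //= !ffunE unlift_none /= qm_mu0 add0r.
by apply: eq_bigr => j _; rewrite !ffunE liftK.
Qed.

Definition qm_insert : qm_morphism (qm_power M p) (qm_power M p.+1) :=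
  QmMorphism qm_insert_linear qm_insert_lambda qm_insert_mu.

End Insert.

Lemma qm_insert_insert (M : quadratic_module) p (i j : 'I_p.+2)
  (x : qm_power M p.+1) : (i <= j)%N ->
  qm_insert M (lift ord0 j) (qm_insert M i x) =
  qm_insert M (widen_ord (leqnSn _) i) (qm_insert M j x).
Proof.
move=> le_ij; apply/ffunP => l; rewrite !ffunE.
have e q (h : 'I_q.+2) (o : option 'I_q.+2) (z : qm_power M q.+1) :
    oapp (qm_insert M h z) 0 o = oapp z 0 (obind (unlift h) o).
  by case: o => //= m; rewrite ffunE.
by rewrite !e unlift_unlift.
Qed.

Section HyperbolicSplitInjections.
Variable M : quadratic_module.

Definition hyp_face p (i : 'I_p.+1)
    (f : qm_morphism (qm_power hyperbolic p.+1) M) :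
    qm_morphism (qm_power hyperbolic p) M :=
  qmm_comp f (qm_insert hyperbolic i).

Lemma hyp_face_face p (i j : 'I_p.+2)
  (f : qm_morphism (qm_power hyperbolic p.+3) M) : (i <= j)%N ->
  hyp_face i (hyp_face (lift ord0 j) f) =
  hyp_face j (hyp_face (widen_ord (leqnSn _) i) f).
Proof.
move=> le_ij; apply: qm_morphism_inj; apply/funext => x.
exact: (congr1 f (qm_insert_insert x le_ij)).
Qed.

Definition hyperbolic_split_injections : semisimplicial :=
  @SemiSimplicial (fun p => qm_morphism (qm_power hyperbolic p.+1) M)
    (fun p i => @hyp_face p.+1 i) hyp_face_face.

End HyperbolicSplitInjections.
End QuadraticModules.

(* Main.v *)
From HB Require Import structures.
Require Import Defs.
From mathcomp Require Import ring zify.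
Import Order.TTheory.
Import GRing.Theory Num.Theory.
Local Open Scope ring_scope.

Set Implicit Arguments.
Unset Strict Implicit.
Unset Printing Implicit Defensive.

(** A simplex of each of the five complexes is encoded by the list of its
    vertices, the empty list being the simplex of degree -1. A complex then
    becomes a set of lists closed under sublists, and its reduced chain complex
    a subcomplex of the free module on all lists.

    If there is a contracting homotopy [h] up to a given degree that sends
    every simplex to a chain of l1-norm at most a constant, then a bounded
    cocycle [f] equals [(f \o h) \o d], so it is the coboundary of a bounded
    cochain ([bounded_coboundary_of_contractible]). So it is enough to prove
    the classical acyclicity of the complexes with uniformly bounded fillings.
    This is why all the contractibility results below provide their constant
    before the poset, module or sequence that they concern: an induction that
    uses infinitely many links at once needs one bound for all of them.

    There are two sources of homotopies, cones ([cone_contractible],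
    [head_cone_contractible]) and the reduction [push_contractible] from a
    complex to its full subcomplex on a set [X] of vertices. The latter only
    needs homotopies on the links in [X] of the simplices [u] that end outside
    [X], in a range shortened by the size of [u], and it only multiplies norms by
    a constant.

    For type A, an interval (A, B) of subspaces is compared with the cone of the
    subspaces that contain L, where L covers A: first the V with V + L < B are
    added, whose links are cones with apex V + L, then the complements of L, whose
    links are smaller intervals. For type C, one starts from the isotropic
    subspaces that contain L = A + <x>, adds those orthogonal to x (apex V + L),
    then the others except those that cover A (apex the intersection of V with
    the orthogonal of x), and finally those that cover A, whose links are
    smaller buildings of type C.

    For split injections, that is for unimodular sequences, the argument is the
    one of van der Kallen. One fixes a sequence that every simplex has to
    complete, and proves the claim at the same time for the vertices in a free
    module W and for those in the union of W and a translate W + b. The stable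
    range condition moves a fixed vector y to a basis vector of W modulo vectors
    that do not matter ([reduce_frame]), after which completing y means dropping
    one coordinate of W.

    For hyperbolic split injections, the argument is the one of Galatius and
    Randal-Williams: given a hyperbolic pair (e, f) one passes from all pairs to
    those orthogonal to e, then to those orthogonal to e and f, where (e, f) is a
    cone point. What makes the links large is that the kernel of a linear form on
    a module with g orthogonal hyperbolic pairs contains g - 1 of them
    ([genus_ker]), by the Euclidean algorithm; this holds over the integers and,
    with a trivial algorithm, over fields. *)

(** * Finitely supported chains *)

Section FreeModule.
Variables (RR : realType) (K : choiceType).
Local Notation A := (malg K RR).
Implicit Types (c d : A) (x : K).

Definition unit_chain x : A := mkmalgU x 1.
Local Notation gen := unit_chain.

Definition supported (P : K -> Prop) c := forall x, x \in msupp c -> P x.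

Definition norm1 c : RR := \sum_(x <- msupp c) `|mcoeff x c|.

Lemma mkmalgU_gen a x : mkmalgU x a = a *: gen x.
Proof. by apply/malgP => y; rewrite mcoeffZ !mcoeffU; case: eqP; rewrite ?mulr1 ?mulr0. Qed.

Lemma support_ind c (Q : A -> Prop) : Q 0 ->
  (forall a x d, x \in msupp c -> Q d -> Q (a *: gen x + d)) -> Q c.
Proof.
move=> Q0 QS; rewrite [c]monalgE big_seq_cond; apply: big_rec => // x d.
by rewrite andbT => xc Qd; rewrite mkmalgU_gen; apply: QS.
Qed.

Lemma gen_ind (Q : A -> Prop) : Q 0 ->
  (forall a x d, Q d -> Q (a *: gen x + d)) -> forall c, Q c.
Proof. by move=> Q0 QS c; apply: support_ind => [//|a x d _]; exact: QS. Qed.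

Lemma supported0 P : supported P 0.
Proof. by move=> x; rewrite msupp0 in_fset0. Qed.

Lemma supportedD P c d : supported P c -> supported P d -> supported P (c + d).
Proof.
move=> Pc Pd x /(fsubsetP (msuppD_le _ _)); rewrite in_fsetU.
by case/orP; [exact: Pc | exact: Pd].
Qed.

Lemma supportedZ P a c : supported P c -> supported P (a *: c).
Proof. by move=> Pc x /(fsubsetP (msuppZ_le _ _)); exact: Pc. Qed.

Lemma supportedN P c : supported P c -> supported P (- c).
Proof. by move=> Pc x; rewrite msuppN; exact: Pc. Qed.

Lemma supportedB P c d : supported P c -> supported P d -> supported P (c - d).
Proof. by move=> Pc Pd; apply: supportedD => //; exact: supportedN. Qed.

Lemma supported_gen (P : K -> Prop) x : P x -> supported P (gen x).
Proof. by move=> Px y; rewrite /unit_chain msuppU oner_eq0 in_fset1 => /eqP ->. Qed.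

Lemma supportedW (P Q : K -> Prop) c :
  (forall x, P x -> Q x) -> supported P c -> supported Q c.
Proof. by move=> PQ Pc x /Pc /PQ. Qed.

Lemma supported_sum P I (r : seq I) (E : I -> A) :
  (forall i, supported P (E i)) -> supported P (\sum_(i <- r) E i).
Proof.
by move=> PE; apply: big_ind => //; [exact: supported0 | exact: supportedD].
Qed.

Lemma norm1E c (D : finSet K) : fsubset (msupp c) D ->
  norm1 c = \sum_(x <- D) `|mcoeff x c|.
Proof.
move=> cD; rewrite /norm1 (big_fset_incl _ cD) // => x _ xc.
by rewrite mcoeff_outdom ?normr0.
Qed.

Lemma norm1_ge0 c : 0 <= norm1 c.
Proof. by apply: sumr_ge0 => x _. Qed.

Lemma norm10 : norm1 0 = 0.
Proof. by rewrite /norm1 msupp0 big_seq_fset0. Qed.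

Lemma norm1D c d : norm1 (c + d) <= norm1 c + norm1 d.
Proof.
rewrite (norm1E (fsubsetUl (msupp c) (msupp d))).
rewrite (norm1E (fsubsetUr (msupp c) (msupp d))) (norm1E (msuppD_le _ _)).
by rewrite -big_split; apply: ler_sum => x _; rewrite mcoeffD ler_normD.
Qed.

Lemma norm1_sum n (E : 'I_n -> A) :
  norm1 (\sum_(i < n) E i) <= \sum_(i < n) norm1 (E i).
Proof.
elim: n E => [|n IH] E; first by rewrite !big_ord0 norm10.
by rewrite !big_ord_recl (le_trans (norm1D _ _)) // lerD2l.
Qed.

Lemma norm1Z a c : norm1 (a *: c) = `|a| * norm1 c.
Proof.
rewrite (norm1E (msuppZ_le _ _)) mulr_sumr; apply: eq_bigr => x _.
by rewrite mcoeffZ normrM.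
Qed.

Lemma norm1N c : norm1 (- c) = norm1 c.
Proof. by rewrite -scaleN1r norm1Z normrN1 mul1r. Qed.

Lemma norm1B c d : norm1 (c - d) <= norm1 c + norm1 d.
Proof. by rewrite (le_trans (norm1D _ _)) ?norm1N. Qed.

Lemma norm1_gen x : norm1 (gen x) = 1.
Proof. by rewrite /norm1 /unit_chain msuppU oner_eq0 big_seq_fset1 mcoeffUU normr1. Qed.

Section Extension.
Variables (M : lmodType RR).
Implicit Type phi : K -> M.

Definition lin phi c : M := \sum_(x <- msupp c) mcoeff x c *: phi x.

Lemma linE phi c (D : finSet K) : fsubset (msupp c) D ->
  lin phi c = \sum_(x <- D) mcoeff x c *: phi x.
Proof.
move=> cD; rewrite /lin (big_fset_incl _ cD) // => x _ xc.
by rewrite mcoeff_outdom ?scale0r.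
Qed.

Lemma lin_sum phi c : lin phi c = \sum_(x <- msupp c) mcoeff x c *: phi x.
Proof. by []. Qed.

Lemma lin_is_linear phi : linear (lin phi).
Proof.
move=> a c d; have cD := fsubsetUl (msupp c) (msupp d).
have dD := fsubsetUr (msupp c) (msupp d).
rewrite (linE phi cD) (linE phi dD) (@linE _ _ (fsetU (msupp c) (msupp d))).
  rewrite scaler_sumr -big_split; apply: eq_bigr => x _.
  by rewrite mcoeffD mcoeffZ scalerDl scalerA.
apply: fsubset_trans (msuppD_le _ _) _.
by apply: fsetSU; exact: msuppZ_le.
Qed.

HB.instance Definition _ phi :=
  GRing.isLinear.Build RR A M _ (lin phi) (lin_is_linear phi).

Lemma lin_gen phi x : lin phi (gen x) = phi x.
Proof. by rewrite /lin /unit_chain msuppU oner_eq0 big_seq_fset1 mcoeffUU scale1r. Qed.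

End Extension.
End FreeModule.

Lemma supported_lin (RR : realType) (K L : choiceType) (phi : K -> malg L RR)
    (P : K -> Prop) (Q : L -> Prop) c :
  supported P c -> (forall x, P x -> supported Q (phi x)) ->
  supported Q (lin phi c).
Proof.
by move=> Pc PQ; rewrite /lin big_seq_cond; apply: big_ind => //;
  [exact: supported0 | exact: supportedD |
   move=> x /andP[/Pc /PQ Qx _]; exact: supportedZ].
Qed.

Lemma norm1_lin (RR : realType) (K L : choiceType) (phi : K -> malg L RR)
    (P : K -> Prop) B c :
  supported P c -> (forall x, P x -> norm1 (phi x) <= B) ->
  norm1 (lin phi c) <= B * norm1 c.
Proof.
move=> Pc PB; rewrite [norm1 c]/norm1 mulr_sumr /lin.
rewrite big_seq_cond [leRHS]big_seq_cond.
pose T (a : malg L RR) (b : RR) := norm1 a <= b.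
apply: (@big_rec2 _ _ T) => [|x b' a' /andP[xc _] ab].
  by rewrite /T norm10.
apply: le_trans (norm1D _ _) _; apply: lerD => //.
by rewrite norm1Z mulrC ler_wpM2r // PB //; exact: Pc.
Qed.

Global Opaque unit_chain lin.

(** * Complexes of lists *)

Section Lists.
Variables (RR : realType) (V : choiceType).
Local Notation A := (malg (seq V) RR).
Local Notation gen := (@unit_chain RR (seq V)).
Implicit Types (s t u w : seq V) (c d : A) (F G L : seq V -> Prop).

Definition catl u : A -> A := lin (fun t => gen (u ++ t)).
Definition catr w : A -> A := lin (fun t => gen (t ++ w)).

HB.instance Definition _ u := GRing.Linear.on (catl u).
HB.instance Definition _ w := GRing.Linear.on (catr w).

Lemma catl_gen u t : catl u (gen t) = gen (u ++ t).
Proof. exact: lin_gen. Qed.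

Lemma catr_gen w t : catr w (gen t) = gen (t ++ w).
Proof. exact: lin_gen. Qed.

Lemma supported_catl (P Q : seq V -> Prop) u c : supported P c ->
  (forall t, P t -> Q (u ++ t)) -> supported Q (catl u c).
Proof. by move=> Pc PQ; apply: supported_lin Pc _ => t /PQ; exact: supported_gen. Qed.

Lemma supported_catr (P Q : seq V -> Prop) w c : supported P c ->
  (forall t, P t -> Q (t ++ w)) -> supported Q (catr w c).
Proof. by move=> Pc PQ; apply: supported_lin Pc _ => t /PQ; exact: supported_gen. Qed.

Lemma norm1_catl u c : norm1 (catl u c) <= norm1 c.
Proof.
rewrite -[leRHS]mul1r; apply: (@norm1_lin _ _ _ _ (fun=> True)) => // t _.
by rewrite norm1_gen.
Qed.

(** The recursion d (x s) = s - x d(s) makes proofs by induction on lists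
    possible; [simplex_bdE] is the usual alternating sum. *)
Fixpoint simplex_bd s : A :=
  if s is x :: s' then gen s' - catl [:: x] (simplex_bd s') else 0.

Lemma norm1_simplex_bd s : norm1 (simplex_bd s) <= (size s)%:R.
Proof.
elim: s => [|x s IH] /=; first by rewrite norm10.
rewrite -addn1 natrD [leRHS]addrC (le_trans (norm1B _ _)) // norm1_gen lerD2l.
exact: le_trans (norm1_catl _ _) IH.
Qed.

Definition bd : A -> A := lin simplex_bd.
HB.instance Definition _ := GRing.Linear.on bd.

Lemma bd_gen s : bd (gen s) = simplex_bd s.
Proof. exact: lin_gen. Qed.

Lemma norm1_bd n c : supported (fun t => size t = n) c ->
  norm1 (bd c) <= n%:R * norm1 c.
Proof. by move=> cn; apply: norm1_lin cn _ => t <-; exact: norm1_simplex_bd. Qed.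

Lemma supported_bd (P Q : seq V -> Prop) c : supported P c ->
  (forall t, P t -> supported Q (simplex_bd t)) -> supported Q (bd c).
Proof. exact: supported_lin. Qed.

Opaque catl catr bd.

Lemma catl_cat u v c : catl u (catl v c) = catl (u ++ v) c.
Proof.
elim/gen_ind: c => [|a t d IH]; first by rewrite !linear0.
by rewrite !linearP /= IH !catl_gen catA.
Qed.

Lemma catl_catr u w c : catl u (catr w c) = catr w (catl u c).
Proof.
elim/gen_ind: c => [|a t d IH]; first by rewrite !linear0.
by rewrite !linearP /= IH !(catl_gen, catr_gen) catA.
Qed.

Lemma catl0 c : catl [::] c = c.
Proof.
elim/gen_ind: c => [|a t d IH]; first by rewrite !linear0.
by rewrite !linearP /= IH catl_gen.
Qed.

Lemma simplex_bd_cat u w :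
  simplex_bd (u ++ w) =
  catr w (simplex_bd u) + (-1) ^+ size u *: catl u (simplex_bd w).
Proof.
elim: u => [|x u IH] /=; first by rewrite linear0 add0r expr0 scale1r catl0.
rewrite IH linearD linearB linearZ /= catl_cat catr_gen catl_catr opprD addrA.
by rewrite exprS mulN1r scaleNr.
Qed.

Lemma bd_catl u c :
  bd (catl u c) =
  lin (fun w => catr w (simplex_bd u)) c + (-1) ^+ size u *: catl u (bd c).
Proof.
elim/gen_ind: c => [|a t d IH]; first by rewrite !linear0 addr0.
rewrite !linearP /= IH catl_gen !bd_gen lin_gen simplex_bd_cat.
by rewrite scalerDr addrACA.
Qed.

Lemma bd_bd c : bd (bd c) = 0.
Proof.
elim/gen_ind: c => [|a t d IH]; first by rewrite !linear0.
rewrite !linearP /= IH addr0 bd_gen; apply/eqP; rewrite scaler_eq0.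
apply/orP; right; apply/eqP.
elim: t => [|x t IHt] /=; first by rewrite linear0.
have bd1 : simplex_bd [:: x] = gen [::] by rewrite /= linear0 subr0.
rewrite linearB /= bd_gen bd_catl bd1 /= IHt. rewrite linear0 scaler0 addr0.
apply/eqP; rewrite subr_eq0; apply/eqP.
elim/gen_ind: (simplex_bd t) => [|b s e IHe]; first by rewrite !linear0.
by rewrite !linearP /= lin_gen catr_gen -IHe.
Qed.

Lemma simplex_bd_supported s :
  supported (fun t => subseq t s /\ size s = (size t).+1) (simplex_bd s).
Proof.
elim: s => [|x s IH] /=; first exact: supported0.
apply: supportedB.
  by apply: supported_gen; split=> //; exact: subseq_cons.
by apply: supported_catl IH _ => t [ts es]; rewrite /= eqxx es.
Qed.

Definition closed F := forall s t, subseq s t -> F t -> F s.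

(** A list of size n is a simplex of degree n - 1, so [m] stands for degrees up to
    [m - 2]. The homotopy is defined on [G] and takes its values in [F], as the
    inclusion of [G] in [F] may be null-homotopic when [G] itself is not
    acyclic. *)
Definition contractible G F m (B : RR) :=
  exists h : seq V -> A, forall s, G s -> (size s < m)%N ->
    [/\ supported (fun t => F t /\ size t = (size s).+1) (h s),
        norm1 (h s) <= B &
        bd (h s) + lin h (simplex_bd s) = gen s].

Lemma contractibleW G G' F F' m m' B B' :
  (forall s, G' s -> G s) -> (forall s, F s -> F' s) -> (m' <= m)%N -> B <= B' ->
  contractible G F m B -> contractible G' F' m' B'.
Proof.
move=> G'G FF' mm' BB' [h hP]; exists h => s Gs sm.
have [h1 h2 h3] := hP _ (G'G _ Gs) (leq_trans sm mm').
split=> //; last exact: le_trans h2 BB'.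
by apply: supportedW h1 => t [/FF'].
Qed.

Lemma simplex_bd_closed G s : closed G -> G s ->
  supported (fun t => G t /\ size s = (size t).+1) (simplex_bd s).
Proof.
move=> Gcl Gs; apply: supportedW (@simplex_bd_supported s) => t [ts e].
by split=> //; exact: Gcl ts Gs.
Qed.

Lemma contraction_homotopy G F m B (h : seq V -> A) : closed G ->
  (forall s, G s -> (size s < m)%N ->
    [/\ supported (fun t => F t /\ size t = (size s).+1) (h s),
        norm1 (h s) <= B &
        bd (h s) + lin h (simplex_bd s) = gen s]) ->
  forall c, supported (fun t => G t /\ (size t < m)%N) c ->
  bd (lin h c) + lin h (bd c) = c.
Proof.
move=> Gcl hP c Gc.
apply: (@support_ind _ _ c (fun c => bd (lin h c) + lin h (bd c) = c)).
  by rewrite !linear0 addr0.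
move=> a s d /Gc[Gs sm] IH; have [_ _ e] := hP _ Gs sm.
rewrite !linearP /= lin_gen bd_gen addrACA IH.
by rewrite -scalerDr e.
Qed.

Lemma cone_contractible G F m y : (forall s, G s -> F (y :: s)) ->
  contractible G F m 1.
Proof.
move=> GF; exists (fun s => gen (y :: s)) => s Gs _; split.
- by apply: supported_gen; split=> //; exact: GF.
- by rewrite norm1_gen.
by rewrite bd_gen /= subrK.
Qed.

(** In an order complex the apex may already be a vertex of a simplex. Such a
    simplex is sent to zero, which is consistent because its only face without the
    apex is the one that drops its first vertex. *)
Lemma head_cone_contractible G F m y : closed G ->
  (forall s, G s -> y \notin s -> F (y :: s)) ->
  (forall s, G s -> y \notin behead s) ->
  contractible G F m 1.
Proof.
move=> Gcl GF Gy.
pose h s : A := if y \in s then 0 else gen (y :: s).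
have hE s c : y \notin s -> supported (fun t => subseq t s) c -> lin h c = catl [:: y] c.
  move=> ys sc; apply: (@support_ind _ _ c (fun c => lin h c = catl [:: y] c)).
    by rewrite !linear0.
  move=> a t d /sc ts IH; rewrite !linearP /= IH catl_gen lin_gen /h.
  by have /negbTE -> : y \notin t by apply: contra ys; exact: mem_subseq.
have bs s : supported (fun t => subseq t s) (simplex_bd s).
  by apply: supportedW (@simplex_bd_supported s) => t [].
exists h => s Gs _; split.
- rewrite /h; case: ifPn => ys; first exact: supported0.
  by apply: supported_gen; split=> //; exact: GF.
- by rewrite /h; case: ifP => _; rewrite ?norm10 ?norm1_gen ?ler01.
have [ys|ys] := boolP (y \in s); last first.
  by rewrite (hE s) // /h (negbTE ys) bd_gen /= subrK.
case: s Gs ys => // x s Gs; rewrite in_cons.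
have ys := Gy _ Gs; rewrite /= in ys; rewrite (negbTE ys) orbF => /eqP e.
rewrite -{}e in Gs *.
rewrite {1}/h in_cons eqxx /= linear0 add0r linearB /= lin_gen {1}/h (negbTE ys).
rewrite -[RHS]subr0; congr (_ - _).
elim/gen_ind: (simplex_bd s) => [|a t d IH]; first by rewrite !linear0.
by rewrite !linearP /= IH catl_gen lin_gen /h in_cons eqxx /= scaler0 addr0.
Qed.

Definition revc : A -> A := lin (fun t => gen (rev t)).
HB.instance Definition _ := GRing.Linear.on revc.

Lemma revc_gen t : revc (gen t) = gen (rev t).
Proof. exact: lin_gen. Qed.

Lemma simplex_bd_rev s :
  simplex_bd (rev s) = (-1) ^+ (size s).+1 *: revc (simplex_bd s).
Proof.
have revl x c : revc (catl [:: x] c) = catr [:: x] (revc c).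
  elim/gen_ind: c => [|a t d IH]; first by rewrite !linear0.
  by rewrite !linearP /= IH catl_gen !revc_gen catr_gen rev_cons cats1.
elim: s => [|x s IH] /=; first by rewrite linear0 scaler0.
rewrite rev_cons -cats1 simplex_bd_cat IH /= linear0 subr0 catl_gen cats0.
rewrite linearB linearZ /= revc_gen revl size_rev.
by rewrite scalerBr addrC !exprS !mulN1r opprK !scaleNr.
Qed.

(** Reversal turns the i-th face into the i-th face from the end, so it commutes
    with the boundary up to a sign that depends on the size only. This gives a
    version of [push_contractible] in which the vertices are removed from the
    front. *)
Lemma rev_contractible G F m B : closed G -> contractible G F m B ->
  contractible (fun s => G (rev s)) (fun s => F (rev s)) m B.
Proof.
move=> Gcl [h hP].
pose h' s : A := (-1) ^+ size s *: revc (h (rev s)).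
have revcK c : revc (revc c) = c.
  elim/gen_ind: c => [|a t d IH]; first by rewrite !linear0.
  by rewrite !linearP /= IH !revc_gen revK.
have bd_rev n c : supported (fun t => size t = n) c ->
    bd (revc c) = (-1) ^+ n.+1 *: revc (bd c).
  move=> cn.
  apply: (@support_ind _ _ c (fun c => bd (revc c) = (-1) ^+ n.+1 *: revc (bd c))).
    by rewrite !linear0.
  move=> a t d /cn tn IH.
  by rewrite !linearP /= IH revc_gen !bd_gen simplex_bd_rev tn.
have hh := contraction_homotopy Gcl hP.
have signSS n : (-1) ^+ n.+2 = (-1) ^+ n :> RR.
  by rewrite !exprS !mulN1r opprK.
have oddK n (c : A) : (-1) ^+ n *: ((-1) ^+ n *: c) = c.
  by rewrite scalerA -expr2 sqrr_sign scale1r.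
exists h' => s Gs sm.
have sm' : (size (rev s) < m)%N by rewrite size_rev.
have [h1 h2 h3] := hP _ Gs sm'; rewrite size_rev in h1.
have rs (P : seq V -> Prop) c : supported (fun t => P (rev t)) c ->
    supported P (revc c).
  by move=> Pc; apply: supported_lin Pc _ => t; exact: supported_gen.
split.
- apply: supportedZ.
  apply: (rs (fun t => F (rev t) /\ size t = (size s).+1)).
  by apply: supportedW h1 => t [Ft st]; rewrite revK size_rev.
- rewrite /h' norm1Z normrX normrN1 expr1n mul1r.
  apply: le_trans h2; rewrite -[leRHS]mul1r.
  apply: (@norm1_lin _ _ _ _ (fun=> True)) => // t _.
  by rewrite norm1_gen.
have -> : lin h' (simplex_bd s) =
    (-1) ^+ (size s).+1 *: revc (lin h (revc (simplex_bd s))).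
  case: s {Gs sm sm' h1 h2 h3} => [|x s].
    by rewrite /= !linear0.
  have := @simplex_bd_supported (x :: s).
  move: (simplex_bd (x :: s)) => c cs.
  apply: (@support_ind _ _ c (fun c => lin h' c =
     (-1) ^+ (size (x :: s)).+1 *: revc (lin h (revc c)))).
    by rewrite !linear0.
  move=> a t d /cs[_ /= [e]] IH.
  by rewrite !linearP /= IH lin_gen revc_gen lin_gen /h' -e signSS.
rewrite linearZ /= (bd_rev (size s).+1); last by apply: supportedW h1 => t [].
rewrite -[RHS]revcK revc_gen -h3 linearD simplex_bd_rev !linearZ /=.
by rewrite signSS oddK.
Qed.

End Lists.

Global Opaque catl catr bd.

(** * Reduction to a subset of the vertices *)

(** The core of a list is what is left when its longest tail with all entries in
    [X] is removed. A face of [s] has either the same core, when an entry of the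
    tail is dropped, or a shorter one. *)
Section Core.
Variables (V : eqType) (X : pred V).
Implicit Types s u w : seq V.

Fixpoint core s :=
  if s is x :: s' then (if all X s then [::] else x :: core s') else [::].

Definition rest s := drop (size (core s)) s.

Lemma core_rest s : core s ++ rest s = s.
Proof.
by rewrite /rest; elim: s => //= x s IH; case: ifP => //= _; rewrite IH.
Qed.

Lemma all_rest s : all X (rest s).
Proof. by rewrite /rest; elim: s => //= x s IH; case: ifP => //= _; rewrite drop0. Qed.

Lemma core_nil s : (core s == [::]) = all X s.
Proof. by case: s => //= x s; case: ifP. Qed.

Lemma size_core_cat u w : all X w -> (size (core (u ++ w)) <= size u)%N.
Proof.
move=> Xw; elim: u => [|x u IH] /=; last by case: ifP.
by move: Xw; rewrite -core_nil => /eqP ->.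
Qed.

Lemma core_last s : core s = [::] \/ exists u x, core s = rcons u x /\ ~~ X x.
Proof.
elim: s => [|x s IH] /=; first by left.
case: ifP => [|/negbT Xs]; [by left | right].
case: IH => [e | [u [y [-> Xy]]]]; last by exists (x :: u), y.
exists [::], x; rewrite e; split=> //; apply: contra Xs => ->.
by rewrite -core_nil e.
Qed.

Lemma core_rcons_cat u x w : ~~ X x -> all X w ->
  core (rcons u x ++ w) = rcons u x.
Proof.
move=> Xx Xw; elim: u => [|y u IH] /=.
  by rewrite (negbTE Xx); congr (_ :: _); apply/eqP; rewrite core_nil.
by rewrite IH all_cat all_rcons (negbTE Xx) andbF.
Qed.

Lemma core_cat s w : all X w -> core (core s ++ w) = core s.
Proof.
move=> Xw; case: (core_last s) => [->|[u [x [-> Xx]]]].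
  by apply/eqP; rewrite core_nil.
exact: core_rcons_cat.
Qed.

Lemma size_core s : (size (core s) <= size s)%N.
Proof. by rewrite -{2}(core_rest s) size_cat leq_addr. Qed.

End Core.

Lemma addr_cancel2 (M : zmodType) (a b x y : M) :
  a + b - (x + a) - (y + b) = - x - y.
Proof.
rewrite [a + b]addrC [x + a]addrC addrKA opprD addrC addrA subrK.
by rewrite addrC.
Qed.

Lemma addr_telescope (M : zmodType) (x a b c : M) :
  x - a + (b + c) = x - (a - b - c).
Proof. by rewrite !opprD !opprK -!addrA. Qed.

Section Push.
Variables (RR : realType) (V : choiceType).
Local Notation A := (malg (seq V) RR).
Local Notation gen := (@unit_chain RR (seq V)).
Local Notation simplex_bd := (@simplex_bd RR V).
Let simplex_bd_supported := @simplex_bd_supported RR V.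
Implicit Types (s t u w : seq V) (c d : A) (F G : seq V -> Prop).

(** A bound for the operator 1 - d H - H d in the proof of [push_contractible],
    if [H] has norm at most [B] and the lists have size at most [D]. *)
Definition push_step D (B : RR) : RR := 1 + B *+ (2 * D).+1.
Definition push_bound D (B B0 : RR) : RR :=
  (B *+ D + B0) * push_step D B ^+ D.

Lemma push_bound_ge0 D B B0 : 0 <= B -> 0 <= B0 -> 0 <= push_bound D B B0.
Proof.
move=> B_ge0 B0_ge0; apply: mulr_ge0; first by rewrite addr_ge0 ?mulrn_wge0.
by rewrite exprn_ge0 // addr_ge0 ?mulrn_wge0.
Qed.

(** Write a simplex as [u ++ w] where [u] is its core. Filling [w] in the link of
    [u] defines an operator [H] on simplices with nonempty core, and
    P = 1 - d H - H d is a chain map, homotopic to the identity. In [P (u ++ w)]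
    the terms with core [u] cancel, hence after [m] iterations all cores are empty
    and what remains is a chain on vertices in [X], where the last hypothesis
    applies. *)
Lemma push_contractible (X : pred V) G F m D (B B0 : RR) :
  (m <= D)%N -> 0 <= B -> 0 <= B0 ->
  closed G -> (forall s, G s -> F s) ->
  (forall u x, ~~ X x -> G (rcons u x) ->
     contractible (fun w => all X w /\ G (rcons u x ++ w))
       (fun w => all X w /\ G (rcons u x ++ w)) (m - (size u).+1) B) ->
  contractible (fun s => all X s /\ G s) F m B0 ->
  contractible G F m (push_bound D B B0).
Proof.
move=> mD B_ge0 B0_ge0 Gcl GF links [h0 h0P].
pose link u w := all X w /\ G (u ++ w).
have /choice[hh hhP] : forall u, exists h : seq V -> A,
    forall s, core X s = u -> u != [::] -> G s ->
    forall w, link u w -> (size w < m - size u)%N ->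
    [/\ supported (fun t => link u t /\ size t = (size w).+1) (h w),
        norm1 (h w) <= B & bd (h w) + lin h (simplex_bd w) = gen w].
  move=> u.
  have [[s [es un Gs]]|no] := pselect (exists s, [/\ core X s = u, u != [::] & G s]);
    last first.
    by exists (fun=> 0) => s e1 e2 e3; case: no; exists s.
  have [e|[u' [x [e Xx]]]] := core_last X s.
    by rewrite -es e in un.
  rewrite es in e; rewrite {}e in un es *.
  have Gu : G (rcons u' x).
    by apply: Gcl Gs; rewrite -(core_rest X s) es prefix_subseq.
  have [h hP] := links _ _ Xx Gu.
  exists h => s' _ _ _ w lw; rewrite size_rcons => sw; exact: hP.
pose lev s := size (core X s).
(* The filling of [w] inside the link of [u], with [u] put back in front. *)
have [H HdefE] : exists H : seq V -> A, forall s, H s =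
    if (core X s != [::]) && (size s < m)%N
    then (-1) ^+ lev s *: catl (core X s) (hh (core X s) (rest X s)) else 0.
  by exists (fun s => if (core X s != [::]) && (size s < m)%N
    then (-1) ^+ lev s *: catl (core X s) (hh (core X s) (rest X s)) else 0).
have linkP s : G s -> link (core X s) (rest X s).
  by move=> Gs; split; [exact: all_rest | rewrite core_rest].
have size_rest s : (size s < m)%N -> (size (rest X s) < m - size (core X s))%N.
  move=> sm; rewrite /rest size_drop ltn_sub2r //.
  exact: leq_ltn_trans (size_core _ _) sm.
have HG s : G s -> supported (fun t => [/\ G t, size t = (size s).+1 &
    (lev t <= lev s)%N]) (H s).
  move=> Gs; rewrite HdefE; case: ifPn => [/andP[cn sm]|_]; last exact: supported0.
  have [h1 _ _] := hhP _ s erefl cn Gs _ (linkP _ Gs) (size_rest _ sm).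
  apply: supportedZ; apply: supported_catl h1 _ => t [[Xt Gt] st].
  split=> //; last exact: size_core_cat.
  by rewrite size_cat st addnS -size_cat core_rest.
have HB s : G s -> norm1 (H s) <= B.
  move=> Gs; rewrite HdefE; case: ifPn => [/andP[cn sm]|_]; last by rewrite norm10.
  have [_ h2 _] := hhP _ s erefl cn Gs _ (linkP _ Gs) (size_rest _ sm).
  rewrite norm1Z normrX normrN1 expr1n mul1r.
  exact: le_trans (norm1_catl _ _) h2.
(* Homotopic to the identity; each application shortens the cores. *)
have [P PE] : exists P : seq V -> A,
    forall s, P s = gen s - bd (H s) - lin H (simplex_bd s).
  by exists (fun s => gen s - bd (H s) - lin H (simplex_bd s)).
have linP c : lin P c = c - bd (lin H c) - lin H (bd c).
  elim/gen_ind: c => [|a t d IH]; first by rewrite !linear0 ?subr0 ?addr0.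
  rewrite !linearP /= IH lin_gen lin_gen bd_gen PE !scalerBr.
  rewrite !scalerN addrACA [_ + (d - _)]addrACA; reflexivity.
have bdP c : bd (lin P c) = lin P (bd c).
  rewrite !linP !linearB /= !bd_bd subr0 linear0 subr0; reflexivity.
have bdG s : G s -> supported (fun t => G t /\ size s = (size t).+1) (simplex_bd s).
  exact: simplex_bd_closed.
have PG s : G s -> supported (fun t => G t /\ size t = size s) (P s).
  move=> Gs; rewrite PE; apply: supportedB; first apply: supportedB.
  - by apply: supported_gen.
  - apply: supported_bd (HG _ Gs) _ => t [Gt st _].
    by apply: supportedW (bdG _ Gt) => v [Gv sv]; split=> //; lia.
  apply: supported_lin (bdG _ Gs) _ => t [Gt st].
  by apply: supportedW (HG _ Gt) => v [Gv sv _]; split=> //; lia.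
(* In [P s] the terms with core [u] add up to [u] followed by
   [w - d (hh u w) - hh u (d w)], which is zero. *)
have Plev s : G s -> (size s < m)%N ->
    supported (fun t => (lev t <= (lev s).-1)%N) (P s).
  move=> Gs sm.
  have [/eqP cn|cn] := boolP (core X s == [::]).
    have Xs : all X s by rewrite -core_nil cn.
    have H0 t : all X t -> H t = 0 by rewrite -core_nil HdefE => ->.
    have -> : P s = gen s.
      rewrite PE H0 // linear0 subr0.
      suff -> : lin H (simplex_bd s) = 0 by rewrite subr0.
      apply: (@support_ind _ _ (simplex_bd s) (fun c => lin H c = 0)).
        by rewrite linear0.
      move=> a t d /simplex_bd_supported [ts _] IH.
      rewrite linearP /= lin_gen H0 ?scaler0 ?add0r //.
      by apply/allP => x /(mem_subseq ts); exact: (allP Xs).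
    by apply: supported_gen; rewrite /lev cn.
  have [u uE] : exists u, u = core X s by exists (core X s).
  have [w wE] : exists w, w = rest X s by exists (rest X s).
  have levE : lev s = size u by rewrite uE.
  have uw : u ++ w = s by rewrite uE wE core_rest.
  have uK t : all X t -> core X (u ++ t) = u by rewrite uE; exact: core_cat.
  have Xw : all X w by rewrite wE all_rest.
  have luw : link u w by rewrite uE wE; exact: linkP.
  have swu : (size w < m - size u)%N by rewrite uE wE; exact: size_rest.
  have un : u != [::] by rewrite uE.
  have [h1 h2 h3] := hhP u s (esym uE) un Gs w luw swu.
  have u_gt0 : (0 < size u)%N by rewrite lt0n size_eq0.
  have faces t : all X t -> G (u ++ t) ->
    supported (fun v => (lev v <= (lev s).-1)%N /\ G v) (catr t (simplex_bd u)).
    move=> Xt Gt; apply: (supported_catr (@simplex_bd_supported u)) => v [vu sv].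
    split.
      by apply: leq_trans (size_core_cat _ Xt) _; rewrite levE sv.
    by apply: Gcl Gt; apply: cat_subseq.
  have HE : lin H (catl u (simplex_bd w)) =
      (-1) ^+ size u *: catl u (lin (hh u) (simplex_bd w)).
    apply: (@support_ind _ _ (simplex_bd w) (fun c => lin H (catl u c) =
       (-1) ^+ size u *: catl u (lin (hh u) c))); first by rewrite !linear0.
    move=> a t d /simplex_bd_supported [tw st] IH.
    have Xt : all X t.
      by apply/allP => x /(mem_subseq tw); exact: (allP Xw).
    have HutE : H (u ++ t) = (-1) ^+ size u *: catl u (hh u t).
      rewrite HdefE /lev /rest (uK _ Xt) un /= (drop_size_cat _ (erefl (size u))).
      have -> : (size (u ++ t) < m)%N.
        by rewrite size_cat -ltn_subRL; apply: ltn_trans swu; rewrite st.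
      reflexivity.
    rewrite !linearP /= IH lin_gen catl_gen lin_gen HutE; reflexivity.
  have HsE : H s = (-1) ^+ size u *: catl u (hh u w).
    rewrite HdefE cn sm levE -uE -wE; reflexivity.
  have gs : gen s = catl u (gen w) by rewrite catl_gen uw.
  have bds : simplex_bd s =
      catr w (simplex_bd u) + (-1) ^+ size u *: catl u (simplex_bd w).
    by rewrite -simplex_bd_cat uw.
  have sg (c : A) : (-1) ^+ size u *: ((-1) ^+ size u *: c) = c.
    by rewrite scalerA -expr2 sqrr_sign scale1r.
  have -> : P s = - ((-1) ^+ size u *:
       lin (fun t => catr t (simplex_bd u)) (hh u w)) -
       lin H (catr w (simplex_bd u)).
    have Pgs : gen s = catl u (bd (hh u w)) + catl u (lin (hh u) (simplex_bd w)).
      rewrite gs -h3 linearD; reflexivity.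
    have PbdH : bd (H s) = (-1) ^+ size u *:
        lin (fun t => catr t (simplex_bd u)) (hh u w) + catl u (bd (hh u w)).
      rewrite HsE linearZ /= bd_catl scalerDr sg; reflexivity.
    have PHbd : lin H (simplex_bd s) =
        lin H (catr w (simplex_bd u)) + catl u (lin (hh u) (simplex_bd w)).
      rewrite bds linearD linearZ /= HE sg; reflexivity.
    rewrite PE Pgs PbdH PHbd.
    exact: addr_cancel2.
  apply: supportedB.
    apply: supportedN; apply: supportedZ; apply: (supported_lin h1) => t [[Xt Gt] _].
    by apply: supportedW (faces t Xt Gt) => v [].
  apply: (supported_lin (faces w luw.1 luw.2)) => v [lv Gv].
  by apply: supportedW (HG _ Gv) => t [_ _ lt]; exact: leq_trans lt lv.
have normP s : G s -> (size s <= m)%N -> norm1 (P s) <= push_step D B.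
  move=> Gs sm.
  have n1 : norm1 (bd (H s)) <= (D.+1)%:R * B.
    apply: (@le_trans _ _ ((size s).+1%:R * norm1 (H s))).
      by apply: norm1_bd; apply: supportedW (HG _ Gs) => t [_ ->].
    apply: ler_pM => //; first exact: norm1_ge0; last exact: HB.
    by rewrite ler_nat ltnS (leq_trans sm).
  have n2 : norm1 (lin H (simplex_bd s)) <= B * D%:R.
    apply: (@le_trans _ _ (B * norm1 (simplex_bd s))); last first.
      rewrite ler_wpM2l // (le_trans (norm1_simplex_bd _ _)) // ler_nat.
      exact: leq_trans sm mD.
    by apply: (norm1_lin (bdG _ Gs)) => t [Gt _]; exact: HB.
  rewrite PE; apply: le_trans (norm1B _ _) _.
  apply: le_trans (lerD (norm1B _ _) (lexx _)) _.
  rewrite norm1_gen; apply: le_trans (lerD (lerD (lexx _) n1) n2) _.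
  have -> : push_step D B = 1 + D.+1%:R * B + B * D%:R.
    rewrite /push_step mul2n -addnn -addSn mulrnDr addrA mulr_natl mulr_natr.
    reflexivity.
  exact: lexx.
have step_ge1 : 1 <= push_step D B by rewrite lerDl mulrn_wge0.
have [Pn [PnE0 PnES]] : exists Pn : nat -> A -> A,
    (forall c, Pn 0%N c = c) /\ (forall n c, Pn n.+1 c = lin P (Pn n c)).
  by exists (fun n => iter n (lin P)).
have Pn_lin n : linear (Pn n).
  elim: n => [|n IH] a c d; first by rewrite !PnE0.
  by rewrite !PnES IH linearP.
have Pn0 n : Pn n 0 = 0.
  by elim: n => [|n IH]; rewrite ?PnE0 // PnES IH linear0.
have bdPn n c : bd (Pn n c) = Pn n (bd c).
  by elim: n c => [|n IH] c; rewrite ?PnE0 // !PnES bdP IH.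
have PnG n k c : supported (fun t => G t /\ size t = k) c ->
    supported (fun t => G t /\ size t = k) (Pn n c).
  move=> Gc; elim: n => [|n IH]; rewrite ?PnE0 // PnES; apply: (supported_lin IH) => t [Gt st].
  by apply: supportedW (PG _ Gt) => v [Gv sv]; split=> //; rewrite sv.
have normPn n k c : (k <= m)%N -> supported (fun t => G t /\ size t = k) c ->
    norm1 (Pn n c) <= push_step D B ^+ n * norm1 c.
  move=> km Gc; elim: n => [|n IH]; first by rewrite PnE0 expr0 mul1r.
  rewrite PnES.
  apply: (@le_trans _ _ (push_step D B * norm1 (Pn n c))).
    apply: (norm1_lin (PnG n _ _ Gc)) => t [Gt st]; apply: normP => //.
    by rewrite st.
  by rewrite exprS -mulrA ler_wpM2l // (le_trans ler01).
have levPn n s : G s -> (size s < m)%N ->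
    supported (fun t => (lev t <= lev s - n)%N) (Pn n (gen s)).
  move=> Gs sm; elim: n => [|n IH].
    by rewrite PnE0; apply: supported_gen; rewrite subn0.
  have Gn := PnG n _ _ (supported_gen (conj Gs erefl : G s /\ size s = size s)).
  have both : supported (fun t => [/\ G t, size t = size s &
      (lev t <= lev s - n)%N]) (Pn n (gen s)).
    by move=> t ts; have [Gt st] := Gn _ ts; split=> //; exact: IH.
  rewrite PnES; apply: (supported_lin both) => t [Gt st lt].
  have tm : (size t < m)%N by rewrite st.
  by apply: supportedW (Plev _ Gt tm) => v lv; lia.
have XPm s : G s -> (size s < m)%N ->
    supported (fun t => (all X t /\ G t) /\ size t = size s) (Pn m (gen s)).
  move=> Gs sm t ts.
  have [Gt st] := PnG m _ _ (supported_gen (conj Gs erefl : G s /\ size s = size s)) _ ts.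
  split=> //; split=> //; rewrite -core_nil -size_eq0 -leqn0 -/(lev t).
  apply: leq_trans (levPn m s Gs sm t ts) _.
  rewrite leqn0 subn_eq0; apply: leq_trans (size_core _ _) (ltnW sm).
exists (fun s => \sum_(i < m) Pn i (H s) + lin h0 (Pn m (gen s))) => s Gs sm.
have XG : closed (fun s => all X s /\ G s).
  move=> t t' tt' [Xt' Gt']; split; last exact: Gcl tt' Gt'.
  by apply/allP => x /(mem_subseq tt'); exact: (allP Xt').
have HsG : supported (fun t => G t /\ size t = (size s).+1) (H s).
  by apply: supportedW (HG _ Gs) => t [].
split.
- apply: supportedD.
    apply: supported_sum => i.
    by apply: supportedW (PnG i _ _ HsG) => t [/GF].
  apply: (supported_lin (XPm s Gs sm)) => t [XGt st].
  have tm : (size t < m)%N by rewrite st.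
  by have [h1 _ _] := h0P _ XGt tm; rewrite st in h1.
- have stepD i : (i <= m)%N -> push_step D B ^+ i <= push_step D B ^+ D.
    by move=> im; apply: ler_weXn2l => //; exact: leq_trans im mD.
  rewrite /push_bound mulrDl; apply: le_trans (norm1D _ _) _; apply: lerD.
    apply: (@le_trans _ _ (\sum_(i < m) B * push_step D B ^+ D)).
      apply: le_trans (norm1_sum _) _; apply: ler_sum => i _.
      apply: le_trans (normPn i _ _ sm HsG) _; rewrite mulrC.
      apply: ler_pM; [exact: norm1_ge0 | | exact: HB | exact/stepD/ltnW].
      by rewrite exprn_ge0 // (le_trans ler01).
    rewrite sumr_const card_ord -mulrnAl ler_wpM2r //.
      by rewrite exprn_ge0 // (le_trans ler01).
    by rewrite ler_wpMn2l.
  have := normPn m _ _ (ltnW sm) (supported_gen (conj Gs erefl : G s /\ size s = size s)).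
  rewrite norm1_gen mulr1 => nm.
  apply: (@le_trans _ _ (B0 * norm1 (Pn m (gen s)))).
    apply: (norm1_lin (XPm s Gs sm)) => t [XGt st].
    have tm : (size t < m)%N by rewrite st.
    by have [] := h0P _ XGt tm.
  apply: ler_wpM2l => //; apply: le_trans nm _; exact: stepD.
have linE c : lin (fun s => \sum_(i < m) Pn i (H s) + lin h0 (Pn m (gen s))) c =
   \sum_(i < m) Pn i (lin H c) + lin h0 (Pn m c).
  elim/gen_ind: c => [|a t d IH].
    rewrite !linear0 Pn0 linear0 addr0; under eq_bigr do rewrite Pn0.
    by rewrite big1.
  rewrite linearP /= IH lin_gen linearP /= lin_gen Pn_lin linearP /=.
  under [in RHS]eq_bigr do rewrite Pn_lin.
  by rewrite big_split /= -scaler_sumr scalerDr addrACA.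
rewrite linE linearD /= addrACA.
have -> : bd (lin h0 (Pn m (gen s))) + lin h0 (Pn m (simplex_bd s)) = Pn m (gen s).
  rewrite -bd_gen -bdPn; apply: (contraction_homotopy XG h0P) => t /(XPm s Gs sm).
  by move=> [XGt ->].
rewrite linear_sum /= -big_split /=.
have tele n : \sum_(i < n) (bd (Pn i (H s)) + Pn i (lin H (simplex_bd s))) =
    gen s - Pn n (gen s).
  elim: n => [|n IH]; first by rewrite PnE0 big_ord0 subrr.
  rewrite big_ord_recr /= IH bdPn.
  have -> : Pn n.+1 (gen s) = Pn n (P s).
    elim: n {IH} => [|n IH]; first by rewrite PnES !PnE0 lin_gen.
    by rewrite PnES IH PnES.
  have PnB c d : Pn n (c - d) = Pn n c - Pn n d.
    by rewrite -scaleN1r addrC Pn_lin scaleN1r addrC.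
  rewrite PE !PnB; exact: addr_telescope.
rewrite tele; exact: subrK.
Qed.
End Push.

(** * From contracting homotopies to bounded cohomology *)

Section Transfer.
Variables (RR : realType) (V : choiceType) (X : semisimplicial).
Variables (F : seq V -> Prop) (enc : forall p, X p -> seq V).
Hypothesis F_closed : closed F.
Hypothesis size_enc : forall p (x : X p), size (enc x) = p.+1.
Hypothesis enc_F : forall p (x : X p), F (enc x).
Hypothesis enc_inj : forall p, injective (@enc p).
Hypothesis enc_surj : forall p s, F s -> size s = p.+1 -> exists x : X p, enc x = s.
Hypothesis enc_face : forall p (x : X p.+1) (i : 'I_p.+2),
  enc (face i x) = take i (enc x) ++ drop i.+1 (enc x).

Local Notation A := (malg (seq V) RR).
Local Notation gen := (@unit_chain RR (seq V)).
Local Notation simplex_bd := (@simplex_bd RR V).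
Local Notation rchain := (rchain RR X).
Local Notation rboundary := (@rboundary RR X _).

Lemma simplex_bdE s :
  simplex_bd s =
  \sum_(i < size s) (-1) ^+ i *: gen (take i s ++ drop i.+1 s).
Proof.
elim: s => [|x s IH] /=; first by rewrite big_ord0.
rewrite big_ord_recl /= drop0 scale1r; congr (_ + _).
have -> : catl [:: x] (simplex_bd s) =
    \sum_(i < size s) (-1) ^+ i *: gen (x :: take i s ++ drop i.+1 s).
  by rewrite IH linear_sum; apply: eq_bigr => i _; rewrite linearZ /= catl_gen.
rewrite -sumrN; apply: eq_bigr => i _.
by rewrite exprS mulN1r scaleNr.
Qed.

Definition of_chain k : rchain k -> A :=
  match k return rchain k -> A with
  | 0%N => fun c => (c : RR) *: gen [::]
  | q.+1 => lin (fun x : {classic X q} => gen (enc x))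
  end.

(** Inverse of [enc] on the lists that encode simplices, and zero elsewhere, so
    that [to_chain] is a left inverse of [of_chain] without raising norms. *)
Definition decode k (s : seq V) : rchain k :=
  match k return rchain k with
  | 0%N => (1 : RR)
  | q.+1 => if pselect (exists x : X q, enc x = s) is left e
            then unit_chain RR (projT1 (cid e) : {classic X q}) else 0
  end.

Definition to_chain k : A -> rchain k := lin (decode k).

Arguments of_chain : simpl never.
Arguments decode : simpl never.

Lemma of_chain_linear k : linear (@of_chain k).
Proof.
case: k => [|q] a c d; rewrite /of_chain; last exact: linearP.
by rewrite scalerDl scalerA.
Qed.

Lemma decode_enc q (x : X q) : decode q.+1 (enc x) = unit_chain RR (x : {classic X q}).
Proof.
rewrite /decode; case: pselect => [e|[]]; last by exists x.
by case: cid => y /= /enc_inj ->.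
Qed.

Lemma rchain_ind k (P : rchain k -> Prop) : P 0 ->
  (forall a c s, F s -> size s = k -> P c -> P (a *: decode k s + c)) ->
  (F [::]) -> forall c, P c.
Proof.
case: k P => [|q] P P0 PS F0 c.
  have := PS c 0 [::] F0 erefl P0.
  by rewrite addr0 /decode [_ *: _]mulr1.
elim/gen_ind: c => [//|a x d Pd].
by rewrite -decode_enc; apply: PS.
Qed.

HB.instance Definition _ k := GRing.isLinear.Build RR (rchain k) A _
  (@of_chain k) (@of_chain_linear k).
HB.instance Definition _ k := GRing.Linear.on (@to_chain k).

Lemma to_chain_gen k s : to_chain k (gen s) = decode k s.
Proof. exact: lin_gen. Qed.

Lemma decodeK k s : F s -> size s = k -> of_chain (decode k s) = gen s.
Proof.
case: k => [|q] Fs ss; first by rewrite /of_chain /decode scale1r (size0nil ss).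
have [x <-] := enc_surj Fs ss.
by rewrite decode_enc /of_chain lin_gen.
Qed.

Hypothesis F_nil : F [::].

Lemma of_chainK k (c : rchain k) : to_chain k (of_chain c) = c.
Proof.
elim/rchain_ind: c => [|a c s Fs ss IH|//]; first by rewrite !linear0.
by rewrite !linearP /= IH decodeK // to_chain_gen.
Qed.

Lemma of_chain_supported k (c : rchain k) :
  supported (fun s => F s /\ size s = k) (of_chain c).
Proof.
elim/rchain_ind: c => [|a c s Fs ss IH|//]; first by rewrite linear0; exact: supported0.
rewrite linearP /=; apply: supportedD => //; apply: supportedZ; rewrite decodeK //.
exact: supported_gen.
Qed.

Lemma norm1_of_chain k (c : rchain k) : norm1 (of_chain c) <= rnorm c.
Proof.
case: k c => [|q] c; first by rewrite /of_chain norm1Z norm1_gen mulr1.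
rewrite -[leRHS]mul1r; apply: (@norm1_lin _ _ _ _ (fun=> True)) => // x _.
by rewrite norm1_gen.
Qed.

Lemma rnorm_to_chain k d : rnorm (to_chain k d) <= norm1 d.
Proof.
rewrite -[leRHS]mul1r /to_chain.
case: k => [|q].
  rewrite lin_sum /decode /= /norm1 mul1r; apply: le_trans (ler_norm_sum _ _ _) _.
  by apply: ler_sum => s _; rewrite normrM normr1 mulr1.
apply: (@norm1_lin _ _ _ _ (fun=> True)) => // s _.
by rewrite /decode; case: pselect => [e|_]; rewrite ?norm1_gen ?norm10.
Qed.

Lemma boundaryE q c : @boundary RR X q c =
  lin (fun x : {classic X q.+1} => \sum_(i < q.+2) (-1) ^+ i *:
     (unit_chain RR (face i x : {classic X q}))) c.
Proof. by rewrite lin_sum. Qed.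

Lemma augmentationE c : @augmentation RR X c = lin (fun=> 1 : RR^o) c.
Proof.
by rewrite lin_sum; apply: eq_bigr => x _; rewrite /GRing.scale /= mulr1.
Qed.

Lemma rboundary_linear k : linear (@Defs.rboundary RR X k).
Proof.
by case: k => [|q] a c d /=; rewrite ?augmentationE ?boundaryE linearP.
Qed.

HB.instance Definition _ k := GRing.isLinear.Build RR (rchain k.+1) (rchain k) _
  (@Defs.rboundary RR X k) (@rboundary_linear k).

Lemma of_chain_bd k (c : rchain k.+1) :
  bd (of_chain c) = of_chain (rboundary c).
Proof.
elim/rchain_ind: c => [|a c s Fs ss IH|//]; first by rewrite !linear0.
rewrite !linearP /= IH (decodeK Fs ss) bd_gen.
suff -> : simplex_bd s = of_chain (rboundary (decode k.+1 s)) by [].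
have [x xs] := enc_surj Fs ss; rewrite -xs decode_enc simplex_bdE size_enc.
case: k x xs {c IH Fs ss} => [|q] x xs.
  rewrite [rboundary _]augmentationE lin_gen /of_chain scale1r.
  rewrite big_ord_recl big_ord0 addr0 scale1r.
  by have := size_enc x; case: (enc x) => [|y []].
rewrite [rboundary _]boundaryE lin_gen linear_sum; apply: eq_bigr => i _.
by rewrite linearZ /= /of_chain lin_gen enc_face.
Qed.

Lemma to_chain_bd k d : supported (fun s => F s /\ size s = k.+1) d ->
  to_chain k (bd d) = rboundary (to_chain k.+1 d).
Proof.
move=> Fd; apply: (@support_ind _ _ d
  (fun d => to_chain k (bd d) = rboundary (to_chain k.+1 d))).
  by rewrite !linear0.
move=> a s c /Fd[Fs ss] IH; rewrite !linearP /= IH bd_gen to_chain_gen.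
suff -> : to_chain k (simplex_bd s) = rboundary (decode k.+1 s) by [].
by rewrite -[RHS]of_chainK -of_chain_bd decodeK // bd_gen.
Qed.

(** If h is a partial contracting homotopy then f = f (d h + h d) = (f h) d for a
    cocycle f, and f h is bounded because h is. The homotopy lives on lists, and
    [of_chain] and [to_chain] are used to carry it to the chains of [X]. *)
Lemma bounded_coboundary_of_contractible k m (B : RR) (f : rchain k -> RR^o) :
  contractible F F m B -> (k < m)%N ->
  bounded_cocycle RR X k f -> bounded_coboundary RR X k f.
Proof.
move=> [h hP] km [[f_lin [M fM]] fd].
have homotopy := contraction_homotopy F_closed hP.
have f0 : f 0 = 0.
  have := f_lin (-1) 0 0; rewrite scaler0 addr0 scaleN1r addNr => ->; done.
have fD x y : f (x + y) = f x + f y by rewrite -{1}[x]scale1r f_lin scale1r.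
have fbd d : supported (fun s => F s /\ size s = k.+1) d -> f (to_chain k (bd d)) = 0.
  by move=> Fd; rewrite to_chain_bd //; exact: (congr1 (@^~ (to_chain k.+1 d)) fd).
have hF k' c : (k' < m)%N -> supported (fun s => F s /\ size s = k') c ->
    supported (fun s => F s /\ size s = k'.+1) (lin h c).
  move=> km' Fc; apply: (supported_lin Fc) => s [Fs ss].
  have sm : (size s < m)%N by rewrite ss.
  by have [h1 _ _] := hP _ Fs sm; rewrite ss in h1.
have fE c : f c = f (to_chain k (lin h (bd (of_chain c)))).
  have Fc := @of_chain_supported _ c.
  have {1}-> : c = to_chain k (of_chain c) by rewrite of_chainK.
  rewrite -{1}(homotopy (of_chain c)); last by apply: supportedW Fc => s [? ->].
  by rewrite linearD fD fbd ?add0r //; exact: hF.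
case: k f km f_lin fM fd f0 fD fbd fE => [|k] f km f_lin fM fd f0 fD fbd fE.
  apply/funext => c; rewrite fE /of_chain linearZ /= bd_gen /= scaler0 !linear0.
  exact: f0.
exists (fun c => f (to_chain k.+1 (lin h (of_chain c)))); last first.
  apply/funext => c /=; rewrite [RHS]fE of_chain_bd; reflexivity.
split.
  by move=> a c d; rewrite !linearP /= f_lin.
exists (`|M| * `|B|) => c.
apply: le_trans (fM _) _.
apply: (@le_trans _ _ (`|M| * rnorm (to_chain k.+1 (lin h (of_chain c))))).
  apply: ler_wpM2r; last exact: ler_norm.
  by case: (to_chain _ _) => *; exact: norm1_ge0.
rewrite -mulrA ler_wpM2l //; apply: le_trans (rnorm_to_chain _ _) _.
apply: (@le_trans _ _ (`|B| * norm1 (of_chain c))); last first.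
  by rewrite ler_wpM2l // norm1_of_chain.
apply: (norm1_lin (@of_chain_supported _ c)) => s [Fs ss].
have sm : (size s < m)%N by rewrite ss (ltn_trans _ km).
by have [_ h2 _] := hP _ Fs sm; apply: le_trans h2 (ler_norm _).
Qed.

Lemma vanishing_of_contractible m (B : RR) (c : \bar int) :
  contractible F F m B ->
  (forall k : nat, ((k%:Z - 1)%:E <= c)%E -> (k < m)%N) ->
  reduced_bH_vanishes_up_to RR X c.
Proof.
move=> FB cm k /cm km.
pose Z := bounded_cocycle RR X k; pose N := bounded_coboundary RR X k.
have ZN z : Z z -> N z by exact: bounded_coboundary_of_contractible FB km.
have Z0 : Z 0.
  split; last by apply/funext.
  split; first by move=> a x y; rewrite scaler0 addr0.
  by exists 0 => x; rewrite normr0 mul0r.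
have ND b b' (e : bool) : N b -> N b' -> N (b + (-1) ^+ e *: b').
  rewrite /N; case: (k) b b' => [|j] b b'.
    by rewrite /bounded_coboundary /= => -> ->; rewrite scaler0 addr0.
  move=> [g [g_lin [M gM]] <-] [g' [g'_lin [M' g'M]] <-].
  exists (g + (-1) ^+ e *: g') => //; split.
    move=> a x y; rewrite !fctE /= g_lin g'_lin !scalerDr !scalerA.
    by rewrite [_ * a]mulrC addrACA.
  exists (M + M') => x; rewrite mulrDl; apply: le_trans (ler_normD _ _) _.
  apply: lerD => //; rewrite normrM normrX normrN1 expr1n mul1r.
  exact: g'M.
have ND1 b b' : N b -> N b' -> N (b + b').
  by move=> Nb Nb'; have := ND _ _ false Nb Nb'; rewrite expr0 scale1r.
have NB b b' : N b -> N b' -> N (b - b').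
  by move=> Nb Nb'; have := ND _ _ true Nb Nb'; rewrite expr1 scaleN1r.
have class0 z : Z z -> cohomology_class z = cohomology_class (0 : rchain k -> RR^o).
  move=> /ZN Nz; apply/seteqP; split=> _ [b Nb <-].
    by exists (z + b); rewrite ?add0r //; exact: ND1.
  by exists (b - z); [exact: NB | rewrite add0r addrC subrK].
apply/seteqP; split=> [_ [z Zz <-] | _ ->]; first exact: class0.
by exists 0.
Qed.

End Transfer.

(** * Chains in posets, and intervals of subspaces *)

Section Chains.
Variables (RR : realType) (V : choiceType).
Implicit Types (r : rel V) (S X : pred V).

Definition is_chain r S (s : seq V) : Prop := all S s && pairwise r s.

Definition chains_contractible r S m (B : RR) :=
  contractible (is_chain r S) (is_chain r S) m B.

Lemma is_chain_closed r S : closed (is_chain r S).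
Proof.
move=> s t st /andP[/allP St rt]; apply/andP; split; last exact: subseq_pairwise st rt.
by apply/allP => x /(mem_subseq st); exact: St.
Qed.

Lemma chains_contractibleW r S S' m m' (B B' : RR) : S =1 S' -> (m' <= m)%N -> B <= B' ->
  chains_contractible r S m B -> chains_contractible r S' m' B'.
Proof.
by move=> SS mm BB; apply: contractibleW => // s;
  rewrite /is_chain (eq_all SS).
Qed.

Lemma pairwise_rev r (s : seq V) :
  pairwise r (rev s) = pairwise (fun x y => r y x) s.
Proof.
elim: s => //= x s IH; rewrite rev_cons pairwise_rcons IH; congr (_ && _).
by rewrite all_rev.
Qed.

Lemma chains_contractible_dual r S m (B : RR) :
  chains_contractible r S m B -> chains_contractible (fun x y => r y x) S m B.
Proof.
move=> /(rev_contractible (@is_chain_closed r S)).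
by apply: contractibleW => // s; rewrite /is_chain all_rev pairwise_rev.
Qed.

(** An apex that precedes all other elements can only be the first vertex of a
    chain. *)
Lemma chains_cone r S m a : irreflexive r -> transitive r -> S a ->
  (forall x, S x -> x = a \/ r a x) -> chains_contractible r S m 1.
Proof.
move=> r_irr r_trans Sa Sr; apply: (@head_cone_contractible _ _ _ _ _ a).
- exact: is_chain_closed.
- move=> s /andP[/allP Ss rs] ns; apply/andP; split=> /=.
    by rewrite Sa; apply/allP.
  rewrite rs andbT; apply/allP => x xs.
  by case: (Sr _ (Ss _ xs)) => // e; rewrite -e xs in ns.
case=> //= z s /andP[/= /andP[Sz Ss] /andP[/allP zs rs]].
apply/negP => /zs za; case: (Sr _ Sz) => [e|az]; first by rewrite e r_irr in za.
by have := r_trans _ _ _ az za; rewrite r_irr.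
Qed.

(** By transitivity, the link in [X] of a chain only depends on its last
    element. *)
Lemma chains_push r S X m D (B B0 : RR) : transitive r ->
  (m <= D)%N -> 0 <= B -> 0 <= B0 -> (forall x, X x -> S x) ->
  (forall v, S v -> ~~ X v ->
     chains_contractible r (fun x => X x && r v x) m.-1 B) ->
  chains_contractible r X m B0 ->
  chains_contractible r S m (push_bound D B B0).
Proof.
move=> r_trans mD B0' B00 XS links base; apply: (@push_contractible _ _ X) => //.
- exact: is_chain_closed.
- move=> u v Xv /andP[]; rewrite all_rcons pairwise_rcons => /andP[Sv Su] /andP[uv ru].
  have E w : (all X w /\ is_chain r S (rcons u v ++ w)) <->
      is_chain r (fun x => X x && r v x) w.
    rewrite /is_chain all_cat pairwise_cat -{2}cats1 allrel_catl allrel1l.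
    rewrite all_rcons pairwise_rcons Sv Su uv ru /= all_predI; split.
      by move=> [-> /andP[_ /andP[/andP[_ ->] ->]]].
    move=> /andP[/andP[Xw vw] rw]; split=> //; rewrite rw vw !andbT.
    rewrite (sub_all XS Xw) /=; apply/allrelP => x y xu yw.
    by apply: r_trans (allP uv _ xu) (allP vw _ yw).
  apply: contractibleW (links v Sv Xv) => //; try by move=> w /E.
  by lia.
apply: contractibleW base => // s; rewrite /is_chain.
  by move=> [-> /andP[_ ->]].
by move=> /andP[Xs ->]; rewrite (sub_all XS Xs).
Qed.

End Chains.

Section Subspaces.
Variables (RR : realType) (K : fieldType) (vT : vectType K).
Implicit Types (A B U V W L : {vspace vT}).

Definition properv U W := (U <= W)%VS && ~~ (W <= U)%VS.

Lemma properv_irr : irreflexive properv.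
Proof. by move=> U; rewrite /properv andbN. Qed.

Lemma properv_trans : transitive properv.
Proof.
move=> V U W /andP[UV VU] /andP[VW WV]; rewrite /properv (subv_trans UV VW).
by apply: contra WV => WU; exact: subv_trans UV.
Qed.

Lemma properv_dim U W : properv U W -> (\dim U < \dim W)%N.
Proof.
by move=> /andP[UW WU]; rewrite (ltn_leqif (dimv_leqif_sup UW)).
Qed.

Lemma properv_sub_trans U V W : properv U V -> (V <= W)%VS -> properv U W.
Proof.
move=> /andP[UV VU] VW; rewrite /properv (subv_trans UV VW).
by apply: contra VU => WU; exact: subv_trans WU.
Qed.

Lemma eq_or_properv U W : (U <= W)%VS -> W = U \/ properv U W.
Proof.
move=> UW; have [WU|WU] := boolP (W <= U)%VS; [left|right].
  by apply/eqP; rewrite eqEsubv WU.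
by rewrite /properv UW.
Qed.

Lemma add_line_dim U (x : vT) : (\dim (U + <[x]>) <= (\dim U).+1)%N.
Proof.
have := dimv_sum_cap U <[x]>; have := dim_vline x; have := leq_b1 (x != 0).
by lia.
Qed.

Lemma add_line_properv U (x : vT) : x \notin U -> properv U (U + <[x]>).
Proof.
move=> xU; rewrite /properv addvSl /=; apply: contra xU => /subvP; apply.
by apply: (subvP (addvSr _ _)); exact: memv_line.
Qed.

Definition interval A B : pred {vspace vT} := fun W => properv A W && properv W B.

(** A uniform version of the theorem of Solomon and Tits. Let x be a vector of [B]
    outside [A] and L = A + <x>. The subspaces above L form a cone. If V does not
    contain L and V + L < B, the subspaces above both V and L form a cone with apex
    V + L, so adding all these V keeps contractibility. The remaining V are
    complements of L, of codimension one in [B], and everything strictly between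
    [A] and such a V has already been added: the link of V is the interval
    (A, V). *)
Theorem interval_contractible d :
  exists2 C : RR, 0 <= C & forall A B, (A <= B)%VS -> \dim B = (\dim A + d)%N ->
  chains_contractible properv (interval A B) d.-1 C.
Proof.
elim: d => [|d [C C0 IH]].
  by exists 0 => // A B _ _; exists (fun=> 0).
pose C1 : RR := push_bound d 1 1; have C1_ge0 : 0 <= C1 by exact: push_bound_ge0.
exists (push_bound d C C1) => [|A B AB dB].
  exact: push_bound_ge0.
have [d0|d_gt0] := posnP d; first by rewrite d0 /=; exists (fun=> 0).
have /subvPn[x xB xA] : ~~ (B <= A)%VS.
  by apply/negP => /dimvS; lia.
pose L := (A + <[x]>)%VS.
have AL : properv A L by exact: add_line_properv.
have dL : \dim L = (\dim A).+1.
  by apply/eqP; rewrite eqn_leq add_line_dim /=; exact: properv_dim.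
have LB : (L <= B)%VS by rewrite subv_add AB /= -memvE.
have LBp : properv L B by rewrite /properv LB; apply/negP => /dimvS; lia.
have xL : x \in L by apply: (subvP (addvSr _ _)); exact: memv_line.
have LV V : (A <= V)%VS -> (L <= V)%VS = (x \in V).
  by move=> AV; rewrite subv_add AV -memvE.
pose X : pred {vspace vT} := fun W => (L <= W)%VS && properv W B.
pose Y : pred {vspace vT} := fun W => interval A B W && properv (W + L) B.
have coneV V : interval A B V -> properv (V + L) B ->
    ~~ (L <= V)%VS -> chains_contractible properv (fun W => X W && properv V W) d (1 : RR).
  move=> AVB VLB LV'; apply: (@chains_cone _ _ _ _ _ (V + L)%VS).
  - exact: properv_irr.
  - exact: properv_trans.
  - rewrite /X addvSr VLB /properv addvSl /= subv_add subvv /=.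
    by rewrite LV'.
  move=> W /andP[/andP[LW WB] /andP[VW _]]; apply: eq_or_properv.
  by rewrite subv_add VW.
have coneX : chains_contractible properv X d (1 : RR).
  apply: (@chains_cone _ _ _ _ _ L).
  - exact: properv_irr.
  - exact: properv_trans.
  - by rewrite /X subvv.
  by move=> W /andP[LW _]; exact: eq_or_properv.
have contrY : chains_contractible properv Y d C1.
  apply: (@chains_push _ _ _ _ X) => //.
  - exact: properv_trans.
  - move=> W /andP[LW WB]; rewrite /Y /interval WB (properv_sub_trans AL LW).
    by rewrite (addv_idPl LW).
  move=> V /andP[AVB VLB]; rewrite negb_and.
  have /andP[_ VB] := AVB; rewrite VB orbF => LV'.
  apply: chains_contractibleW (coneV V AVB VLB LV'); rewrite ?leq_pred //.
apply: chains_contractible_dual => /=.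
pose r U W := properv W U.
have r_trans : transitive r by move=> U V W h1 h2; exact: properv_trans h2 h1.
apply: (@chains_push _ _ r _ Y) => //.
- by move=> W /andP[].
- move=> V AVB nY; have /andP[AV VB] := AVB.
  have VLB : (B <= V + L)%VS.
    move: nY; rewrite /Y AVB /properv subv_add LB /=.
    by have /andP[-> _] := VB; rewrite /= negbK.
  have dV : \dim V = (\dim A + d)%N.
    have VLx : (V + L <= V + <[x]>)%VS.
      rewrite subv_add addvSl /= LV; first exact: (subvP (addvSr _ _) _ (memv_line x)).
      by have /andP[AV' _] := AV; apply: subv_trans AV' (addvSl _ _).
    have := dimvS (subv_trans VLB VLx); have := add_line_dim V x.
    have := properv_dim VB; move: dB; clear; lia.
  have AV' : (A <= V)%VS by have /andP[] := AV.
  have IHV : chains_contractible r (interval A V) d.-1 C.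
    by apply: chains_contractible_dual; apply: IH; rewrite ?dV.
  apply: chains_contractibleW IHV => // W; apply/idP/idP; last first.
    by move=> /andP[/andP[/andP[AW _] _] WV]; rewrite /interval AW.
  move=> /andP[AW WV]; rewrite /r WV andbT /Y /interval AW.
  rewrite (properv_trans WV VB) /= /properv subv_add LB.
  have /andP[WB' _] := properv_trans WV VB; rewrite WB' /=.
  apply/negP => BW.
  have AW' : (A <= W)%VS by have /andP[] := AW.
  have WLx : (W + L <= W + <[x]>)%VS.
    rewrite subv_add addvSl /= LV; first exact: (subvP (addvSr _ _) _ (memv_line x)).
    exact: subv_trans AW' (addvSl _ _).
  have := dimvS (subv_trans BW WLx); have := add_line_dim W x.
  have := properv_dim WV; move: dV dB; clear; lia.
exact: chains_contractible_dual.
Qed.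
End Subspaces.

(** * Order complexes and the two Tits buildings *)

Lemma codom_ord (T : Type) n (f : 'I_n.+1 -> T) :
  codom f = mkseq (fun k => f (inord k)) n.+1.
Proof.
rewrite /codom /image_mem /mkseq -val_enum_ord -map_comp.
by apply: eq_map => i /=; rewrite inord_val.
Qed.

Lemma codom_lift (T : Type) n (f : 'I_n.+2 -> T) (i : 'I_n.+2) :
  codom (fun j => f (lift i j)) = take i (codom f) ++ drop i.+1 (codom f).
Proof.
have lt_i := ltn_ord i; set x0 := f ord0.
have sz m (g : 'I_m -> T) : size (codom g) = m by rewrite size_codom card_ord.
have nthc m (g : 'I_m.+1 -> T) (k : 'I_m.+1) : nth x0 (codom g) k = g k.
  by rewrite codom_ord nth_mkseq // inord_val.
apply: (@eq_from_nth _ x0) => [|k].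
  by rewrite size_cat size_take size_drop !sz lt_i; lia.
rewrite sz => lt_k; rewrite (nthc _ _ (Ordinal lt_k)) nth_cat size_take sz lt_i.
case: ltnP => ki.
  rewrite nth_take // -(nthc _ f (lift i (Ordinal lt_k))) /= /bump leqNgt ki.
  by [].
rewrite nth_drop -(nthc _ f (lift i (Ordinal lt_k))) /= /bump ki.
by congr nth; lia.
Qed.

Lemma nth_codom_ord (T : Type) (x0 : T) n (f : 'I_n -> T) (i : 'I_n) :
  nth x0 (codom f) i = f i.
Proof.
case: n f i => [|n] f i; first by case: i.
by rewrite codom_ord nth_mkseq // inord_val.
Qed.

Section OrderComplexTransfer.
Variables (RR : realType) (V : choiceType) (r : rel V) (S : pred V).
Variables (d : Order.disp_t) (T : porderType d) (iota : T -> V).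
Hypothesis iota_inj : injective iota.
Hypothesis iota_S : forall v, S v <-> exists x, iota x = v.
Hypothesis iota_lt : forall x y, (x < y)%O = r (iota x) (iota y).

Lemma order_complex_vanishing m (B : RR) (c : \bar int) :
  chains_contractible r S m B ->
  (forall k : nat, ((k%:Z - 1)%:E <= c)%E -> (k < m)%N) ->
  reduced_bH_vanishes_up_to RR (order_complex T) c.
Proof.
pose enc p (x : order_complex T p) := codom (fun i => iota (vertex x i)).
have size_enc p (x : order_complex T p) : size (enc p x) = p.+1.
  by rewrite size_codom card_ord.
apply: (@vanishing_of_contractible _ _ _ _ enc) => //.
- exact: is_chain_closed.
- move=> p x; apply/andP; split.
    by apply/allP => v /codomP[i ->]; apply/iota_S; exists (vertex x i).
  apply/(pairwiseP (iota (vertex x ord0))) => i j.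
  rewrite !inE size_enc => lt_i lt_j lt_ij.
  rewrite (nth_codom_ord _ _ (Ordinal lt_i)) (nth_codom_ord _ _ (Ordinal lt_j)).
  by rewrite -iota_lt vertex_lt.
- move=> p x y /= exy; apply: poset_chain_inj; apply/funext => i.
  have := congr1 (fun s => nth (iota (vertex x i)) s i) exy.
  by rewrite /enc !nth_codom_ord => /iota_inj.
- move=> p s /andP[/allP Ss rs] ss.
  have [v0 _] : exists v0 : V, True by case: s ss {Ss rs} => // v0; exists v0.
  have /choice[x xP] : forall i : 'I_p.+1, exists t, iota t = nth v0 s i.
    by move=> i; apply/iota_S/Ss/mem_nth; rewrite ss.
  have x_lt (i j : 'I_p.+1) : (i < j)%N -> (x i < x j)%O.
    by move=> lt_ij; rewrite iota_lt !xP; apply: (pairwiseP v0 rs) => //;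
      rewrite inE ss.
  exists (PosetChain x_lt); apply: (@eq_from_nth _ v0); rewrite size_enc // => i lt_i.
  by rewrite (nth_codom_ord _ _ (Ordinal lt_i)) /= xP.
- by move=> p x i; rewrite /enc -codom_lift.
Qed.

End OrderComplexTransfer.

Lemma subspace_order_complex_vanishing (RR : realType) (K : fieldType)
    (vT : vectType K) (P : pred {vspace vT}) m (B : RR) (c : \bar int) :
  chains_contractible (@properv K vT) P m B ->
  (forall k : nat, ((k%:Z - 1)%:E <= c)%E -> (k < m)%N) ->
  reduced_bH_vanishes_up_to RR (order_complex (subspace_of P)) c.
Proof.
apply: (@order_complex_vanishing _ _ _ _ _ _ (@carrier K vT P)).
- exact: val_inj.
- move=> U; split=> [PU|[x <-]]; last exact: carrierP.
  by exists (SubspaceOf PU).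
by move=> U W; rewrite lt_leAnge.
Qed.

Theorem tits_building_A_vanishing (RR : realType) (K : fieldType) n :
  reduced_bH_vanishes_up_to RR (tits_building_A K n) (n%:Z - 3)%:E.
Proof.
have [C _ IC] := @interval_contractible RR K 'cV[K]_n n.
apply: (@subspace_order_complex_vanishing _ _ _ _ n.-1 C); last first.
  by move=> k; rewrite lee_fin; lia.
have := IC 0%VS fullv (sub0v _).
rewrite dimv0 dimvf dim_matrix mulr1 => /(_ erefl).
apply: chains_contractibleW => // U; rewrite /interval /properv sub0v subvf /=.
by rewrite subv0; congr (_ && ~~ _); rewrite eqEsubv subvf.
Qed.

Section Symplectic.
Variables (RR : realType) (K : fieldType) (vT : vectType K).
Variable form : vT -> vT -> K.
Hypothesis form_linear : forall x, linear (form x : vT -> K^o).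
Hypothesis form_alt : forall x, form x x = 0.
Hypothesis form_anti : forall x y, form x y = - form y x.
Implicit Types (A U V W L : {vspace vT}).

Definition isotropic_for U := forall x y, x \in U -> y \in U -> form x y = 0.

Lemma perp_subproof x : exists W, (forall y, (y \in W) = (form x y == 0)) /\
  (forall U, (\dim U <= \dim (U :&: W)%VS + 1)%N).
Proof.
pose f := HB.pack_for {linear vT -> K^o} (form x : vT -> K^o)
   (GRing.isLinear.Build K vT K^o _ (form x : vT -> K^o) (form_linear x)).
exists (lker (linfun f)); split=> [y|U]; first by rewrite memv_ker lfunE.
have := limg_ker_dim (linfun f) U; have := dimvS (subvf (linfun f @: U)).
by rewrite dimvf => + <-; rewrite leq_add2l.
Qed.

Definition perp x := projT1 (cid (perp_subproof x)).

Lemma mem_perp x y : (y \in perp x) = (form x y == 0).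
Proof. by rewrite /perp; case: cid => W [] /=. Qed.

Lemma dim_cap_perp x U : (\dim U <= \dim (U :&: perp x)%VS + 1)%N.
Proof. by rewrite /perp; case: cid => W [] /=. Qed.

Lemma perp_seq (s : seq vT) : exists W, (\dim {:vT} <= \dim W + size s)%N /\
  forall x y, x \in s -> y \in W -> form x y = 0.
Proof.
elim: s => [|a s [W [dW Ws]]]; first by exists fullv; rewrite addn0.
exists (W :&: perp a)%VS; split.
  by have := dim_cap_perp a W; move: dW; clear => /=; lia.
move=> x y; rewrite inE => /orP[/eqP ->|xs] /memv_capP[yW ya].
  by apply/eqP; rewrite -mem_perp.
exact: Ws.
Qed.

(** The orthogonal of [A] has codimension at most the dimension of [A], so it is
    not contained in [A] when twice that dimension is too small. *)
Lemma perp_outside A : (2 * \dim A < \dim {:vT})%N ->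
  exists2 x, x \notin A & (A <= perp x)%VS.
Proof.
move=> dA; have [W [dW WA]] := perp_seq (vbasis A).
have /subvPn[x xW xA] : ~~ (W <= A)%VS.
  apply/negP => /dimvS; move: dW dA; rewrite size_tuple; clear; lia.
exists x => //; rewrite -(span_basis (vbasisP A)); apply/span_subvP => a aA.
by rewrite mem_perp form_anti WA ?oppr0.
Qed.

Lemma isotropic_add_line U x : isotropic_for U -> (U <= perp x)%VS ->
  isotropic_for (U + <[x]>).
Proof.
move=> Uiso /subvP Ux y z /memv_addP[u uU [_ /vlineP[a ->] ->]].
move=> /memv_addP[v vU [_ /vlineP[b ->] ->]].
have fD t u' v' : form t (u' + v') = form t u' + form t v'.
  by rewrite -[u']scale1r form_linear !scale1r.
have f0 t : form t 0 = 0.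
  by have := form_linear t (-1) 0 0; rewrite scaler0 addr0 scaleN1r addNr.
have fZ t c v' : form t (c *: v') = c * form t v'.
  by rewrite -[c *: v']addr0 form_linear f0 addr0.
have xU w : w \in U -> form x w = 0 by move=> /Ux; rewrite mem_perp => /eqP.
have Ux' w : w \in U -> form w x = 0 by move=> wU; rewrite form_anti xU ?oppr0.
have xy : form x (u + a *: x) = 0 by rewrite fD fZ xU // form_alt mulr0 addr0.
rewrite fD fZ [form _ x]form_anti xy oppr0 mulr0 addr0.
by rewrite form_anti fD fZ Ux' // mulr0 addr0 Uiso ?oppr0.
Qed.

Definition above_isotropic A : pred {vspace vT} :=
  fun W => properv A W && `[< isotropic_for W >].

Lemma isotropic_sub U W : (U <= W)%VS -> isotropic_for W -> isotropic_for U.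
Proof. by move=> /subvP UW Wiso x y /UW xW /UW; exact: Wiso. Qed.

(** Let x be orthogonal to [A] and not in it. The isotropic subspaces above
    L = A + <x> form a cone [X]. If V is orthogonal to x then V + L is isotropic and
    is an apex for the part of [X] above V; this adds [Y]. If V is not orthogonal to
    x, its intersection with the orthogonal of x is a hyperplane of V, and it is an
    apex for the part of [Y] below V as soon as it is larger than [A]; this adds
    [Y']. The remaining V cover [A], and what lies above such a V is the same
    complex for V in place of [A]. *)
Theorem above_isotropic_contractible n e : \dim {:vT} = (n + n)%N ->
  exists2 C : RR, 0 <= C & forall A, isotropic_for A -> (\dim A + e = n)%N ->
  chains_contractible (@properv K vT) (above_isotropic A) e C.
Proof.
move=> dimn; elim: e => [|e [C C_ge0 IH]].
  by exists 0 => // A _ _; exists (fun=> 0).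
pose C1 : RR := push_bound e.+1 1 1.
have C1_ge0 : 0 <= C1 by exact: push_bound_ge0.
pose C2 : RR := push_bound e.+1 1 C1.
have C2_ge0 : 0 <= C2 by exact: push_bound_ge0.
exists (push_bound e.+1 C C2) => [|A Aiso dA]; first exact: push_bound_ge0.
have [|x xA Ax] := @perp_outside A; first by rewrite dimn; move: dA; clear; lia.
pose L := (A + <[x]>)%VS.
have Liso : isotropic_for L by exact: isotropic_add_line.
have AL : properv A L by exact: add_line_properv.
have xL : x \in L by apply: (subvP (addvSr _ _)); exact: memv_line.
have LV V : (A <= V)%VS -> (L <= V)%VS = (x \in V).
  by move=> AV; rewrite subv_add AV -memvE.
have properv_r := @properv_trans K vT.
pose r U W := @properv K vT W U.
have r_trans : transitive r by move=> U V W h1 h2; exact: properv_r h2 h1.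
have r_irr : irreflexive r by exact: properv_irr.
pose X : pred {vspace vT} := fun W => (L <= W)%VS && `[< isotropic_for W >].
pose Y : pred {vspace vT} := fun W => above_isotropic A W && (W <= perp x)%VS.
pose Y' : pred {vspace vT} := fun W =>
  above_isotropic A W && ((W <= perp x)%VS || ((\dim A).+1 < \dim W)%N).
have contrX : chains_contractible (@properv K vT) X e.+1 (1 : RR).
  apply: (@chains_cone _ _ _ _ _ L) => //.
    by rewrite /X subvv; apply/asboolP.
  by move=> W /andP[LW _]; exact: eq_or_properv.
have contrY : chains_contractible (@properv K vT) Y e.+1 C1.
  apply: (@chains_push _ _ _ _ X) => //.
    move=> W /andP[LW Wiso]; rewrite /Y /above_isotropic Wiso andbT.
    rewrite (properv_sub_trans AL LW); apply/subvP => w wW.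
    rewrite mem_perp; apply/eqP; apply: (asboolP _ Wiso) => //.
    exact: subvP LW _ xL.
  move=> V /andP[/andP[AV Viso] Vx]; rewrite negb_and Viso orbF => LV'.
  have AV' : (A <= V)%VS by have /andP[] := AV.
  apply: (@chains_cone _ _ _ _ _ (V + <[x]>)%VS) => //.
    rewrite /X LV ?(subv_trans AV' (addvSl _ _)) //.
    rewrite (subvP (addvSr _ _) _ (memv_line x)) /= add_line_properv; last first.
      by rewrite -LV.
    by rewrite andbT; apply/asboolP/isotropic_add_line/Vx/asboolP.
  move=> W /andP[/andP[LW _] /andP[VW _]]; apply: eq_or_properv.
  by rewrite subv_add VW -memvE (subvP LW).
have contrY' : chains_contractible (@properv K vT) Y' e.+1 C2.
  apply: (chains_contractible_dual (r := r)); apply: (@chains_push _ _ r _ Y) => //.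
  - by move=> W /andP[? ?]; apply/andP; split=> //; apply/orP; left.
  - move=> V /andP[/andP[AV Viso] dV]; rewrite /Y /above_isotropic AV Viso /= => Vx.
    rewrite (negbTE Vx) /= in dV.
    have AV' : (A <= V)%VS by have /andP[] := AV.
    apply: (@chains_cone _ _ _ _ _ (V :&: perp x)%VS) => //.
      rewrite /Y /above_isotropic capvSr andbT /r /properv capvSl.
      rewrite !subv_cap subvv (negbTE Vx) AV' Ax /= !andbT; apply/andP; split; last first.
        by apply/asboolP/(isotropic_sub (capvSl _ _))/asboolP.
      apply/negP => /dimvS; have := dim_cap_perp x V; move: dV; clear; lia.
    move=> W /andP[/andP[_ Wx] /andP[WV _]].
    by case: (@eq_or_properv K vT W (V :&: perp x)%VS) => [|->|]; [
       rewrite subv_cap WV | left | right].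
  exact: chains_contractible_dual.
apply: (@chains_push _ _ _ _ Y') => //.
  by move=> W /andP[].
move=> V AV; rewrite /Y' AV negb_or -leqNgt => /andP[_ dV].
have /andP[AV' /asboolP Viso] := AV.
have dV' : \dim V = (\dim A).+1.
  by apply/eqP; rewrite eqn_leq dV properv_dim.
have IHV : chains_contractible (@properv K vT) (above_isotropic V) e C.
  by apply: IH => //; rewrite dV'; move: dA; clear; lia.
apply: chains_contractibleW IHV => // W.
rewrite /Y' /above_isotropic; case: (boolP (properv V W)) => VW; rewrite ?andbF //=.
by rewrite (properv_r _ _ _ AV' VW) -dV' (properv_dim VW) orbT !andbT.
Qed.

End Symplectic.

Theorem tits_building_C_vanishing (RR : realType) (K : fieldType) n :
  reduced_bH_vanishes_up_to RR (tits_building_C K n) (n%:Z - 2)%:E.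
Proof.
have lin x : linear (std_symplectic x : 'cV[K]_(n + n) -> K^o).
  move=> a y z; rewrite /std_symplectic scaler_sumr -big_split.
  apply: eq_bigr => i _ /=; rewrite !mxE /GRing.scale /=; ring.
have alt (x : 'cV[K]_(n + n)) : std_symplectic x x = 0 :> K.
  by rewrite /std_symplectic big1 // => i _; rewrite mulrC subrr.
have anti (x y : 'cV[K]_(n + n)) : std_symplectic x y = - std_symplectic y x :> K.
  rewrite /std_symplectic -sumrN; apply: eq_bigr => i _; ring.
have dimn : \dim {:'cV[K]_(n + n)} = (n + n)%N by rewrite dimvf dim_matrix mulr1.
have [C _ IC] := above_isotropic_contractible RR lin alt anti n dimn.
apply: (@subspace_order_complex_vanishing _ _ _ _ n C); last first.
  by move=> k; rewrite lee_fin; lia.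
have iso0 : isotropic_for (@std_symplectic K n) 0%VS.
  move=> x y _; rewrite memv0 => /eqP ->.
  by have := lin x (-1) 0 0; rewrite scaler0 addr0 scaleN1r addNr.
have := IC 0%VS iso0; rewrite dimv0 => /(_ erefl).
by apply: chains_contractibleW => // U; rewrite /above_isotropic /properv sub0v subv0.
Qed.

(** * Unimodular sequences and stable rank *)

Section Functionals.
Variables (S : pzRingType) (V : lmodType S).
Implicit Types (f g : V -> S) (x y v : V) (s t u : seq V).

Definition functional f := forall a x y, f (a *: x + y) = a * f x + f y.

Lemma functional0 f : functional f -> f 0 = 0.
Proof. by move=> /(_ (-1) 0 0); rewrite scaler0 addr0 mulN1r addNr. Qed.

Lemma functionalD f x y : functional f -> f (x + y) = f x + f y.
Proof. by move=> /(_ 1 x y); rewrite scale1r mul1r. Qed.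

Lemma functionalZ f a x : functional f -> f (a *: x) = a * f x.
Proof. by move=> fl; have := fl a x 0; rewrite functional0 // !addr0. Qed.

Lemma functionalB f x y : functional f -> f (x - y) = f x - f y.
Proof.
by move=> fl; rewrite -scaleN1r functionalD // functionalZ // mulN1r.
Qed.

Lemma functional_sum f n (x : nat -> V) : functional f ->
  f (\sum_(i < n) x i) = \sum_(i < n) f (x i).
Proof.
move=> fl; elim: n => [|n IH]; first by rewrite !big_ord0 functional0.
by rewrite !big_ord_recr /= functionalD // IH.
Qed.

Lemma functional_addM f g a : functional f -> functional g ->
  functional (fun v => f v + g v * a).
Proof.
move=> fl gl b x y; rewrite fl gl mulrDl mulrDr -!mulrA addrACA.
by [].
Qed.

Lemma functional_subM f g a : functional f -> functional g ->
  functional (fun v => f v - g v * a).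
Proof.
by move=> fl gl b x y; rewrite fl gl mulrDl mulrBr -!mulrA opprD addrACA.
Qed.

Lemma functional_sumM n (f : nat -> V -> S) (a : nat -> S) :
  (forall i, (i < n)%N -> functional (f i)) ->
  functional (fun v => \sum_(i < n) f i v * a i).
Proof.
move=> fl b x y; rewrite mulr_sumr -big_split; apply: eq_bigr => i _ /=.
by rewrite fl // mulrDl mulrA.
Qed.

(** A list is unimodular when it has a dual family of functionals, that is when
    the homomorphism it defines from a free module is a split injection. Picking an
    entry by means of [perm_eq] rather than by its index makes the invariance under
    permutations immediate. *)
Definition uni s := forall x s', perm_eq s (x :: s') ->
  exists f, [/\ functional f, f x = 1 & forall y, y \in s' -> f y = 0].

Lemma uni_perm s t : perm_eq s t -> uni s -> uni t.
Proof. by move=> st us x s' tx; apply: us; exact: perm_trans st tx. Qed.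

Lemma uni_catl s t : uni (s ++ t) -> uni s.
Proof.
move=> us x s' sx; have [|f [fl fx f0]] := us x (s' ++ t).
  by rewrite -cat_cons perm_cat2r.
by exists f; split=> // y ys; apply: f0; rewrite mem_cat ys.
Qed.

Lemma uni_subseq s t : subseq s t -> uni t -> uni s.
Proof.
by move=> /perm_to_subseq[r tr] /(uni_perm tr); exact: uni_catl.
Qed.

Lemma uni_cons b s f : functional f -> f b = 1 -> (forall y, y \in s -> f y = 0) ->
  uni s -> uni (b :: s).
Proof.
move=> fl fb f0 us x s' p.
have [xb|xb] := eqVneq b x.
  by subst x; move: p; rewrite perm_cons => /perm_mem p; exists f;
    split=> // y; rewrite -p; exact: f0.
have bs' : b \in s'.
  have : b \in x :: s' by rewrite -(perm_mem p) mem_head.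
  by rewrite inE (negbTE xb).
have p' : perm_eq s (x :: rem b s').
  rewrite -(perm_cons b); apply: perm_trans p _.
  by rewrite perm_sym (perm_catCA [:: b] [:: x]) /= perm_cons perm_sym perm_to_rem.
have [g [gl gx g0]] := us _ _ p'.
have xs : x \in s by rewrite (perm_mem p') mem_head.
exists (fun v => g v - f v * g b); split.
- exact: functional_subM.
- by rewrite gx f0 // mul0r subr0.
move=> y; rewrite (perm_mem (perm_to_rem bs')) inE => /orP[/eqP ->|ys].
  by rewrite fb mul1r subrr.
by rewrite g0 // f0 ?mul0r ?subr0 // (perm_mem p') inE ys orbT.
Qed.

(** [u] is a list of vectors that the coordinates on [W] ignore. Completing [u] by
    vectors of [W] only involves [W] modulo these vectors, so enlarging [u] replaces
    passing to a quotient module. *)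
Definition frame n (e : nat -> V) (es : nat -> V -> S) (W : V -> Prop) u :=
  [/\ forall i, (i < n)%N -> functional (es i),
      forall i j, (i < n)%N -> (j < n)%N -> es i (e j) = (i == j)%:R,
      forall v, W v <-> v = \sum_(i < n) es i v *: e i &
      forall i, (i < n)%N -> forall y, y \in u -> es i y = 0].

Definition free_rank n W u := exists e es, frame n e es W u.

(** The condition (SR) in terms of left modules: columns over a ring are a left
    module over the opposite ring, hence the coefficients on the right. *)
Definition sr_condition l := forall n, (l <= n)%N -> forall x g : nat -> S,
  \sum_(i < n.+1) x i * g i = 1 ->
  exists t g' : nat -> S, \sum_(i < n) (x i + x n * t i) * g' i = 1.

Lemma sum_delta n (a : nat -> S) j : (j < n)%N ->
  \sum_(i < n) a i * (nat_of_ord i == j)%:R = a j.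
Proof.
move=> jn; rewrite (bigD1 (Ordinal jn)) //= eqxx mulr1 big1 ?addr0 // => i ij.
by rewrite (_ : (i == j :> nat) = false) ?mulr0 //; apply: contraNF ij => /eqP ij;
  apply/eqP/val_inj.
Qed.

Lemma sum_deltal n (a : nat -> S) j : (j < n)%N ->
  \sum_(i < n) (nat_of_ord i == j)%:R * a i = a j.
Proof.
move=> jn; rewrite (bigD1 (Ordinal jn)) //= eqxx mul1r big1 ?addr0 // => i ij.
by rewrite (_ : (i == j :> nat) = false) ?mul0r //; apply: contraNF ij => /eqP ij;
  apply/eqP/val_inj.
Qed.

Lemma frame_span n e es W u (a : nat -> S) : frame n e es W u ->
  W (\sum_(i < n) a i *: e i).
Proof.
move=> [fl dual Wv _]; apply/Wv; apply: eq_bigr => j _; congr (_ *: _).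
have flj := fl _ (ltn_ord j).
rewrite (functional_sum _ (fun i => a i *: e i)) //.
under eq_bigr => i _ do rewrite functionalZ // dual // eq_sym.
by rewrite sum_delta.
Qed.

Lemma frame_e n e es W u j : frame n e es W u -> (j < n)%N -> W (e j).
Proof.
move=> fr jn; have := frame_span (fun i => (i == j)%:R) fr.
rewrite (bigD1 (Ordinal jn)) //= eqxx scale1r big1 ?addr0 // => i ij.
by rewrite (_ : (i == j :> nat) = false) ?scale0r //; apply: contraNF ij => /eqP ij;
  apply/eqP/val_inj.
Qed.

Section Submodule.
Variables (n : nat) (e : nat -> V) (es : nat -> V -> S) (W : V -> Prop) (u : seq V).
Hypothesis fr : frame n e es W u.

Lemma frame_sub : forall x y, W x -> W y -> W (x - y).
Proof.
move: fr => [fl _ Wv _] x y /Wv xE /Wv yE; apply/Wv.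
rewrite {1}xE {1}yE -sumrB; apply: eq_bigr => i _.
by rewrite (functionalB _ _ (fl _ (ltn_ord i))) scalerBl.
Qed.

Lemma frame_zero : W 0.
Proof.
move: fr => [fl _ Wv _]; apply/Wv; rewrite big1 // => i _.
by rewrite (functional0 (fl _ (ltn_ord i))) scale0r.
Qed.

Lemma frame_add : forall x y, W x -> W y -> W (x + y).
Proof.
move=> x y Wx Wy; rewrite -[y]opprK; apply: frame_sub => //.
by rewrite -sub0r; apply: frame_sub => //; exact: frame_zero.
Qed.

Lemma frame_scale a x : W x -> W (a *: x).
Proof.
move: fr => [fl _ Wv _] /Wv xE; apply/Wv.
rewrite {1}xE scaler_sumr; apply: eq_bigr => i _.
by rewrite (functionalZ _ _ (fl _ (ltn_ord i))) scalerA.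
Qed.

Lemma frame_change f (t : nat -> S) : functional f ->
  (forall v, W v -> f v = 0) -> 
  forall u', (forall i, (i < n)%N -> forall y, y \in u' -> es i y + f y * t i = 0) ->
  frame n e (fun i v => es i v + f v * t i) W u'.
Proof.
move: (fr) => [fl dual Wv _] ff fW u' u'0; split.
- by move=> i ltin; apply: functional_addM => //; exact: fl.
- move=> i j ltin ltjn; rewrite fW ?mul0r ?addr0 ?dual //.
  exact: frame_e fr ltjn.
- move=> v; split=> [Wv'|->].
    rewrite {1}(Wv v).1 //; apply: eq_bigr => i _.
    by rewrite fW // mul0r addr0.
  exact: (frame_span (fun i => es i v + f v * t i) fr).
exact: u'0.
Qed.

End Submodule.

(** With [f y = 1], the coordinates of [y] and the value at [y] of the part of [f]
    that vanishes on [W] form a unimodular column, of length [n.+1]. The stable range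
    condition allows to add multiples of that part to the coordinates on [W] so that
    the coordinates of [y] become unimodular on their own. This changes neither
    [W] nor the values on [u]. *)
Lemma improve_frame l n e es W u y f : sr_condition l -> (l <= n)%N ->
  frame n e es W u -> functional f -> f y = 1 -> (forall z, z \in u -> f z = 0) ->
  exists es' (g : nat -> S), frame n e es' W u /\ \sum_(i < n) es' i y * g i = 1.
Proof.
move=> sr sn fr ff fy fu; have [fl dual Wv u0] := fr.
pose f' v := f v - (\sum_(i < n) es i v * f (e i)) * 1.
have f'l : functional f'.
  by apply: functional_subM => //; exact: (functional_sumM (fun i => f (e i)) fl).
have f'W v : W v -> f' v = 0.
  move=> /Wv vE; rewrite /f' mulr1 {1}vE (functional_sum _ (fun i => es i v *: e i)) //.
  under eq_bigr => i _ do rewrite functionalZ //.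
  by rewrite subrr.
have f'u z : z \in u -> f' z = 0.
  move=> zu; rewrite /f' fu // big1 ?mul0r ?subr0 // => i _.
  by rewrite u0 // mul0r.
pose x i := if (i < n)%N then es i y else f' y.
pose g i := if (i < n)%N then f (e i) else 1.
have xg : \sum_(i < n.+1) x i * g i = 1.
  rewrite big_ord_recr /= /x /g ltnn mulr1.
  rewrite (eq_bigr (fun i : 'I_n => es i y * f (e i))); last first.
    by move=> i _; rewrite ltn_ord.
  by rewrite /f' mulr1 addrC subrK.
have [t [g' tg]] := sr n sn x g xg.
exists (fun i v => es i v + f' v * t i), g'; split.
  apply: (frame_change fr) => // i ltin z zu.
  by rewrite f'u // u0 // mul0r addr0.
rewrite -[RHS]tg; apply: eq_bigr => i _.
by rewrite /x ltn_ord ltnn.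
Qed.

(** A unimodular column of length at least [l + 2] can be moved to the last basis
    vector by elementary operations: the stable range condition makes the first [n]
    coordinates unimodular ([es1]), a combination of them makes the last coordinate
    equal to 1 ([p]), and the last coordinate then clears the others ([es3]). Then
    [y] joins the vectors that the coordinates ignore, and [W'] is the part of
    [W] where [p] vanishes. *)
Lemma reduce_frame l n e es W u y (g : nat -> S) : sr_condition l -> (l <= n)%N ->
  frame n.+1 e es W u -> \sum_(i < n.+1) es i y * g i = 1 ->
  exists W' p e', [/\ free_rank n W' (y :: u), forall v, W' v -> W v,
     functional p /\ p y = 1, (forall v, W' v \/ v \in u -> p v = 0) & W e' /\ p e' = 1].
Proof.
move=> sr sn fr yg; have [fl dual Wv u0] := fr.
have [t [g' tg]] := sr n sn (fun i => es i y) g yg.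
have ltS i : (i < n)%N -> (i < n.+1)%N by exact: leqW.
pose es1 i v := es i v + es n v * t i.
have es1l i : (i < n)%N -> functional (es1 i).
  by move=> ltin; apply: functional_addM; apply: fl => //; exact: ltS.
pose c i := g' i * (1 - es n y).
pose p v := es n v + (\sum_(i < n) es1 i v * c i) * 1.
have pl : functional p.
  by apply: functional_addM; [exact: fl | exact: (functional_sumM c es1l)].
have py : p y = 1.
  rewrite /p mulr1; under eq_bigr => i _ do rewrite /c mulrA.
  by rewrite -mulr_suml /es1 tg mul1r addrC subrK.
pose es3 i v := es1 i v - p v * es1 i y.
have es3l i : (i < n)%N -> functional (es3 i).
  by move=> ltin; apply: functional_subM => //; exact: es1l.
pose e1 := e n - \sum_(i < n) t i *: e i.
have We1 : W e1.
  apply: (frame_sub fr); first exact: frame_e fr _.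
  have -> : \sum_(i < n) t i *: e i =
      \sum_(i < n.+1) (if (i < n)%N then t i else 0) *: e i.
    rewrite big_ord_recr /= ltnn scale0r addr0; apply: eq_bigr => i _.
    by rewrite ltn_ord.
  exact: (frame_span (fun i => if (i < n)%N then t i else 0) fr).
have es_e1 i : (i <= n)%N -> es i e1 = if (i < n)%N then - t i else 1.
  move=> lein; have fli : functional (es i) by exact: fl.
  rewrite /e1 functionalB // dual // (functional_sum _ (fun i => t i *: e i)) //.
  under eq_bigr => j _ do rewrite functionalZ // dual // ?ltnS // ?(ltnW (ltn_ord _)) // eq_sym.
  case: ltnP => [ltin|]; first by rewrite sum_delta // ltn_eqF // sub0r.
  move=> leni; have -> : i = n by apply/eqP; rewrite eqn_leq lein.
  rewrite eqxx big1 ?subr0 // => j _.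
  by rewrite ltn_eqF ?mulr0.
have es1_e1 i : (i < n)%N -> es1 i e1 = 0.
  by move=> ltin; rewrite /es1 !es_e1 // ?(ltnW ltin) // ltin ltnn mul1r addNr.
have pe1 : p e1 = 1.
  rewrite /p es_e1 // ltnn big1 ?mul0r ?addr0 // => i _.
  by rewrite es1_e1 // mul0r.
pose e2 i := e i - c i *: e1.
have We2 i : (i < n)%N -> W (e2 i).
  move=> ltin; apply: (frame_sub fr); first by apply: frame_e fr _; exact: ltS.
  exact: (frame_scale fr).
have es1_e i j : (i < n)%N -> (j < n)%N -> es1 i (e j) = (i == j)%:R.
  move=> ltin ltjn; rewrite /es1 (dual _ _ (ltS _ ltin) (ltS _ ltjn)).
  by rewrite (dual _ _ (ltnSn n) (ltS _ ltjn)) (gtn_eqF ltjn) mul0r addr0.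
have p_e i : (i < n)%N -> p (e i) = c i.
  move=> ltin; rewrite /p (dual _ _ (ltnSn n) (ltS _ ltin)) (gtn_eqF ltin) add0r mulr1.
  under eq_bigr => j _ do rewrite es1_e //.
  by rewrite sum_deltal.
have p_e2 i : (i < n)%N -> p (e2 i) = 0.
  by move=> ltin; rewrite /e2 functionalB // functionalZ // pe1 p_e // mulr1 subrr.
have es3_e2 i j : (i < n)%N -> (j < n)%N -> es3 i (e2 j) = (i == j)%:R.
  move=> ltin ltjn; rewrite /es3 p_e2 // mul0r subr0 /e2.
  by rewrite (functionalB _ _ (es1l _ ltin)) (functionalZ _ _ (es1l _ ltin)) es1_e1 // mulr0 subr0 es1_e.
pose W' v := W v /\ p v = 0.
have u_es1 i z : (i < n)%N -> z \in u -> es1 i z = 0.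
  move=> ltin zu; rewrite /es1 (u0 _ (ltS _ ltin) _ zu).
  by rewrite (u0 _ (ltnSn n) _ zu) mul0r addr0.
have pu z : z \in u -> p z = 0.
  move=> zu; rewrite /p (u0 _ (ltnSn n) _ zu) add0r big1 ?mul0r // => i _.
  by rewrite u_es1 // mul0r.
exists W', p, e1; split=> //; first last.
- by move=> v [[]|] //; exact: pu.
- by move=> v [].
exists e2, es3; split=> //.
- move=> v; split=> [[/Wv vE pv]|vE].
    have es3v i : es3 i v = es1 i v by rewrite /es3 pv mul0r subr0.
    under eq_bigr => i _ do rewrite es3v /e2 scalerBr scalerA.
    rewrite sumrB -scaler_suml.
    have -> : \sum_(i < n) es1 i v * c i = - es n v.
      by move/eqP: pv; rewrite /p mulr1 addrC addr_eq0 => /eqP.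
    rewrite scaleNr opprK {1}vE big_ord_recr /= /e1 scalerBr.
    under [X in _ = X + _]eq_bigr => i _ do rewrite /es1 scalerDl -scalerA.
    rewrite big_split /= -scaler_sumr -addrA; congr (_ + _).
    by rewrite addrC subrK.
  rewrite vE; split.
    elim: (n) We2 => [|k IH] We2'; first by rewrite big_ord0; exact: (frame_zero fr).
    rewrite big_ord_recr /=; apply: (frame_add fr).
      by apply: IH => i ltik; apply: We2'; exact: leqW.
    by apply: (frame_scale fr); exact: We2'.
  rewrite (functional_sum _ (fun i => es3 i v *: e2 i)) // big1 // => i _.
  by rewrite functionalZ // p_e2 // mulr0.
move=> i ltin z; rewrite inE => /orP[/eqP ->|zu].
  by rewrite /es3 py mul1r subrr.
by rewrite /es3 pu // mul0r subr0 u_es1.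
Qed.

End Functionals.

(** * Complexes of unimodular sequences *)

Ltac count_perm := apply/permP => ?; rewrite -?cats1 /=;
  rewrite ?count_cat /= ?count_cat /= ?count_cat /=; clear; lia.

Section UnimodularLists.
Variables (RR : realType) (S : pzRingType) (V : lmodType S).
Implicit Types (B X W : V -> Prop) (s t u w : seq V).

Definition uni_lists B u w := (forall x, x \in w -> B x) /\ uni (w ++ u).

Definition uni_contractible B u m (C : RR) :=
  contractible (uni_lists B u) (uni_lists B u) m C.

Lemma uni_lists_closed B u : closed (uni_lists B u).
Proof.
move=> s t st [Bt ut]; split=> [x /(mem_subseq st)|]; first exact: Bt.
by apply: uni_subseq ut; exact: cat_subseq.
Qed.

Lemma uni_contractibleW B u u' m m' (C C' : RR) : perm_eq u u' -> (m' <= m)%N ->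
  C <= C' -> uni_contractible B u m C -> uni_contractible B u' m' C'.
Proof.
move=> uu' mm CC; apply: contractibleW => // w [Bw uw]; split=> //.
  by apply: uni_perm uw; rewrite perm_cat2l perm_sym.
by apply: uni_perm uw; rewrite perm_cat2l.
Qed.

Lemma uni_push B X u m D (C C0 : RR) : (m <= D)%N -> 0 <= C -> 0 <= C0 ->
  (forall v, X v -> B v) ->
  (forall t x, ~ X x -> B x ->
     uni_contractible X (u ++ rcons t x) (m - (size t).+1) C) ->
  contractible (uni_lists X u) (uni_lists B u) m C0 ->
  uni_contractible B u m (push_bound D C C0).
Proof.
move=> mD C_ge0 C0_ge0 XB links base.
have allX w : all (fun v => `[< X v >]) w <-> (forall x, x \in w -> X x).
  split=> [/allP h x /h /asboolP //|h]; apply/allP => x /h Xx; exact/asboolP.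
apply: (@push_contractible _ _ (fun v => `[< X v >])) => //.
- exact: uni_lists_closed.
- move=> t x /asboolP nXx [Btx _].
  have E w : (all (fun v => `[< X v >]) w /\ uni_lists B u (rcons t x ++ w)) <->
      uni_lists X (u ++ rcons t x) w.
    have p : perm_eq ((rcons t x ++ w) ++ u) (w ++ u ++ rcons t x).
      by rewrite -catA perm_catC catA.
    split=> [[/allX Xw [_ uw]]|[Xw uw]].
      by split=> //; exact: uni_perm p uw.
    split; first exact/allX.
    split=> [y|]; last by apply: uni_perm uw; rewrite perm_sym.
    by rewrite mem_cat => /orP[/Btx //|/Xw /XB].
  have Bx : B x by apply: Btx; rewrite mem_rcons mem_head.
  by apply: contractibleW (links t x nXx Bx) => // w /E.
apply: contractibleW base => // w [/allX Xw [_ uw]]; split=> //.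
Qed.

Lemma contractible0 (U : choiceType) (G F : seq U -> Prop) (C : RR) : contractible G F 0 C.
Proof. by exists (fun=> 0). Qed.

Lemma contractible1 (U : choiceType) (G F : seq U -> Prop) x (C : RR) :
  1 <= C -> F [:: x] -> contractible G F 1 C.
Proof.
move=> C_ge1 Fx; exists (fun=> unit_chain RR [:: x]) => s _; rewrite ltnS leqn0 size_eq0 => /eqP ->.
split; [exact: supported_gen | by rewrite norm1_gen |].
by rewrite bd_gen /= !linear0 ?subr0 !addr0.
Qed.

Lemma not_uni_contractible B u m (C : RR) : ~ uni u -> uni_contractible B u m C.
Proof.
move=> nu; exists (fun=> 0) => w [_ uw]; case: nu.
by apply: uni_subseq uw; exact: suffix_subseq.
Qed.

Lemma uni_head y t : uni (y :: t) ->
  exists f, [/\ functional f, f y = 1 & forall z, z \in t -> f z = 0].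
Proof. by move=> ut; exact: (ut y t). Qed.

(** The vertices that lie in [W] or in its translate by [b]. For these the range is
    one larger than for [W] alone, since [b] is a cone point for the lists in
    [W]. *)
Definition affine_pair W b v := W v \/ W (v - b).

Variable l : nat.
Hypothesis l_gt0 : (0 < l)%N.
Hypothesis sr_l : sr_condition S l.

Definition linear_claim n (C : RR) := forall W u u', free_rank n W u ->
  uni_contractible W (u ++ u') (n.+1 - (size u' + l)) C.

Definition affine_claim n (C : RR) := forall W b bs u u', free_rank n W u ->
  functional bs -> bs b = 1 -> (forall v, W v \/ v \in u -> bs v = 0) ->
  uni_contractible (affine_pair W b) (u ++ u') (n.+2 - (size u' + l)) C.

(** If [u'] is empty, pass from [W] to the union of the span [W1] of all basis vectors but
    the last with its translate by the last one. Otherwise move the first vector [y] of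
    [u'] to a basis vector and pass to the complement [W'] of that vector; there
    [y] does not matter any more, which makes up for the loss of one rank. *)
Lemma linear_step n (C : RR) : 0 <= C -> linear_claim n C -> affine_claim n C ->
  linear_claim n.+1 (push_bound n.+2 C C).
Proof.
move=> C_ge0 lin aff W u [|y u'] fr.
  have [e [es fr']] := fr; have [fl dual Wv u0] := fr'.
  have fln : functional (es n) by exact: fl.
  pose W1 v := v = \sum_(i < n) es i v *: e i.
  have W1n v : W1 v -> es n v = 0.
    move=> ->; rewrite (functional_sum _ (fun i => es i v *: e i)) //.
    rewrite big1 // => i _; rewrite functionalZ //.
    by rewrite (dual _ _ (ltnSn n) (leqW (ltn_ord i))) gtn_eqF ?mulr0.
  have W1W v : W1 v -> W v.
    move=> v1; apply/Wv; rewrite big_ord_recr /= -v1 W1n //.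
    by rewrite scale0r addr0.
  have fr1 : free_rank n W1 u.
    exists e, es; split=> [i ltin|i j ltin ltjn|//|i ltin].
    - exact/fl/leqW.
    - by rewrite dual // leqW.
    - exact/u0/leqW.
  have en : es n (e n) = 1 by rewrite dual // eqxx.
  have bsP v : W1 v \/ v \in u -> es n v = 0.
    by case=> [|vu]; [exact: W1n | rewrite (u0 _ (ltnSn n))].
  have XB v : affine_pair W1 (e n) v -> W v.
    case=> [|v1]; first exact: W1W.
    rewrite -[v](subrK (e n)); apply: (frame_add fr'); first exact: W1W.
    exact: (frame_e fr').
  rewrite cats0; apply: (@uni_push _ (affine_pair W1 (e n))) => //.
  - by rewrite leq_subr.
  - move=> t x _ _.
    apply: uni_contractibleW (aff W1 (e n) (es n) u (rcons t x) fr1 fln en bsP) => //.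
    by rewrite size_rcons /=; clear; lia.
  have := aff W1 (e n) (es n) u [::] fr1 fln en bsP.
  rewrite cats0; apply: contractibleW => //.
  by move=> w [Xw uw]; split=> // x /Xw /XB.
case: (pselect (uni (u ++ y :: u'))) => [uu|nu]; last exact: not_uni_contractible.
have [big|small] := ltnP (size u' + l) n.+1; last first.
  have -> : (n.+2 - (size (y :: u') + l) = 0)%N by move: small; rewrite /=; clear; lia.
  exact: contractible0.
have ln : (l <= n)%N by move: big; clear; lia.
have [e [es fr']] := fr.
have uy : uni (y :: u).
  apply: uni_catl (u') _; apply: uni_perm uu.
  by rewrite perm_catC cat_cons /= perm_cons perm_catC.
have [f [ff fy fu]] := uni_head uy.
have [es' [g [fr2 yg]]] := improve_frame sr_l (leqW ln) fr' ff fy fu.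
have [W' [p [e' [frW' W'W _ _ _]]]] := reduce_frame sr_l ln fr2 yg.
have pyu t : perm_eq ((y :: u) ++ t ++ u') ((u ++ y :: u') ++ t).
  by count_perm.
apply: (@uni_push _ W') => //; first by rewrite leq_subr.
- move=> t x _ _.
  apply: uni_contractibleW (lin W' (y :: u) (rcons t x ++ u') frW') => //.
  by rewrite size_cat size_rcons /=; clear; lia.
have := lin W' (y :: u) u' frW'.
have pp : perm_eq ((y :: u) ++ u') (u ++ y :: u').
  by have := pyu [::]; rewrite cats0.
move=> /(uni_contractibleW pp (leqnn _) (lexx _)).
apply: contractibleW => [//|w [W'w uw]||//]; last by rewrite /=; clear; lia.
by split=> // v /W'w /W'W.
Qed.

(** If [u'] is empty, pass to the lists in [W], over which [b] is a cone point. In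
    the links, the last vertex outside [W] has the form w + b, so it can be ignored
    after subtracting a multiple of [bs] from the coordinates. If [u'] is not
    empty, proceed as in [linear_step], with the translate of [W'] by a vector
    [b'] of [W + b] on which the new coordinate vanishes. When the rank is too
    small for this, only the nonemptiness of the complex is claimed. *)
Lemma affine_step n (C C' : RR) : 0 <= C -> 0 <= C' ->
  (forall k, n = k.+1 -> affine_claim k C) -> linear_claim n C' ->
  affine_claim n (Num.max 1 (push_bound n.+2 C C) + push_bound n.+2 C' 1).
Proof.
move=> C_ge0 C'_ge0 aff lin W b bs u u' fr bsl bsb bs0.
have [e [es fr']] := fr; have [fl dual Wv u0] := fr'.
set M := Num.max _ _; set N := push_bound _ C' 1.
have M_ge1 : 1 <= M by rewrite le_max lexx.
have N_ge0 : 0 <= N by exact: push_bound_ge0.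
have M_le : M <= M + N by rewrite lerDl.
have N_le : N <= M + N by rewrite lerDr (le_trans ler01).
case: u' => [|y u'].
  rewrite cats0; apply: uni_contractibleW (perm_refl u) (leqnn _) N_le _.
  apply: (@uni_push _ W) => //; first by rewrite leq_subr.
  - by move=> v; left.
  - move=> t x nWx [//|Wxb].
    have bsx : bs x = 1.
      by rewrite -[x](subrK b) functionalD // bsb bs0 ?add0r //; left.
    have frx : free_rank n W (x :: u).
      exists e, (fun i v => es i v + bs v * (- es i x)).
      apply: (frame_change fr') => // [v Wv'|i ltin z].
        by apply: bs0; left.
      rewrite inE => /orP[/eqP ->|zu]; first by rewrite bsx mul1r subrr.
      by rewrite bs0 ?mul0r ?addr0 ?u0 //; right.
    have p : perm_eq ((x :: u) ++ t) (u ++ rcons t x).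
      by count_perm.
    apply: uni_contractibleW (lin W (x :: u) t frx) => //.
    by clear; lia.
  apply: (@cone_contractible _ _ _ _ _ b) => w [Ww uw]; split.
    move=> x; rewrite inE => /orP[/eqP ->|/Ww]; last by left.
    by right; rewrite subrr; exact: (frame_zero fr').
  apply: (uni_cons bsl bsb _ uw) => z; rewrite mem_cat => /orP[/Ww Wz|zu].
    by apply: bs0; left.
  by apply: bs0; right.
apply: uni_contractibleW (perm_refl _) (leqnn _) M_le _.
case: (pselect (uni (u ++ y :: u'))) => [uu|nu]; last exact: not_uni_contractible.
have [big|small] := leqP (size u' + l) n; last first.
  have -> : (n.+2 - (size (y :: u') + l) = 0)%N by move: small; rewrite /=; clear; lia.
  exact: contractible0.
have ln : (l <= n)%N by move: big; clear; lia.
have uy : uni (y :: u).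
  apply: uni_catl (u') _; apply: uni_perm uu.
  by rewrite perm_catC cat_cons /= perm_cons perm_catC.
have [f [ff fy fu]] := uni_head uy.
have [es' [g [fr2 yg]]] := improve_frame sr_l ln fr' ff fy fu.
have [l_max|] := leqP n l.
  have nl : n = l by apply/eqP; rewrite eqn_leq l_max.
  have u'0 : u' = [::] by apply: size0nil; move: big; rewrite nl; clear; lia.
  rewrite u'0 nl (_ : l.+2 - (size [:: y] + l) = 1)%N; last by rewrite /=; clear; lia.
  have [fl2 dual2 _ u02] := fr2.
  pose b0 := b - \sum_(i < n) es' i b *: e i.
  have Wb0 : W (\sum_(i < n) es' i b *: e i).
    exact: (frame_span (fun i => es' i b) fr').
  have bsb0 : bs b0 = 1.
    by rewrite /b0 functionalB // bsb bs0 ?subr0 //; left.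
  pose h v := \sum_(i < n) es' i v * g i.
  have hl : functional h by exact: (functional_sumM g fl2).
  have es'b0 i : (i < n)%N -> es' i b0 = 0.
    move=> ltin; have fli := fl2 _ ltin.
    rewrite /b0 functionalB // (functional_sum _ (fun j => es' j b *: e j)) //.
    under eq_bigr => j _ do rewrite functionalZ // dual2 // eq_sym.
    by rewrite (sum_delta (fun j => es' j b)) // subrr.
  have hb0 : h b0 = 0 by rewrite /h big1 // => i _; rewrite es'b0 ?mul0r.
  have ub0 : uni_lists (affine_pair W b) (u ++ [:: y]) [:: b0].
    split.
      move=> x; rewrite inE => /eqP ->; right.
      rewrite /b0 addrAC subrr; apply: (frame_sub fr') => //.
      exact: (frame_zero fr').
    apply: (@uni_cons _ _ _ _ (fun v => bs v - h v * bs y)); rewrite /=.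
    - exact: functional_subM.
    - by rewrite bsb0 hb0 mul0r subr0.
    - move=> z; rewrite mem_cat inE => /orP[zu|/eqP ->].
        rewrite bs0; last by right.
        by rewrite /h big1 ?mul0r ?subr0 // => i _; rewrite u02 ?mul0r.
      by rewrite /h yg mul1r subrr.
    by rewrite u'0 in uu.
  exact: contractible1 M_ge1 ub0.
have pushM : push_bound n.+2 C C <= M by rewrite le_max lexx orbT.
clearbody M N.
case: n fr fr' fl dual Wv u0 aff lin pushM big ln fr2 yg
  => [|n] fr fr' fl dual Wv u0 aff lin pushM big ln fr2 yg ln'.
  by have := leq_trans l_gt0 ln.
have [W' [p [e' [frW' W'W [pl py] p0 [We' pe']]]]] := reduce_frame sr_l ln' fr2 yg.
pose b' := b - p b *: e'.
pose bs' v := bs v - p v * bs y.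
have bs'l : functional bs' by exact: functional_subM.
have pb' : p b' = 0 by rewrite /b' functionalB // functionalZ // pe' mulr1 subrr.
have bs'b' : bs' b' = 1.
  rewrite /bs' pb' mul0r subr0 /b' functionalB // functionalZ // bsb.
  by rewrite bs0 ?mulr0 ?subr0 //; left.
have bs'0 v : W' v \/ v \in y :: u -> bs' v = 0.
  rewrite inE => -[W'v|/orP[/eqP ->|vu]].
  - by rewrite /bs' p0 ?mul0r ?subr0; [apply: bs0; left; exact: W'W | left].
  - by rewrite /bs' py mul1r subrr.
  - by rewrite /bs' p0 ?mul0r ?subr0; [apply: bs0; right | right].
have XB v : affine_pair W' b' v -> affine_pair W b v.
  case=> [W'v|W'vb]; [by left; exact: W'W | right].
  have -> : v - b = (v - b') - p b *: e'.
    by rewrite /b' opprB [_ *: _ - b]addrC addrA addrK.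
  by apply: (frame_sub fr'); [exact: W'W | exact: (frame_scale fr')].
have claim := aff n erefl W' b' bs' (y :: u) _ frW' bs'l bs'b' bs'0.
apply: uni_contractibleW (perm_refl _) (leqnn _) pushM _.
apply: (@uni_push _ (affine_pair W' b')) => //; first by rewrite leq_subr.
- move=> t x _ _; apply: uni_contractibleW (claim (rcons t x ++ u')) => //.
    count_perm.
  by rewrite size_cat size_rcons /=; clear; lia.
have pp : perm_eq ((y :: u) ++ u') (u ++ y :: u').
  by count_perm.
move: (claim u') => /(uni_contractibleW pp (leqnn _) (lexx _)).
apply: contractibleW => [//|w [Xw uw]||//]; last by rewrite /=; clear; lia.
by split=> // v /Xw /XB.
Qed.

Theorem linear_claim_holds n : exists2 C : RR, 0 <= C & linear_claim n C.
Proof.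
suff [C [C_ge0 lin _]] : exists C : RR, [/\ 0 <= C, linear_claim n C & affine_claim n C].
  by exists C.
elim: n => [|n [C [C_ge0 lin aff]]].
  have lin0 : linear_claim 0 0.
    move=> W u u' _; rewrite (_ : 1 - _ = 0)%N; first exact: contractible0.
    by move: l_gt0; clear; lia.
  have none k : 0%N = k.+1 -> affine_claim k 0 by [].
  have aff0 := affine_step (lexx 0) (lexx 0) none lin0.
  set C := _ + _ in aff0; exists C.
  have C_ge0 : 0 <= C.
    by rewrite addr_ge0 ?push_bound_ge0 // le_max ler01.
  split=> // W u u' fr.
  exact: uni_contractibleW (perm_refl _) (leqnn _) C_ge0 (lin0 W u u' fr).
have lin1 := linear_step C_ge0 lin aff.
set C' := push_bound _ _ _ in lin1.
have C'_ge0 : 0 <= C' by exact: push_bound_ge0.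
have aff' k : n.+1 = k.+1 -> affine_claim k C by case=> <-.
have aff1 := affine_step C_ge0 C'_ge0 aff' lin1.
set C2 := _ + push_bound _ _ _ in aff1.
have C2_ge0 : 0 <= C2 by rewrite addr_ge0 ?push_bound_ge0 // le_max ler01.
exists (C' + C2); split; first exact: addr_ge0.
  move=> W u u' fr; apply: uni_contractibleW (perm_refl _) (leqnn _) _ (lin1 W u u' fr).
  by rewrite lerDl.
move=> W b bs u u' fr h1 h2 h3.
apply: uni_contractibleW (perm_refl _) (leqnn _) _ (aff1 W b bs u u' fr h1 h2 h3).
by rewrite lerDr.
Qed.

End UnimodularLists.

(** * Split injections *)

Section Columns.
Variables (S : pzRingType).

(** The coefficient of the projection onto the span of [r] along a complement; it
    is well defined because [r] is linearly independent. *)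
Lemma unimodular_functional (M : lmodType S) (r : M) :
  unimodular (fun _ : 'I_1 => r) -> exists2 f : M -> S, functional f & f r = 1.
Proof.
move=> [N [[[N0 ND NZ] [N' [[N'0 N'D N'Z] NN' dec]]] [indep span]]].
have span1 x : N x <-> exists a, x = a *: r.
  rewrite span; split=> [[a ->]|[a ->]]; first by exists (a ord0); rewrite big_ord1.
  by exists (fun=> a); rewrite big_ord1.
have indep1 a : a *: r = 0 -> a = 0.
  by move=> ar; apply: (indep (fun=> a) _ ord0); rewrite big_ord1.
have /choice[f fP] : forall x, exists a, N' (x - a *: r).
  move=> x; have [y [z [/span1[a ->] N'z ->]]] := dec x; exists a.
  by rewrite addrC addKr.
have uniq x a : N' (x - a *: r) -> a = f x.
  move=> xa; apply/eqP; rewrite -subr_eq0; apply/eqP/indep1.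
  apply: NN'; first by apply/span1; exists (a - f x).
  have -> : (a - f x) *: r = (x - f x *: r) + -1 *: (x - a *: r).
    by rewrite scaleN1r opprB [RHS]addrC addrA subrK scalerBl.
  by apply: N'D; [exact: fP | exact/N'Z/xa].
exists f.
  move=> a x y; apply/esym/uniq.
  have -> : a *: x + y - (a * f x + f y) *: r =
      a *: (x - f x *: r) + (y - f y *: r).
    by rewrite scalerDl opprD addrACA scalerBr scalerA.
  by apply: N'D; [exact/N'Z/fP | exact: fP].
by apply/esym/uniq; rewrite scale1r subrr.
Qed.

Lemma functional_unimodular (M : lmodType S) (r : M) (f : M -> S) :
  functional f -> f r = 1 -> unimodular (fun _ : 'I_1 => r).
Proof.
move=> fl fr.
exists (fun x => exists a, x = a *: r); split; last first.
  split=> [a|x].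
    rewrite big_ord1 => ar i; rewrite (ord1 i).
    have := congr1 f ar; rewrite functionalZ // fr mulr1 => ->.
    by rewrite functional0.
  split=> [[a ->]|[a ->]]; last by exists (a ord0); rewrite big_ord1.
  by exists (fun=> a); rewrite big_ord1.
split.
  split; first by exists 0; rewrite scale0r.
    by move=> x y [a ->] [b ->]; exists (a + b); rewrite scalerDl.
  by move=> b x [a ->]; exists (b * a); rewrite scalerA.
exists (fun x => f x = 0); split.
- split=> [|x y fx fy|a x fx]; first by rewrite functional0.
    by rewrite functionalD // fx fy addr0.
  by rewrite functionalZ // fx mulr0.
- by move=> x [a ->]; rewrite functionalZ // fr mulr1 => ->; rewrite scale0r.
move=> x; exists (f x *: r), (x - f x *: r); split.
- by exists (f x).
- by rewrite functionalB // functionalZ // fr mulr1 subrr.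
by rewrite addrC subrK.
Qed.

Lemma col_sum n (v : 'cV[S]_n) : v = \sum_(i < n) v i 0 *: delta_mx i 0.
Proof.
rewrite {1}(matrix_sum_delta v); apply: eq_bigr => i _.
by rewrite big_ord1.
Qed.

Lemma col_functionalE n (f : 'cV[S]_n -> S) v : functional f ->
  f v = \sum_(i < n) v i 0 * f (delta_mx i 0).
Proof.
move=> fl; rewrite {1}(col_sum v).
elim/big_rec2: _ => [|i a w _ IH]; first by rewrite functional0.
by rewrite functionalD // functionalZ // IH.
Qed.

Lemma sum_functional n (g : 'I_n -> S) :
  functional (fun v : 'cV[S]_n => \sum_(i < n) v i 0 * g i).
Proof.
move=> a x y; rewrite mulr_sumr -big_split; apply: eq_bigr => i _.
by rewrite !mxE mulrDl mulrA.
Qed.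

Definition coord n (i : nat) (v : 'cV[S]_n) : S := oapp (fun k => v k 0) 0 (insub i).
Definition base_col n (i : nat) : 'cV[S]_n := \col_k (k == i :> nat)%:R.

Lemma coordE n (i : 'I_n) v : coord i v = v i 0.
Proof. by rewrite /coord valK. Qed.

Lemma free_rank_col n : free_rank n (fun _ : 'cV[S]_n => True) [::].
Proof.
exists (@base_col n), (@coord n); split=> //.
- move=> i ltin; have -> : i = Ordinal ltin by [].
  by move=> a x y; rewrite !coordE !mxE.
- move=> i j ltin _; have -> : i = Ordinal ltin by [].
  by rewrite coordE mxE.
move=> v; split=> // _; apply/colP => k.
rewrite summxE (bigD1 k) //= big1 ?addr0 => [|i ik].
  by rewrite !mxE coordE eqxx mulr1.
by rewrite !mxE eq_sym (negbTE (ik : val i != k)) mulr0.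
Qed.

End Columns.

Section StableRange.
Variable R : pzRingType.

(** Functionals on columns are given by rows, so a column is unimodular in the sense
    of direct summands exactly when some row multiplies it to 1. *)
Lemma SR_sr_condition l : SR R l.+1 -> sr_condition R^c l.
Proof.
move=> sr n ln x g xg.
pose r : 'cV[R^c]_n.+1 := \col_i x i.
have r_uni : unimodular_col r.
  apply: (functional_unimodular (sum_functional (fun i : 'I_n.+1 => g i))).
  by rewrite -[RHS]xg; apply: eq_bigr => i _; rewrite mxE.
have [t /unimodular_functional[f fl]] := sr n ln r r_uni.
rewrite (col_functionalE _ fl) => fr.
pose t' (i : nat) : R^c := oapp t 0 (insub i).
pose g' (i : nat) : R^c := oapp (fun k : 'I_n => f (delta_mx k 0)) 0 (insub i).
exists t', g'; rewrite -[RHS]fr; apply: eq_bigr => i _.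
rewrite /t' /g' !valK /= [X in _ = X * _]mxE !mxE; reflexivity.
Qed.

End StableRange.

Section SplitInjectionLists.
Variables (RR : realType) (R : pzRingType) (n : nat).
Local Notation S := (R^c).
Local Notation V := ('cV[S]_n).

Definition sinj_list p (f : split_injection R n p) : seq V :=
  codom (fun i : 'I_p => f (delta_mx i 0)).

Lemma sinj_sum p (f : split_injection R n p) x :
  f x = \sum_(i < p) x i 0 *: f (delta_mx i 0).
Proof.
have lf := sinj_linear f.
have f0 : f 0 = 0.
  by have := lf (-1) 0 0; rewrite scaler0 addr0 scaleN1r addNr.
rewrite {1}(col_sum x); elim/big_rec2: _ => [|i a w _ IH]; first by rewrite f0.
by rewrite lf IH.
Qed.

Lemma size_sinj_list p (f : split_injection R n p) : size (sinj_list f) = p.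
Proof. by rewrite size_codom card_ord. Qed.

Lemma sinj_list_uni p (f : split_injection R n p) : uni (sinj_list f).
Proof.
have [g [gl gK]] := sinj_split f.
move=> x s'; rewrite perm_sym => /(perm_iotaP 0) [[|i Is] // pI [-> ->]].
rewrite size_sinj_list in pI.
have lti : (i < p)%N.
  by have := perm_mem pI i; rewrite mem_iota inE eqxx.
have /andP[iIs _] : uniq (i :: Is) by rewrite (perm_uniq pI) iota_uniq.
exists (fun v => g v (Ordinal lti) 0); split.
- by move=> a y z; rewrite gl !mxE.
- by rewrite (nth_codom_ord _ _ (Ordinal lti)) gK mxE !eqxx.
move=> y /mapP[j jIs ->].
have ltj : (j < p)%N.
  by have := perm_mem pI j; rewrite mem_iota inE jIs orbT.
rewrite (nth_codom_ord _ _ (Ordinal ltj)) gK mxE eqxx andbT.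
case: eqP => // ij; move: iIs; rewrite (_ : i = j) ?jIs //.
by have := congr1 val ij.
Qed.

(** The dual functionals of the list are the coordinates of a left inverse. *)
Lemma uni_sinj_list p (s : seq V) : uni s -> size s = p ->
  exists f : split_injection R n p, sinj_list f = s.
Proof.
move=> us ss.
have /choice[phi phiP] : forall i : 'I_p, exists f : V -> S, functional f /\
    forall j : 'I_p, f (nth 0 s j) = (j == i)%:R.
  move=> i; have si : (i < size s)%N by rewrite ss.
  have p1 : perm_eq s (nth 0 s i :: (take i s ++ drop i.+1 s)).
    have e : s = take i s ++ nth 0 s i :: drop i.+1 s.
      by rewrite -drop_nth // cat_take_drop.
    by rewrite {1}e; apply/permP => P; rewrite /= !count_cat /= addnCA.
  have [f [fl f1 f0]] := us _ _ p1; exists f; split=> // j.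
  have [->|ji] := eqVneq j i; first exact: f1.
  have sj : (j < size s)%N by rewrite ss.
  apply: f0; rewrite mem_cat.
  case: (ltngtP j i) => [lt_ji|lt_ij|/val_inj e]; last by rewrite e eqxx in ji.
    by apply/orP; left; rewrite -(nth_take 0 lt_ji) mem_nth // size_take si.
  apply/orP; right; rewrite -(subnKC lt_ij) -nth_drop mem_nth // size_drop.
  by apply: ltn_sub2r => //; exact: leq_ltn_trans lt_ij sj.
pose F (x : 'cV[S]_p) : V := \sum_(i < p) x i 0 *: nth 0 s i.
have F_lin : linear F.
  move=> a x y; rewrite /F scaler_sumr -big_split; apply: eq_bigr => i _ /=.
  by rewrite !mxE scalerDl scalerA.
pose G (v : V) : 'cV[S]_p := \col_i phi i v.
have F_split : exists G, linear G /\ cancel F G.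
  exists G; split=> [a x y|x].
    by apply/colP => i; rewrite !mxE (phiP i).1.
  apply/colP => i; rewrite mxE /F; have [fl f1] := phiP i.
  have -> : phi i (\sum_(j < p) x j 0 *: nth 0 s j) = \sum_(j < p) x j 0 * (j == i)%:R.
    elim/big_rec2: _ => [|j a w _ IH]; first by rewrite functional0.
    by rewrite functionalD // functionalZ // f1 IH.
  by rewrite (bigD1 i) //= eqxx mulr1 big1 ?addr0 // => j /negbTE ->; rewrite mulr0.
exists (SplitInjection F_lin F_split); apply: (@eq_from_nth _ 0).
  by rewrite size_sinj_list ss.
move=> i; rewrite size_sinj_list => lti.
rewrite (nth_codom_ord _ _ (Ordinal lti)) /= /F (bigD1 (Ordinal lti)) //=.
rewrite mxE !eqxx scale1r big1 ?addr0 // => j ij.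
by rewrite mxE (negbTE ij) scale0r.
Qed.

Lemma insert_delta p (i : 'I_p.+1) (j : 'I_p) :
  insert_zero i (delta_mx j 0) = delta_mx (lift i j) 0 :> 'cV[S]_p.+1.
Proof.
apply/colP => k; rewrite !mxE; case: unliftP => [m ->|->] /=.
  by rewrite mxE (inj_eq lift_inj).
by rewrite (negbTE (neq_lift i j)).
Qed.

Theorem split_injections_vanishing_of_SR l : (0 < l)%N -> SR R l.+1 ->
  reduced_bH_vanishes_up_to RR (split_injections R n) (n%:Z - l%:Z - 1)%:E.
Proof.
move=> l_gt0 /SR_sr_condition sr.
have [C _ lin] := @linear_claim_holds RR S V l l_gt0 sr n.
have := lin _ [::] [::] (@free_rank_col S n); rewrite /= add0n => contr.
apply: (@vanishing_of_contractible _ _ _ (uni_lists (fun=> True) [::])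
  (fun p (f : split_injections R n p) => sinj_list (p := p.+1) f)
  (@uni_lists_closed _ _ _ _) _ _ _ _ _ _ _ _ _ contr).
- by move=> p f; exact: size_sinj_list.
- by move=> p f; split=> //; rewrite cats0; exact: sinj_list_uni.
- move=> p f g fg; apply: split_injection_inj; apply/funext => x.
  rewrite !sinj_sum; apply: eq_bigr => i _; congr (_ *: _).
  have := congr1 (fun s => nth 0 s i) fg.
  by rewrite /sinj_list !nth_codom_ord.
- move=> p s [_]; rewrite cats0 => us ss; exact: uni_sinj_list.
- move=> p f i; rewrite -codom_lift; apply: eq_codom => j /=.
  by rewrite insert_delta.
- by split=> // x s'; case: s' => [|? ?] /perm_size.
by move=> k; rewrite lee_fin; lia.
Qed.

Theorem split_injections_vanishing :
  reduced_bH_vanishes_up_to RR (split_injections R n)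
    (n%:Z%:E - stable_rank R - 1%:E)%E.
Proof.
rewrite /stable_rank; case: pselect => [ex|_]; last by move=> k.
case: ex_minnP => l /andP[l_gt0 /asboolP sr] _.
exact: split_injections_vanishing_of_SR.
Qed.

End SplitInjectionLists.

(** * Orthogonal hyperbolic pairs *)

Section HyperbolicPairs.
Variables (R : comPzRingType) (P : form_parameter R) (M : quadratic_module P).
Local Notation eps := (fp_eps P).
Local Notation lam := (@qm_lambda R P M).
Local Notation mu := (@qm_mu R P M).
Hypothesis Lambda_sqr : forall a b : R, b \in fp_Lambda P -> a ^+ 2 * b \in fp_Lambda P.
Implicit Types (x y z : M) (h k : (M * M)%type) (s t u w : seq (M * M)).
Implicit Types (T : M -> Prop).

Lemma lamDl x x' y : lam (x + x') y = lam x y + lam x' y.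
Proof. by rewrite -{1}[x]scale1r qm_lambda_linearl mul1r. Qed.
Lemma lamDr x y y' : lam x (y + y') = lam x y + lam x y'.
Proof. by rewrite -{1}[y]scale1r qm_lambda_linearr mul1r. Qed.
Lemma lam0l y : lam 0 y = 0. Proof. exact: qm_lambda0l. Qed.
Lemma lam_sym x y : lam x y = 0 -> lam y x = 0.
Proof. by rewrite [lam y x]qm_lambdaC => ->; rewrite mulr0. Qed.
Lemma lam0r x : lam x 0 = 0. Proof. exact/lam_sym/lam0l. Qed.
Lemma lamZl a x y : lam (a *: x) y = a * lam x y.
Proof. by rewrite -[a *: x]addr0 qm_lambda_linearl lam0l addr0. Qed.
Lemma lamZr a x y : lam x (a *: y) = a * lam x y.
Proof. by rewrite -[a *: y]addr0 qm_lambda_linearr lam0r addr0. Qed.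
Lemma lamNl x y : lam (- x) y = - lam x y.
Proof. by rewrite -scaleN1r lamZl mulN1r. Qed.
Lemma lamNr x y : lam x (- y) = - lam x y.
Proof. by rewrite -scaleN1r lamZr mulN1r. Qed.
Definition lamE := (lamDl, lamDr, lamZl, lamZr, lamNl, lamNr).

Lemma lam_functional x : functional (lam x).
Proof. by move=> a y z; rewrite qm_lambda_linearr. Qed.

Lemma to_mod_Lambda0 : to_mod_Lambda P 0 = 0.
Proof. exact: raddf0. Qed.

Lemma muD x y : mu (x + y) = mu x + mu y + to_mod_Lambda P (lam x y).
Proof. by rewrite -qm_muD -[_ - _ - _]addrA -opprD [RHS]addrC subrK. Qed.

Lemma mu_orthD x y : lam x y = 0 -> mu (x + y) = mu x + mu y.
Proof. by move=> xy; rewrite muD xy to_mod_Lambda0 addr0. Qed.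

(** A representative of mu(x) = 0 lies in Lambda, and so does its product by a
    square. *)
Lemma muZ0 a x : mu x = 0 -> mu (a *: x) = 0.
Proof.
move=> x0; have [b bx ->] := qm_muZ a x.
have bL : b \in fp_Lambda P.
  rewrite -[b]subr0 Quotient.idealrBE.
  by apply/eqP; move: bx; rewrite x0 /to_mod_Lambda raddf0.
apply/eqP; rewrite /to_mod_Lambda -[0](raddf0 (\pi_(Quotient.quot (fp_Lambda P))%qT)).
by rewrite -Quotient.idealrBE subr0 Lambda_sqr.
Qed.

Definition hyp h := [/\ lam h.1 h.2 = 1, lam h.1 h.1 = 0, lam h.2 h.2 = 0,
  mu h.1 = 0 & mu h.2 = 0].

Definition orth h k := [&& lam h.1 k.1 == 0, lam h.1 k.2 == 0,
  lam h.2 k.1 == 0 & lam h.2 k.2 == 0].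

Lemma orthP h k : reflect [/\ lam h.1 k.1 = 0, lam h.1 k.2 = 0,
  lam h.2 k.1 = 0 & lam h.2 k.2 = 0] (orth h k).
Proof. by apply: (iffP and4P) => -[/eqP ? /eqP ? /eqP ? /eqP ?]. Qed.

Lemma orth_sym h k : orth h k -> orth k h.
Proof. by case/orthP=> *; apply/orthP; split; exact: lam_sym. Qed.

Definition hyp_list T s :=
  (forall h, h \in s -> [/\ hyp h, T h.1 & T h.2]) /\ pairwise orth s.

(** [T] contains the image of an orthogonal sum of [g] hyperbolic modules. *)
Definition genus T g := exists2 s, hyp_list T s & size s = g.

Lemma hyp_list_closed T : closed (hyp_list T).
Proof.
move=> s t st [Tt ot]; split; last exact: subseq_pairwise st ot.
by move=> h /(mem_subseq st); exact: Tt.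
Qed.

Lemma genus_sub T T' g : (forall x, T x -> T' x) -> genus T g -> genus T' g.
Proof.
move=> TT [s [Ts os] ss]; exists s => //; split=> // h /Ts[hh h1 h2].
by split=> //; exact: TT.
Qed.

Lemma hyp_list_cons T h s : hyp_list T (h :: s) <->
  [/\ hyp h, T h.1 & T h.2] /\ hyp_list T s /\ all (orth h) s.
Proof.
split=> [[Ts /= /andP[hs os]]|[hT [[Ts os] hs]]].
  split; first by apply: Ts; rewrite mem_head.
  by split=> //; split=> // k ks; apply: Ts; rewrite inE ks orbT.
split=> /=; last by rewrite hs.
by move=> k; rewrite inE => /orP[/eqP ->|]; [|exact: Ts].
Qed.

Section Euclid.
Variable size_of : R -> nat.
Hypothesis euclid : forall a b : R, a != 0 ->
  exists q, b - q * a = 0 \/ (size_of (b - q * a) < size_of a)%N.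
Variables (T : M -> Prop) (l : M -> R).
Hypothesis T_sub : is_submodule T.
Hypothesis l_lin : functional l.

(** The second condition holds when the new pairs lie in the span of the old
    ones, and it is how that span enters the argument. *)
Definition replaces h0 h1 h0' h1' := hyp_list T [:: h0'; h1'] /\
  forall k, orth k h0 -> orth k h1 -> orth k h0' /\ orth k h1'.

Lemma replaces_trans h0 h1 h0' h1' h0'' h1'' :
  replaces h0 h1 h0' h1' -> replaces h0' h1' h0'' h1'' -> replaces h0 h1 h0'' h1''.
Proof.
move=> [_ r1] [T2 r2]; split=> // k k0 k1.
by have [k0' k1'] := r1 _ k0 k1; exact: r2.
Qed.

Lemma hyp_list2 h0 h1 : hyp_list T [:: h0; h1] <->
  [/\ [/\ hyp h0, T h0.1 & T h0.2], [/\ hyp h1, T h1.1 & T h1.2] & orth h0 h1].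
Proof.
rewrite !hyp_list_cons /= andbT; split=> [[A [[B _] C]]|[A B C]] //.
Qed.

Lemma replaces_swap h0 h1 : hyp_list T [:: h0; h1] -> replaces h0 h1 h1 h0.
Proof.
move=> /hyp_list2[A B C]; split; last by [].
by apply/hyp_list2; split=> //; exact: orth_sym.
Qed.

Lemma replaces_turn h0 h1 : hyp_list T [:: h0; h1] ->
  replaces h0 h1 h0 (h1.2, eps *: h1.1).
Proof.
have [_ _ TZ] := T_sub.
move=> /hyp_list2[A [[e1 e2 e3 e4 e5] B1 B2] /orthP[C1 C2 C3 C4]]; split.
  apply/hyp_list2; split=> //; last first.
    by apply/orthP; split; rewrite /= ?lamE ?C1 ?C2 ?C3 ?C4 ?mulr0.
  split=> /=; [split=> /= | exact: B2 | exact: TZ].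
  - by rewrite lamE qm_lambdaC e1 mulr1 eps_sqr.
  - exact: e3.
  - by rewrite !lamE e2 !mulr0.
  - exact: e5.
  - exact: muZ0.
move=> k k0 /orthP[k1 k2 k3 k4]; split=> //.
by apply/orthP; split; rewrite /= ?lamE ?k1 ?k2 ?k3 ?k4 ?mulr0.
Qed.

Lemma replaces_transvection q h0 h1 : hyp_list T [:: h0; h1] ->
  replaces h0 h1 (h0.1, h0.2 + q *: h1.2) (h1.1 - q *: h0.1, h1.2).
Proof.
have [_ TD TZ] := T_sub.
have TB x y : T x -> T y -> T (x - q *: y).
  by move=> Tx Ty; apply: TD => //; rewrite -scaleN1r; apply/TZ/TZ.
move=> /hyp_list2[[[a1 a2 a3 a4 a5] A1 A2] [[e1 e2 e3 e4 e5] B1 B2] o].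
have /orthP[c1 c2 c3 c4] := o; have /orthP[d1 d2 d3 d4] := orth_sym o.
split.
  apply/hyp_list2; split.
  - split=> /=; [split=> /= | exact: A1 | by apply/TD/TZ].
    + by rewrite !lamE a1 c2 mulr0 addr0.
    + exact: a2.
    + by rewrite !lamE a3 c4 d4 e3 !mulr0 !addr0.
    + exact: a4.
    + by rewrite mu_orthD ?lamE ?c4 ?mulr0 // a5 muZ0 // addr0.
  - split=> /=; [split=> /= | exact: TB | exact: B2].
    + by rewrite !lamE e1 c2 mulr0 oppr0 addr0.
    + by rewrite !lamE e2 d1 c1 a2 !(mulr0, oppr0, addr0).
    + exact: e3.
    + rewrite mu_orthD ?lamE ?d1 ?mulr0 ?oppr0 // e4 add0r -scaleNr.
      exact: muZ0.
    + exact: e5.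
  apply/orthP; split=> /=.
  - by rewrite !lamE c1 a2 mulr0 oppr0 addr0.
  - exact: c2.
  - rewrite !lamE c3 d3 [lam h0.2 h0.1]qm_lambdaC a1 [lam h1.2 h1.1]qm_lambdaC e1.
    ring.
  - by rewrite !lamE c4 e3 mulr0 addr0.
move=> k /orthP[f1 f2 f3 f4] /orthP[g1 g2 g3 g4]; split; apply/orthP; split=> /=;
  by rewrite ?lamE ?f1 ?f2 ?f3 ?f4 ?g1 ?g2 ?g3 ?g4 ?(mulr0, oppr0, addr0).
Qed.

Lemma euclid_step h0 h1 : hyp_list T [:: h0; h1] -> l h0.1 != 0 ->
  exists h0' h1', [/\ replaces h0 h1 h0' h1', l h0'.1 = l h0.1, l h1'.2 = l h1.2 &
    l h1'.1 = 0 \/ (size_of (l h1'.1) < size_of (l h0.1))%N].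
Proof.
move=> hT l0; have [q qP] := euclid (l h1.1) l0.
exists (h0.1, h0.2 + q *: h1.2), (h1.1 - q *: h0.1, h1.2); split=> //=.
  exact: replaces_transvection.
by rewrite functionalB // functionalZ.
Qed.

(** The Euclidean algorithm on the values of [l]. A transvection reduces
    [l h1.1] modulo [l h0.1]; if the remainder is not zero it becomes the new
    [l h0.1], otherwise the same is done with [h1.2], brought in first place by
    turning [h1]. The value [l h0.1] decreases until both values on [h1] are
    zero. *)
Lemma euclid_pair h0 h1 : hyp_list T [:: h0; h1] ->
  exists h0' h1', [/\ replaces h0 h1 h0' h1', l h1'.1 = 0 & l h1'.2 = 0].
Proof.
have rec n : forall h0 h1, hyp_list T [:: h0; h1] -> l h0.1 != 0 ->
    (size_of (l h0.1) < n)%N ->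
    exists h0' h1', [/\ replaces h0 h1 h0' h1', l h1'.1 = 0 & l h1'.2 = 0].
  elim: n => // n IH {}h0 {}h1 hT l0 ln.
  (* continue from a smaller nonzero value, moved to the first pair *)
  have again k0 k1 : replaces h0 h1 k0 k1 -> l k1.1 != 0 ->
      (size_of (l k1.1) < size_of (l h0.1))%N ->
      exists h0' h1', [/\ replaces h0 h1 h0' h1', l h1'.1 = 0 & l h1'.2 = 0].
    move=> rk k_neq0 lk.
    have [|j0 [j1 [rj j1E j2E]]] := IH k1 k0 (replaces_swap rk.1).1 k_neq0.
      by apply: leq_trans lk _.
    exists j0, j1; split=> //; apply: (replaces_trans rk).
    exact: (replaces_trans (replaces_swap rk.1) rj).
  have [k0 [k1 [rk k0l k1l small]]] := euclid_step hT l0.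
  have [k11|k11] := eqVneq (l k1.1) 0; last first.
    by case: small => [e|]; [rewrite e eqxx in k11 | exact: (again _ _ rk k11)].
  have rt := replaces_turn rk.1.
  have k0' : l k0.1 != 0 by rewrite k0l.
  have [j0 [j1 [rj j0l j1l small']]] := euclid_step rt.1 k0'.
  have rhj : replaces h0 h1 j0 j1.
    exact: (replaces_trans rk (replaces_trans rt rj)).
  have j12 : l j1.2 = 0 by rewrite j1l /= functionalZ // k11 mulr0.
  have [j11|j11] := eqVneq (l j1.1) 0; first by exists j0, j1.
  case: small' => [e|]; first by rewrite e eqxx in j11.
  by rewrite /= k0l; exact: (again _ _ rhj j11).
move=> hT.
have [z0|n0] := eqVneq (l h0.1) 0; last exact: rec hT n0 (ltnSn _).
have via k0 k1 : replaces h0 h1 k0 k1 -> l k0.1 != 0 ->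
    exists h0' h1', [/\ replaces h0 h1 h0' h1', l h1'.1 = 0 & l h1'.2 = 0].
  move=> rk k_neq0; have [j0 [j1 [rj ? ?]]] := rec _ _ _ rk.1 k_neq0 (ltnSn _).
  by exists j0, j1; split=> //; exact: (replaces_trans rk rj).
have [z1|n1] := eqVneq (l h1.1) 0; last exact: via (replaces_swap hT) n1.
have [z2|n2] := eqVneq (l h1.2) 0; first by exists h0, h1.
have rt := replaces_turn hT.
exact: (via _ _ (replaces_trans rt (replaces_swap rt.1))).
Qed.

(** The first pair absorbs the values of [l] on the other pairs one after the
    other. *)
Lemma euclid_list s h0 : hyp_list T (h0 :: s) -> exists h0' s',
  [/\ hyp_list T (h0' :: s'), size s' = size s,
      forall h, h \in s' -> l h.1 = 0 /\ l h.2 = 0 &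
      forall k, all (orth k) (h0 :: s) -> all (orth k) (h0' :: s')].
Proof.
elim: s h0 => [|h1 s IH] h0 hT; first by exists h0, [::].
have hT2 : hyp_list T [:: h0; h1].
  by apply: hyp_list_closed hT; rewrite -[h0 :: h1 :: s]/([:: h0; h1] ++ s) prefix_subseq.
have [h0' [h1' [[r1 r2] l1 l2]]] := euclid_pair hT2.
have [A [/hyp_list_cons[B [sT o1s]] /= /andP[o01 o0s]]] := (hyp_list_cons _ _ _).1 hT.
have [A' B' o'] := (hyp_list2 _ _).1 r1.
have o's k : k \in s -> orth h0' k /\ orth h1' k.
  move=> ks; have [] := r2 k (orth_sym (allP o0s _ ks)) (orth_sym (allP o1s _ ks)).
  by split; exact: orth_sym.
have [|h0'' [s' [T'' ss' ls' os']]] := IH h0'.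
  by apply/hyp_list_cons; do 2!split=> //; apply/allP => k /o's[].
have : all (orth h1') (h0'' :: s').
  apply: os' => /=; rewrite orth_sym //=; apply/allP => k /o's[] //.
move=> /= /andP[o1'' o1s'].
have [A'' [sT'' o0s']] := (hyp_list_cons _ _ _).1 T''.
exists h0'', (h1' :: s'); split=> /=.
- apply/hyp_list_cons; split=> //; split; last by rewrite /= orth_sym.
  by apply/hyp_list_cons.
- by rewrite ss'.
- by move=> h; rewrite inE => /orP[/eqP -> //|/ls'].
move=> k /and3P[k0 k1 ks]; have [k0' k1'] := r2 _ k0 k1.
by have /= := os' k; rewrite k0' ks => /(_ isT) /andP[-> ->]; rewrite k1'.
Qed.

Lemma genus_ker g : genus T g -> genus (fun x => T x /\ l x = 0) g.-1.
Proof.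
move=> [[|h0 s] hT <-]; first by exists [::].
have [h0' [s' [/hyp_list_cons[_ [[s'T s'o] _]] ss' ls' _]]] := euclid_list hT.
exists s' => //; split=> // h hs'; have [? ? ?] := s'T _ hs'; have [? ?] := ls' _ hs'.
by split.
Qed.

End Euclid.


Variable size_of : R -> nat.
Hypothesis euclid : forall a b : R, a != 0 ->
  exists q, b - q * a = 0 \/ (size_of (b - q * a) < size_of a)%N.

Lemma is_submodule_ker T (l : M -> R) : is_submodule T -> functional l ->
  is_submodule (fun x => T x /\ l x = 0).
Proof.
move=> [T0 TD TZ] ll; split; first by split=> //; exact: functional0.
  by move=> x y [Tx x0] [Ty y0]; split; [exact: TD | rewrite functionalD // x0 y0 addr0].
by move=> a x [Tx x0]; split; [exact: TZ | rewrite functionalZ // x0 mulr0].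
Qed.

Definition perp_to T u x := T x /\ forall h, h \in u -> lam h.1 x = 0 /\ lam h.2 x = 0.

Lemma is_submodule_perp T u : is_submodule T -> is_submodule (perp_to T u).
Proof.
move=> [T0 TD TZ]; split; first by split=> // h _; rewrite !lam0r.
  move=> x y [Tx hx] [Ty hy]; split; first exact: TD.
  move=> h hu; have [x1 x2] := hx h hu; have [y1 y2] := hy h hu.
  by rewrite !lamE x1 x2 y1 y2 addr0.
move=> a x [Tx hx]; split; first exact: TZ.
by move=> h hu; have [x1 x2] := hx h hu; rewrite !lamE x1 x2 mulr0.
Qed.

Lemma hyp_list_map T T' (f : M -> M) s :
  (forall x, T x -> T' (f x) /\ mu (f x) = mu x) ->
  (forall x y, T x -> T y -> lam (f x) (f y) = lam x y) ->
  hyp_list T s -> hyp_list T' [seq (f h.1, f h.2) | h <- s].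
Proof.
move=> fT fl; elim: s => [|h s IH]; first by [].
move=> /hyp_list_cons[[[h1 h2 h3 h4 h5] Th1 Th2] [sT hs]].
apply/hyp_list_cons; split; last split; last 1 first.
- rewrite all_map; apply/allP => k ks /=.
  have [_ Tk1 Tk2] := sT.1 k ks; have /orthP[o1 o2 o3 o4] := allP hs _ ks.
  by apply/orthP; split; rewrite /= fl.
- have [T'1 m1] := fT _ Th1; have [T'2 m2] := fT _ Th2.
  by split=> //=; split; rewrite /= ?m1 ?m2 ?fl.
exact: IH.
Qed.

Lemma lam_shift e x y a b : lam e e = 0 -> lam e x = 0 -> lam e y = 0 ->
  lam (x + a *: e) (y + b *: e) = lam x y.
Proof.
move=> ee ex ey; rewrite !lamE ee ey (lam_sym ex).
by rewrite !(mulr0, addr0).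
Qed.

Lemma mu_shift e x a : mu e = 0 -> lam e x = 0 -> mu (x + a *: e) = mu x.
Proof.
move=> e0 ex; rewrite mu_orthD ?muZ0 ?addr0 //.
by rewrite lamE (lam_sym ex) mulr0.
Qed.

(** The projection along [h.1] of the orthogonal of [h.1] onto that of [h]. It is
    an isometry because [h.1] is isotropic and orthogonal to its domain
    ([lam_shift], [mu_shift]). *)
Definition strip h x := x + (- (eps * lam h.2 x)) *: h.1.

Lemma strip_perp h x : hyp h -> lam h.1 x = 0 ->
  lam h.1 (strip h x) = 0 /\ lam h.2 (strip h x) = 0.
Proof.
move=> [h1 h2 h3 h4 h5] hx; rewrite /strip !lamE hx h2 mulr0 addr0; split=> //.
rewrite [lam h.2 h.1]qm_lambdaC h1 mulr1.
have := eps_sqr P; move: (fp_eps P) => E EE.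
have -> : lam h.2 x + - (E * lam h.2 x) * E = lam h.2 x * (1 - E * E) by ring.
by rewrite EE subrr mulr0.
Qed.

Definition perp_pair T h x := [/\ T x, lam h.1 x = 0 & lam h.2 x = 0].

Lemma hyp_list_strip T h s : is_submodule T -> hyp h -> T h.1 ->
  hyp_list (fun x => T x /\ lam h.1 x = 0) s ->
  hyp_list (perp_pair T h) [seq (strip h k.1, strip h k.2) | k <- s].
Proof.
move=> [T0 TD TZ] hh Th1; have [h1 h2 h3 h4 h5] := hh.
apply: hyp_list_map => [x [Tx hx]|x y [Tx hx] [Ty hy]]; last exact: lam_shift.
split; last exact: mu_shift.
have [p1 p2] := strip_perp hh hx; split=> //.
by apply: TD => //; exact: TZ.
Qed.

(** Dividing the orthogonal of [h.1] by [h.1] gives the orthogonal of the whole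
    pair, so only one pair is lost, although two linear conditions are imposed. This
    plays the part of Witt cancellation. *)
Lemma genus_perp_pair T h g : is_submodule T -> hyp h -> T h.1 -> genus T g ->
  genus (perp_pair T h) g.-1.
Proof.
move=> Tsub hh Th1 /(genus_ker euclid Tsub (lam_functional h.1)) [s sT <-].
exists [seq (strip h k.1, strip h k.2) | k <- s]; last by rewrite size_map.
exact: hyp_list_strip.
Qed.

Lemma is_submodule_perp_pair T h : is_submodule T -> is_submodule (perp_pair T h).
Proof.
move=> [T0 TD TZ]; split; first by split; rewrite ?lam0r.
  by move=> x y [Tx x1 x2] [Ty y1 y2]; split; rewrite ?lamE ?x1 ?x2 ?y1 ?y2 ?addr0 //;
    exact: TD.
by move=> a x [Tx x1 x2]; split; rewrite ?lamE ?x1 ?x2 ?mulr0 //; exact: TZ.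
Qed.

Lemma genus_perp T u g : is_submodule T -> hyp_list T u -> genus T g ->
  genus (perp_to T u) (g - size u).
Proof.
elim: u T g => [|h u IH] T g Tsub uT gT.
  by rewrite subn0; apply: genus_sub gT.
have [[hh Th1 Th2] [uT' hu]] := (hyp_list_cons _ _ _).1 uT.
have uT2 : hyp_list (perp_pair T h) u.
  split; last by case: uT'.
  move=> k ku; have [kh Tk1 Tk2] := uT'.1 k ku.
  by have /orthP[o1 o2 o3 o4] := allP hu _ ku.
have := IH _ _ (is_submodule_perp_pair h Tsub) uT2 (genus_perp_pair Tsub hh Th1 gT).
rewrite /= -subn1 -subnDA add1n; apply: genus_sub => x [[Tx x1 x2] xu].
by split=> // k; rewrite inE => /orP[/eqP ->|/xu].
Qed.

Section Contractibility.
Variable RR : realType.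

Lemma hyp_push T T1 F m D (C C0 : RR) : (m <= D)%N -> 0 <= C -> 0 <= C0 ->
  (forall x, T1 x -> T x) -> (forall s, hyp_list T s -> F s) ->
  (forall u, hyp_list T u -> (0 < size u)%N ->
     contractible (hyp_list (perp_to T1 u)) (hyp_list (perp_to T1 u)) (m - size u) C) ->
  contractible (hyp_list T1) F m C0 ->
  contractible (hyp_list T) F m (push_bound D C C0).
Proof.
move=> mD C_ge0 C0_ge0 T1T TF links base.
pose X : pred (M * M) := fun h => `[< T1 h.1 /\ T1 h.2 >].
apply: (@push_contractible _ _ X) => //.
- exact: hyp_list_closed.
- move=> u v _ uT; set uv := rcons u v in uT *.
  have suv : size uv = (size u).+1 by rewrite size_rcons.
  have E w : (all X w /\ hyp_list T (uv ++ w)) <-> hyp_list (perp_to T1 uv) w.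
    rewrite /hyp_list pairwise_cat; split.
      move=> [/allP Xw [uwT /and3P[/allrelP uw _ ow]]]; split=> // h hw.
      have huw : h \in uv ++ w by rewrite mem_cat hw orbT.
      have [hh _ _] := uwT h huw.
      have /asboolP[Th1 Th2] := Xw h hw.
      by split=> //; split=> // k ku; have /orthP[] := uw _ _ ku hw.
    move=> [wT ow]; split.
      by apply/allP => h /wT[_ [Th1 _] [Th2 _]]; apply/asboolP.
    split.
      move=> h; rewrite mem_cat => /orP[/uT.1 //|/wT[hh [Th1 _] [Th2 _]]].
      by split=> //; exact: T1T.
    rewrite uT.2 ow !andbT; apply/allrelP => k h ku /wT[_ [_ h1] [_ h2]].
    by have [? ?] := h1 k ku; have [? ?] := h2 k ku; apply/orthP.
  have := links uv uT; rewrite suv => /(_ isT).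
  by apply: contractibleW => // w /E.
apply: contractibleW base => // s [/allP Xs [sT os]]; split=> // h hs.
have [hh _ _] := sT h hs; have /asboolP[Th1 Th2] := Xs h hs.
by split.
Qed.

(** Let [h] be a hyperbolic pair in [T]. The pairs orthogonal to [h] form a
    complex over which [h] is a cone point. It is reached in two reductions: to
    the pairs orthogonal to [h.1], and then to those orthogonal to [h.2] too. A
    link of [u] has genus at least [g - size u - 1] each time: in the second reduction
    [u] is orthogonal to [h.1], hence it can be replaced by its projection [strip h] with the
    same link. As [size u] is positive, this is at least [g - 2 * size u], which is
    what the range [g./2 - size u] requires. A single reduction would lose one more
    pair. *)
Theorem hyp_list_contractible N : exists2 C : RR, 0 <= C &
  forall g, (g <= N)%N -> forall T, is_submodule T -> genus T g ->
  contractible (hyp_list T) (hyp_list T) g./2 C.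
Proof.
elim: N => [|N [C C_ge0 IH]].
  by exists 0 => // g; rewrite leqn0 => /eqP -> T _ _; exists (fun=> 0).
pose C1 : RR := push_bound N.+1 C 1.
have C1_ge0 : 0 <= C1 by exact: push_bound_ge0.
have C2_ge0 : 0 <= push_bound N.+1 C C1 by exact: push_bound_ge0.
exists (C + push_bound N.+1 C C1) => [|g]; first exact: addr_ge0.
rewrite leq_eqVlt => /orP[/eqP ->{g}|gN] T Tsub gT; last first.
  by apply: contractibleW (IH g gN T Tsub gT) => //; rewrite lerDl.
suff: contractible (hyp_list T) (hyp_list T) (N.+1)./2 (push_bound N.+1 C C1).
  by apply: contractibleW => //; rewrite lerDr.
have [[//|h s] /hyp_list_cons[[hh Th1 Th2] _] _] := gT.
pose T1 x := T x /\ lam h.1 x = 0.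
pose T2 := perp_pair T h.
have T1sub : is_submodule T1 by exact: (is_submodule_ker Tsub (lam_functional h.1)).
have T2sub : is_submodule T2 by exact: is_submodule_perp_pair.
have half_le : (N.+1./2 <= N.+1)%N by rewrite -divn2 leq_div.
have base : contractible (hyp_list T2) (hyp_list T) N.+1./2 (1 : RR).
  apply: (@cone_contractible _ _ _ _ _ h) => u [uT2 ou]; apply/hyp_list_cons.
  split=> //; split.
    by split=> // k /uT2[kh [Tk1 _ _] [Tk2 _ _]].
  by apply/allP => k /uT2[_ [_ ? ?] [_ ? ?]]; apply/orthP.
have contr1 : contractible (hyp_list T1) (hyp_list T) N.+1./2 C1.
  apply: (@hyp_push T1 T2) => //.
  - by move=> x [].
  - by move=> u [uT1 ou]; split=> // k /uT1[kh [? _] [? _]].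
  move=> u uT1 u_gt0.
  have g2 : genus T2 N by exact: (genus_perp_pair Tsub hh Th1 gT).
  have := genus_perp T2sub (hyp_list_strip Tsub hh Th1 uT1) g2.
  rewrite size_map => gu.
  have gu' : genus (perp_to T2 u) (N - size u).
    apply: genus_sub gu => x [[Tx x1 x2] xu]; split=> // k ku.
    have /= := xu (strip h k.1, strip h k.2) (map_f _ ku).
    by rewrite /strip !lamE x1 !mulr0 !addr0.
  have := IH _ (leq_subr _ _) _ (is_submodule_perp u T2sub) gu'.
  apply: contractibleW => //.
  by move: u_gt0; clear; rewrite -!divn2; lia.
apply: (@hyp_push T T1) => //; first by move=> x [].
move=> u uT u_gt0.
have := genus_ker euclid (is_submodule_perp u Tsub) (lam_functional h.1)
  (genus_perp Tsub uT gT).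
move=> gu.
have gu' : genus (perp_to T1 u) (N.+1 - size u).-1.
  by apply: genus_sub gu => x [[Tx xu] x1].
have le : ((N.+1 - size u).-1 <= N)%N by move: u_gt0; clear; lia.
have := IH _ le _ (is_submodule_perp u T1sub) gu'.
apply: contractibleW => //.
by move: u_gt0; clear; rewrite -!divn2; lia.
Qed.

End Contractibility.

End HyperbolicPairs.

(** * Hyperbolic split injections *)

Section MorphismLists.
Variables (R : comPzRingType) (P : form_parameter R) (M : quadratic_module P).
Hypothesis Lambda_sqr : forall a b : R, b \in fp_Lambda P -> a ^+ 2 * b \in fp_Lambda P.
Local Notation H k := (qm_power (hyperbolic P) k).
Local Notation pair := (R^o * R^o)%type.
Local Notation top := (fun _ => True).

Definition at_index k (i : 'I_k) (v : pair) : H k := [ffun j => if j == i then v else 0].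

Definition evec : pair := (1, 0).
Definition fvec : pair := (0, 1).

Lemma hyp_lambda0l (v : pair) : hyp_lambda P 0 v = 0.
Proof. by rewrite /hyp_lambda /= !mul0r mulr0 addr0. Qed.

Lemma hyp_lambda0r (v : pair) : hyp_lambda P v 0 = 0.
Proof. by rewrite /hyp_lambda /= !mulr0 addr0. Qed.

Lemma lambda_at_index k (i j : 'I_k) (u v : pair) :
  qm_lambda (at_index i u) (at_index j v) = if i == j then hyp_lambda P u v else 0.
Proof.
rewrite /= /pow_lambda (bigD1 i) //= big1 => [|l li].
  by rewrite !ffunE eqxx addr0; case: eqP => // _; rewrite hyp_lambda0r.
by rewrite !ffunE (negbTE li) hyp_lambda0l.
Qed.

Lemma mu_at_index k (i : 'I_k) (u : pair) :
  qm_mu (at_index i u) = to_mod_Lambda P (u.1 * u.2 : R).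
Proof.
rewrite /= /pow_mu (bigD1 i) //= big1 => [|l li]; first by rewrite ffunE eqxx addr0.
by rewrite ffunE (negbTE li) /hyp_mu /= mulr0 to_mod_Lambda0.
Qed.

Definition morphism_list k (f : qm_morphism (H k) M) : seq (M * M) :=
  codom (fun i => (f (at_index i evec), f (at_index i fvec))).

Lemma size_morphism_list k (f : qm_morphism (H k) M) : size (morphism_list f) = k.
Proof. by rewrite size_codom card_ord. Qed.

Lemma morphism_list_hyp k (f : qm_morphism (H k) M) : hyp_list top (morphism_list f).
Proof.
split.
  move=> h /codomP[i ->]; split=> //; split; rewrite /= ?qmm_lambda ?qmm_mu;
    rewrite ?lambda_at_index ?mu_at_index ?eqxx /hyp_lambda /=;
    by rewrite ?(mulr0, mul0r, mulr1, addr0) ?to_mod_Lambda0.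
case: k f => [|k] f.
  by rewrite (size0nil (size_morphism_list f)).
apply/(pairwiseP (0, 0)) => i j; rewrite !inE size_morphism_list => lti ltj ltij.
rewrite (nth_codom_ord _ _ (Ordinal lti)) (nth_codom_ord _ _ (Ordinal ltj)).
have ij : (Ordinal lti == Ordinal ltj) = false.
  by apply/eqP => /(congr1 val) /= e; rewrite e ltnn in ltij.
by apply/orthP; split; rewrite /= qmm_lambda lambda_at_index ij.
Qed.

Lemma sum_at_index k (x : H k) :
  x = \sum_(i < k) ((x i).1 *: at_index i evec + (x i).2 *: at_index i fvec) :> H k.
Proof.
apply/ffunP => j; rewrite sum_ffunE (bigD1 j) //= big1 ?addr0 => [|i ij].
  rewrite !ffunE eqxx; case: (x j) => a b; rewrite /evec /fvec /=.
  by congr (_, _); rewrite /= /GRing.scale /= ?(mulr1, mulr0, addr0, add0r).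
by rewrite !ffunE eq_sym (negbTE ij) !scaler0 addr0.
Qed.

Lemma morphism_sum k (f : qm_morphism (H k) M) x :
  f x = \sum_(i < k) ((x i).1 *: f (at_index i evec) + (x i).2 *: f (at_index i fvec)).
Proof.
have lf := qmm_linear f.
have fD y z : f (y + z) = f y + f z by rewrite -{1}[y]scale1r lf scale1r.
have f0 : f 0 = 0.
  by have := lf (-1) 0 0; rewrite scaler0 addr0 scaleN1r addNr.
have fZ a y : f (a *: y) = a *: f y by rewrite -[a *: y]addr0 lf f0 addr0.
rewrite {1}(sum_at_index x); elim/big_rec2: _ => [//|i a w _ IH].
by rewrite fD IH fD !fZ.
Qed.

Lemma lam_sum0 k (F : 'I_k -> M) (r : seq 'I_k) y :
  (forall i, i \in r -> qm_lambda (F i) y = 0) -> qm_lambda (\sum_(i <- r) F i) y = 0.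
Proof.
move=> Fy; rewrite big_seq; elim/big_rec: _ => [|i x ir IH]; first exact: lam0l.
by rewrite lamDl Fy // IH addr0.
Qed.

Lemma lam_orth_sum k (F G : 'I_k -> M) (r : seq 'I_k) : uniq r ->
  (forall i j, i != j -> qm_lambda (F i) (G j) = 0) ->
  qm_lambda (\sum_(i <- r) F i) (\sum_(i <- r) G i) =
  \sum_(i <- r) qm_lambda (F i) (G i).
Proof.
move=> + FG; elim: r => [|i r IH] /=; first by rewrite !big_nil lam0l.
move=> /andP[ir /IH e]; rewrite !big_cons lamDl !lamDr e.
rewrite (@lam_sum0 _ F r (G i)) ?add0r => [|j jr]; last first.
  by apply: FG; apply: contraNneq ir => <-.
suff -> : qm_lambda (F i) (\sum_(j <- r) G j) = 0 by rewrite addr0.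
apply/lam_sym/lam_sum0 => j jr; apply/lam_sym/FG.
by apply: contraNneq ir => ->.
Qed.

Lemma mu_orth_sum k (F : 'I_k -> M) (r : seq 'I_k) : uniq r ->
  (forall i j, i != j -> qm_lambda (F i) (F j) = 0) ->
  qm_mu (\sum_(i <- r) F i) = \sum_(i <- r) qm_mu (F i).
Proof.
move=> + FF; elim: r => [|i r IH] /=; first by rewrite !big_nil qm_mu0.
move=> /andP[ir /IH e]; rewrite !big_cons mu_orthD ?e //.
apply/lam_sym/lam_sum0 => j jr; apply: FF.
by apply: contraNneq ir => <-.
Qed.

(** The linear map that sends the standard pairs to those of [s] is a morphism, as
    lambda and mu are determined by their values on pairwise orthogonal
    hyperbolic pairs. *)
Lemma morphism_list_surj k s : hyp_list top s -> size s = k ->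
  exists f : qm_morphism (H k) M, morphism_list f = s.
Proof.
move=> [sT os] ss.
pose e (i : 'I_k) := (nth (0, 0) s i).1; pose f (i : 'I_k) := (nth (0, 0) s i).2.
have s_hyp (i : 'I_k) : hyp (nth (0, 0) s i).
  have si : nth (0, 0) s i \in s by apply: mem_nth; rewrite ss.
  by have [] := sT _ si.
have s_orth (i j : 'I_k) : i != j -> orth (nth (0, 0) s i) (nth (0, 0) s j).
  move=> ij; case: (ltngtP i j) => [lt|lt|/val_inj eij].
  - by apply: (pairwiseP (0, 0) os) => //; rewrite inE ss.
  - by apply: orth_sym; apply: (pairwiseP (0, 0) os) => //; rewrite inE ss.
  - by rewrite eij eqxx in ij.
pose F (x : H k) i := (x i).1 *: e i + (x i).2 *: f i.
have F_orth x y i j : i != j -> qm_lambda (F x i) (F y j) = 0.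
  move=> /s_orth /orthP[o1 o2 o3 o4].
  by rewrite /F !lamE o1 o2 o3 o4 !(mulr0, addr0).
have phi_lin : linear (fun x : H k => \sum_i F x i).
  move=> a x y; rewrite scaler_sumr -big_split; apply: eq_bigr => i _ /=.
  by rewrite /F !ffunE /= !scalerDl scalerDr -!scalerA addrACA.
have phi_lam x y : qm_lambda (\sum_i F x i) (\sum_i F y i) = qm_lambda x y.
  rewrite lam_orth_sum; [|exact: index_enum_uniq|exact: F_orth].
  apply: eq_bigr => i _; have [h1 h2 h3 _ _] := s_hyp i.
  rewrite /F !lamE h1 h2 h3 [qm_lambda (f i) (e i)]qm_lambdaC h1 /= /hyp_lambda.
  by ring.
have phi_mu x : qm_mu (\sum_i F x i) = qm_mu x.
  rewrite mu_orth_sum; [|exact: index_enum_uniq|exact: F_orth].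
  apply: eq_bigr => i _; have [h1 h2 h3 h4 h5] := s_hyp i.
  rewrite /F muD !muZ0 // !add0r !lamE h1 mulr1.
  by [].
exists (QmMorphism phi_lin phi_lam phi_mu).
apply: (@eq_from_nth _ (0, 0)); first by rewrite size_morphism_list ss.
move=> i; rewrite size_morphism_list => lti.
rewrite (nth_codom_ord _ _ (Ordinal lti)) /= -[nth _ s i]/(nth (0, 0) s (Ordinal lti)).
have single v : \sum_j F (at_index (Ordinal lti) v) j =
    v.1 *: e (Ordinal lti) + v.2 *: f (Ordinal lti).
  rewrite (bigD1 (Ordinal lti)) //= /F ffunE eqxx big1 ?addr0 // => j ji.
  by rewrite ffunE (negbTE ji) /= !scale0r addr0.
rewrite !single /= !scale1r !scale0r addr0 add0r /e /f.
by case: (nth _ _ _).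
Qed.

Lemma insert_at_index k (i : 'I_k.+1) (j : 'I_k) v :
  qm_insert (hyperbolic P) i (at_index j v) = at_index (lift i j) v.
Proof.
apply/ffunP => l; rewrite !ffunE; case: unliftP => [m ->|->] /=.
  by rewrite ffunE (inj_eq lift_inj).
by rewrite (negbTE (neq_lift i j)).
Qed.

End MorphismLists.

Definition qm_id (R : comPzRingType) (P : form_parameter R) (M : quadratic_module P) :
  qm_morphism M M := @QmMorphism _ _ M M id (fun a x y => erefl) (fun x y => erefl)
    (fun x => erefl).

(** The genus of the target is read off the identity morphism. *)
Lemma hyperbolic_split_injections_vanishing (RR : realType) (R : comPzRingType)
    (P : form_parameter R) (size_of : R -> nat) (n : nat) :
  (forall a b : R, b \in fp_Lambda P -> a ^+ 2 * b \in fp_Lambda P) ->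
  (forall a b : R, a != 0 ->
    exists q, b - q * a = 0 \/ (size_of (b - q * a)%R < size_of a)%N) ->
  reduced_bH_vanishes_up_to RR
    (hyperbolic_split_injections (qm_power (hyperbolic P) n))
    (((n%:Z - 4) %/ 2)%Z)%:E.
Proof.
move=> Lambda_sqr euclid; set M := qm_power _ n.
have [C _ contr] := @hyp_list_contractible R P M Lambda_sqr size_of euclid RR n.
have genusM : genus (fun _ : M => True) n.
  exists (morphism_list (qm_id M)); last exact: size_morphism_list.
  exact: morphism_list_hyp.
have sub : is_submodule (fun _ : M => True) by [].
have {}contr := contr n (leqnn n) _ sub genusM.
apply: (@vanishing_of_contractible _ _ _ (hyp_list (fun _ : M => True))
  (fun p (f : hyperbolic_split_injections M p) => morphism_list (k := p.+1) f)
  (@hyp_list_closed _ _ _ _) _ _ _ _ _ _ _ _ _ contr).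
- by move=> p f; exact: size_morphism_list.
- by move=> p f; exact: morphism_list_hyp.
- move=> p f g fg; apply: qm_morphism_inj; apply/funext => x.
  rewrite !morphism_sum; apply: eq_bigr => i _.
  have := congr1 (fun s => nth (0, 0) s i) fg.
  by rewrite /morphism_list !nth_codom_ord => -[-> ->].
- by move=> p s sT ss; exact: morphism_list_surj.
- move=> p f i; rewrite -codom_lift; apply: eq_codom => j.
  by rewrite -!(insert_at_index P i j).
- by [].
by move=> k; rewrite lee_fin -divn2; lia.
Qed.

Lemma hyperbolic_vanishing_int (RR : realType) (P : form_parameter int) n :
  reduced_bH_vanishes_up_to RR
    (hyperbolic_split_injections (qm_power (hyperbolic P) n))
    (((n%:Z - 4) %/ 2)%Z)%:E.
Proof.
apply: (@hyperbolic_split_injections_vanishing _ _ _ absz).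
  move=> a b bL; have -> : a ^+ 2 * b = b *+ (`|a| ^ 2)%N.
    by rewrite -mulr_natl natrX natz abszE real_normK ?num_real.
  exact: rpredMn.
move=> a b a0; exists (b %/ a)%Z; right.
have -> : b - (b %/ a)%Z * a = (b %% a)%Z by rewrite {1}(divz_eq b a) addrC addKr.
rewrite -ltz_nat gez0_abs ?modz_ge0 //.
by rewrite ltz_mod.
Qed.

(** In characteristic zero Lambda is 0 if epsilon = 1, and everything if
    epsilon = -1. *)
Lemma hyperbolic_vanishing_field (RR : realType) (F : fieldType) :
  [pchar F] =i pred0 -> forall (P : form_parameter F) n,
  reduced_bH_vanishes_up_to RR
    (hyperbolic_split_injections (qm_power (hyperbolic P) n))
    (((n%:Z - 4) %/ 2)%Z)%:E.
Proof.
move=> char0 P n.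
have two_neq0 : 2%:R != 0 :> F.
  by have := char0 2; rewrite !inE /= => /negbT.
apply: (@hyperbolic_split_injections_vanishing _ _ _ (fun=> 0%N)); last first.
  by move=> a b a0; exists (b / a); left; rewrite divfK // subrr.
move=> a b bL; case: (fp_epsP P) => e.
  have := fp_max bL; rewrite e mul1r -mulr2n -mulr_natl => /eqP.
  by rewrite mulf_eq0 (negbTE two_neq0) /= => /eqP ->; rewrite mulr0 rpred0.
have := fp_min P (a ^+ 2 * b / 2%:R).
rewrite e mulN1r opprK (_ : _ + _ = a ^+ 2 * b) //.
by rewrite -mulrDl -mulr2n -[_ *+ 2]mulr_natr mulfK.
Qed.

(** * Vanishing of reduced bounded cohomology *)

Theorem theoremA (RR : realType) :
  [/\ forall (K : fieldType) (n : nat),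
        reduced_bH_vanishes_up_to RR (tits_building_A K n) (n%:Z - 3)%:E,
      forall (R : pzRingType) (n : nat),
        reduced_bH_vanishes_up_to RR (split_injections R n)
          (n%:Z%:E - stable_rank R - 1%:E)%E,
      forall (K : fieldType) (n : nat),
        reduced_bH_vanishes_up_to RR (tits_building_C K n) (n%:Z - 2)%:E,
      forall (P : form_parameter int) (n : nat),
        reduced_bH_vanishes_up_to RR
          (hyperbolic_split_injections (qm_power (hyperbolic P) n))
          (((n%:Z - 4) %/ 2)%Z)%:E
    & forall (F : fieldType), [pchar F] =i pred0 ->
      forall (P : form_parameter F) (n : nat),
        reduced_bH_vanishes_up_to RR
          (hyperbolic_split_injections (qm_power (hyperbolic P) n))
          (((n%:Z - 4) %/ 2)%Z)%:E].
Proof.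
split.
- exact: tits_building_A_vanishing.
- exact: split_injections_vanishing.
- exact: tits_building_C_vanishing.
- exact: hyperbolic_vanishing_int.
- exact: hyperbolic_vanishing_field.
Qed.
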